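(* The singular vectors of degree one in the $E(5,10)$-modules $M(\lambda)$, $\lambda\in\mathbb{N}^4$, are, up to nonzero scalar multiples, exactly the following (here $\mathrm{wt}(d_{15})=(1,0,0,-1)$, $\mathrm{wt}(d_{45})=(0,0,-1,0)$, and products are over weights $\sigma$ of $V(\omega_2)$): (i) $d_{12}v_\lambda$, where $\lambda=(m,n,0,0)$, $m,n\in\mathbb{N}$; (ii) $\displaystyle\prod_{\mathrm{wt}(d_{15})<\sigma\le\omega_2}\frac{\tilde c-\chi_{\sigma+\lambda}(\tilde c)}{\chi_{\mathrm{wt}(d_{15})+\lambda}(\tilde c)-\chi_{\sigma+\lambda}(\tilde c)}\,.\,d_{15}v_\lambda$, where $\lambda=(m,0,0,n)$, $m\in\mathbb{N}$, $1\le n\in\mathbb{N}$; (iii) $\displaystyle\prod_{\mathrm{wt}(d_{45})<\sigma\le\omega_2}\frac{\tilde c-\chi_{\sigma+\lambda}(\tilde c)}{\chi_{\mathrm{wt}(d_{45})+\lambda}(\tilde c)-\chi_{\sigma+\lambda}(\tilde c)}\,.\,d_{45}v_\lambda$, where $\lambda=(0,0,m,n)$, $1\le m\in\mathbb{N}$, $n\in\mathbb{N}$.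
   Context: The ground field is $\mathbb{C}$. The Lie superalgebra $L=E(5,10)$: its even part is $S_5$, the Lie algebra of divergence-free formal vector fields $\sum_{i=1}^5 p_i\partial_i$, $p_i\in\mathbb{C}[[x_1,\dots,x_5]]$, with the usual bracket; its odd part is the space of closed formal differential 2-forms in $x_1,\dots,x_5$. The even part acts on the odd part by Lie derivative. With $d_{ij}=dx_i\wedge dx_j$, the odd-odd bracket is given (bilinearly) by $[f d_{jk},g d_{lm}]=\sum_i\varepsilon_{ijklm}fg\,\partial_i$, where $\varepsilon_{ijklm}$ is the sign of the permutation $(ijklm)$ if the indices are distinct, and $0$ otherwise. Gradation: $\deg x_i=2$, $\deg\partial_i=-2$, $\deg d_{ij}=-1$; $L_j$ ($j\ge-2$) is the degree $j$ component, $L_+$ the positive part, $L_-=L_{-2}+L_{-1}$, $L_{\ge0}=L_0+L_+$. $L_0\cong sl_5$ via $x_i\partial_j\leftrightarrow E_{ij}$; the Borel subalgebra contains $x_i\partial_j$ ($i<j$); $\alpha_i,\omega_i$ ($1\le i\le 4$) are the simple roots and fundamental weights, and weights are written in coordinates with respect to $\omega_1,\dots,\omega_4$. $V(\lambda)$ is the finite-dimensional irreducible $L_0$-module of highest weight $\sum_i\lambda_i\omega_i$ with highest weight vector $v_\lambda$, with $L_+$ acting trivially, and $M(\lambda)=U(L)\otimes_{U(L_{\ge0})}V(\lambda)\cong U(L_-)\otimes V(\lambda)$. A singular vector is a nonzero $\xi\in M(\lambda)$ with $(x_i\partial_{i+1}).\xi=0$ for $1\le i\le4$ and $(x_5d_{45}).\xi=0$.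 Degree-one vectors are the nonzero vectors $\sum_{i<j}d_{ij}v_{ij}$, $v_{ij}\in V(\lambda)$; their span is identified with $W\otimes V(\lambda)$, where $W=L_{-1}=\mathrm{Span}\{d_{ij}\}\cong V(\omega_2)$. The operator $\tilde c$ on $W\otimes V(\lambda)$ is $$\tilde c=\frac1{10}\Big[\sum_{i=1}^4h_i\otimes h_i^*+\sum_{1\le i\ne j\le5}E_{ij}\otimes E_{ji}\Big],$$ where $h_i=E_{ii}-E_{i+1,i+1}$ and $h_1^*=\frac45h_1+\frac35h_2+\frac25h_3+\frac15h_4$, $h_2^*=\frac35h_1+\frac65h_2+\frac45h_3+\frac25h_4$, $h_3^*=\frac25h_1+\frac45h_2+\frac65h_3+\frac35h_4$, $h_4^*=\frac15h_1+\frac25h_2+\frac35h_3+\frac45h_4$. With $\delta=\sum_i\omega_i$, $\mu=\omega_2$, and $(\cdot,\cdot)$ the form on weights induced by the Killing form ($(\alpha_i,\alpha_i)=\frac15$, $(\alpha_i,\alpha_{i\pm1})=-\frac1{10}$, $(\alpha_i,\alpha_j)=0$ otherwise), $$\chi_{\sigma+\lambda}(\tilde c)=\tfrac12\big[(\sigma+\lambda,\sigma+\lambda+2\delta)-(\mu,\mu+2\delta)-(\lambda,\lambda+2\delta)\big].$$ The order on weights is: $\tau\le\sigma$ iff $\sigma-\tau$ is a nonnegative integer combination of simple roots. *)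

(* Defs.v *)
From HB Require Import structures.
From mathcomp Require Import all_boot all_order all_fingroup all_algebra.
From mathcomp Require Import boolp classical_sets functions.
From mathcomp Require Import ring.

Set Implicit Arguments.
Unset Strict Implicit.
Unset Printing Implicit Defensive.

Import GRing.Theory Num.Theory.
Local Open Scope ring_scope.

(* Monomials in x_1, ..., x_5. The indices 1, ..., 5 of the variables are
   represented by the elements 0, ..., 4 of 'I_5. *)
Definition mon := {ffun 'I_5 -> nat}.

Definition mdeg5 (m : mon) : nat := (\sum_i m i)%N.

Definition mvar (i : 'I_5) : mon := [ffun j => nat_of_bool (j == i)].

(* All pairs (a, b) of monomials with a + b = m. *)
Definition splits (m : mon) : seq (mon * mon) :=
  let bounded := enum {ffun 'I_5 -> 'I_(mdeg5 m).+1} in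
  let to_mon (a : {ffun 'I_5 -> 'I_(mdeg5 m).+1}) : mon :=
    [ffun i => nat_of_ord (a i)] in
  [seq q <- [seq (to_mon a, to_mon b) | a <- bounded, b <- bounded]
  | q.1 + q.2 == m].

Lemma splits_uniq m : uniq (splits m).
Proof.
apply: filter_uniq; apply: allpairs_uniq; rewrite ?enum_uniq //.
move=> [a b] [a' b'] _ _ [] /ffunP ha /ffunP hb.
by congr (_, _); apply/ffunP => i; apply/val_inj;
   [move: (ha i) | move: (hb i)]; rewrite !ffunE.
Qed.

Lemma leq_mdeg5 (m : mon) i : (m i <= mdeg5 m)%N.
Proof. by rewrite /mdeg5 (bigD1 i) //= leq_addr. Qed.

Lemma mon_addI (c : mon) : injective (fun a : mon => a + c).
Proof.
move=> a b /ffunP e; apply/ffunP => i.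
by move: (e i); rewrite !ffunE => /addIn.
Qed.

Lemma monD_mvar (a : mon) i : (a + mvar i) i = (a i).+1.
Proof. by rewrite !ffunE eqxx; exact: addn1. Qed.

Lemma mem_splits m (q : mon * mon) : (q \in splits m) = (q.1 + q.2 == m).
Proof.
rewrite mem_filter; case: eqP => //= <-.
have lt1 i : (q.1 i < (mdeg5 (q.1 + q.2)%R).+1)%N.
  by rewrite ltnS (leq_trans _ (leq_mdeg5 _ i)) // ffunE leq_addr.
have lt2 i : (q.2 i < (mdeg5 (q.1 + q.2)%R).+1)%N.
  by rewrite ltnS (leq_trans _ (leq_mdeg5 _ i)) // ffunE leq_addl.
apply/allpairsP; exists ([ffun i => Ordinal (lt1 i)], [ffun i => Ordinal (lt2 i)]).
rewrite !mem_enum; split=> //=; case: q lt1 lt2 => a b lt1 lt2.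
by congr (_, _); apply/ffunP => i; rewrite !ffunE.
Qed.

Section PowerSeries.
Variable K : fieldType.

(* f : fps is the family of its coefficients. *)
Definition fps := mon -> K.

HB.instance Definition _ := GRing.Lmodule.copy fps (mon -> K^o).

Implicit Types f g h : fps.

Definition fone : fps := fun m => (m == 0)%:R.

Definition fmul f g : fps := fun m => \sum_(q <- splits m) f q.1 * g q.2.

Lemma fmulC : commutative fmul.
Proof.
move=> f g; apply/funext => m; rewrite /fmul.
rewrite [RHS](eq_bigr (fun q => f q.2 * g q.1)); last by move=> q _; rewrite mulrC.
rewrite -(big_map (fun q : mon * mon => (q.2, q.1)) predT
            (fun q => f q.1 * g q.2)).
apply: perm_big; apply: uniq_perm; rewrite ?splits_uniq //.
  rewrite map_inj_uniq ?splits_uniq //.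
  by move=> [a b] [c d] [-> ->].
move=> [a b]; rewrite mem_splits /=; apply/idP/mapP => [ab|[[c d]]].
  by exists (b, a) => //; rewrite mem_splits /= addrC.
by rewrite mem_splits /= => cd [-> ->]; rewrite addrC.
Qed.

Lemma fmulA : associative fmul.
Proof.
move=> f g h; apply/funext => m; rewrite /fmul.
under eq_bigr => p _ do rewrite big_distrr /=.
under [in RHS]eq_bigr => p _ do rewrite big_distrl /=.
pose F (t : mon * mon * mon) := f t.1.1 * (g t.1.2 * h t.2).
transitivity (\sum_(t <- [seq (p.1, q.1, q.2) | p <- splits m, q <- splits p.2]) F t).
  by rewrite big_allpairs_dep.
transitivity (\sum_(t <- [seq (q.1, q.2, p.2) | p <- splits m, q <- splits p.1]) F t);
  last first.
  rewrite big_allpairs_dep; apply: eq_bigr => p _; apply: eq_bigr => q _.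
  by rewrite /F /= mulrA.
apply: perm_big; apply: uniq_perm.
- apply: allpairs_uniq_dep => [|p _|]; rewrite ?splits_uniq //.
  move=> [[a b] [c d]] [[a' b'] [c' d']] /allpairsPdep[p [q [+ + E]]].
  case: p q E => [p1 p2] [q1 q2] [-> -> -> ->].
  rewrite !mem_splits /= => /eqP _ /eqP eb.
  move=> /allpairsPdep[p' [q' [+ + E]]].
  case: p' q' E => [p1' p2'] [q1' q2'] [-> -> -> ->].
  rewrite !mem_splits /= => /eqP _ /eqP eb' [e1 e2 e3].
  by subst.
- apply: allpairs_uniq_dep => [|p _|]; rewrite ?splits_uniq //.
  move=> [[a b] [c d]] [[a' b'] [c' d']] /allpairsPdep[p [q [+ + E]]].
  case: p q E => [p1 p2] [q1 q2] [-> -> -> ->].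
  rewrite !mem_splits /= => /eqP _ /eqP eb.
  move=> /allpairsPdep[p' [q' [+ + E]]].
  case: p' q' E => [p1' p2'] [q1' q2'] [-> -> -> ->].
  rewrite !mem_splits /= => /eqP _ /eqP eb' [e1 e2 e3].
  by subst.
move=> [[x y] z]; apply/allpairsPdep/allpairsPdep => -[p [q []]];
  rewrite !mem_splits => /eqP pm /eqP qp [-> -> ->].
- by exists (p.1 + q.1, q.2), (p.1, q.1); rewrite !mem_splits /= -addrA qp pm.
- by exists (q.1, q.2 + p.2), (q.2, p.2); rewrite !mem_splits /= addrA qp pm.
Qed.

Lemma fmul1 : left_id fone fmul.
Proof.
move=> f; apply/funext => m; rewrite /fmul.
have m0 : ((0, m) : mon * mon) \in splits m by rewrite mem_splits /= add0r.
rewrite (bigD1_seq (0, m)) ?splits_uniq //= /fone eqxx mul1r big1_seq ?addr0 //.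
move=> [a b] /andP[]; rewrite mem_splits /= => ne /eqP e.
case: eqP => [a0|_]; last by rewrite mul0r.
by move: ne; rewrite -e a0 add0r eqxx.
Qed.

Lemma fmulDl : left_distributive fmul +%R.
Proof.
move=> f g h; apply/funext => m.
by rewrite /fmul -[RHS]big_split; apply: eq_bigr => q _; exact: mulrDl.
Qed.

Lemma fone_neq0 : fone != 0.
Proof.
apply/eqP => /(congr1 (fun f : fps => f 0)) /eqP.
by rewrite /fone eqxx /= oner_eq0.
Qed.

HB.instance Definition _ := GRing.Zmodule_isComNzRing.Build fps
  fmulA fmulC fmul1 fmulDl fone_neq0.

Lemma fscaleAl (c : K) f g : c *: (f * g) = (c *: f) * g.
Proof.
apply/funext => m; rewrite /= -[_ * _]/(fmul _ _) -[RHS]/(fmul _ _ m) /fmul.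
rewrite -[LHS]/(c * \sum_(q <- _) _) big_distrr.
by apply: eq_bigr => q _; exact: mulrA.
Qed.

HB.instance Definition _ := GRing.Lmodule_isLalgebra.Build K fps fscaleAl.
HB.instance Definition _ := GRing.Lalgebra_isComAlgebra.Build K fps.

Definition fvar (i : 'I_5) : fps := fun m => (m == mvar i)%:R.

Definition fder (i : 'I_5) (f : fps) : fps :=
  fun m => (m i).+1%:R * f (m + mvar i).

Lemma fder_is_linear i : linear (fder i).
Proof.
move=> c f g; apply/funext => m; rewrite /fder.
exact: etrans (mulrDr _ _ _) (congr1 (+%R^~ _) (mulrCA _ _ _)).
Qed.

HB.instance Definition _ i :=
  GRing.isLinear.Build K fps fps _ (fder i) (fder_is_linear i).

Lemma fder_comm i j f : fder i (fder j f) = fder j (fder i f).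
Proof.
apply/funext => m; rewrite /fder !mulrA -!addrA [mvar j + _]addrC.
congr (_ * _); rewrite -!natrM !ffunE; congr (_%:R).
by case: (eqVneq i j) => [->//|ne]; rewrite /= !addr0 mulnC.
Qed.

Lemma fderM i f g : fder i (f * g) = fder i f * g + f * fder i g.
Proof.
have H (F : mon * mon -> K) m :
    \sum_(q <- splits (m + mvar i)) (q.1 i)%:R * F q =
    \sum_(q <- splits m) (q.1 i).+1%:R * F (q.1 + mvar i, q.2).
  pose G (q : mon * mon) : mon * mon := (q.1 + mvar i, q.2).
  have Gi : injective G by move=> [a b] [c d] [] /mon_addI -> ->.
  rewrite (bigID (fun q : mon * mon => (0 < q.1 i)%N)) /= [X in _ + X]big1 ?addr0;
    last by move=> q; rewrite lt0n negbK => /eqP ->; rewrite mul0r.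
  transitivity (\sum_(q <- splits m) ((G q).1 i)%:R * F (G q)); last first.
    by apply: eq_bigr => q _; rewrite /G /= monD_mvar.
  rewrite -big_filter.
  rewrite -[RHS](big_map G predT (fun q => (q.1 i)%:R * F q)).
  apply: perm_big; apply: uniq_perm.
    by rewrite filter_uniq ?splits_uniq.
    by rewrite map_inj_uniq ?splits_uniq.
  move=> [a b]; rewrite mem_filter mem_splits /=; apply/andP/mapP.
    move=> [ai /eqP e].
    pose a' : mon := [ffun j => (a j - mvar i j)%N].
    have ea : a = a' + mvar i.
      apply/ffunP => j; rewrite !ffunE; case: eqP => [->|_] /=.
        exact/esym/subnK.
      by rewrite subn0 addr0.
    exists (a', b); last by rewrite /G /= -ea.
    rewrite mem_splits /=; apply/eqP/(@mon_addI (mvar i)).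
    by rewrite addrAC -ea.
  move=> [[c d]]; rewrite mem_splits /= => /eqP <- [-> ->].
  by rewrite monD_mvar addrAC.
apply/funext => m; rewrite /fder.
transitivity (\sum_(q <- splits (m + mvar i)) (q.1 i)%:R * (f q.1 * g q.2)
   + \sum_(q <- splits (m + mvar i)) (q.1 i)%:R * (g q.1 * f q.2)); last first.
  rewrite !H; congr (_ + _).
    by apply: eq_bigr => q _; rewrite /fder mulrA.
  rewrite [f * _]mulrC.
  by apply: eq_bigr => q _; rewrite /fder mulrA.
have -> : \sum_(q <- splits (m + mvar i)) (q.1 i)%:R * (g q.1 * f q.2) =
          \sum_(q <- splits (m + mvar i)) (q.2 i)%:R * (f q.1 * g q.2).
  pose S (q : mon * mon) := (q.2, q.1).
  rewrite [LHS](eq_bigr (fun q => ((S q).2 i)%:R * (f (S q).1 * g (S q).2)));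
    last by move=> q _; rewrite /= [g _ * _]mulrC.
  rewrite -(big_map S predT (fun q => (q.2 i)%:R * (f q.1 * g q.2))) /=.
  apply: perm_big; apply: uniq_perm; rewrite ?splits_uniq //.
    by rewrite map_inj_uniq ?splits_uniq // => -[a b] [c d] [-> ->].
  move=> [a b]; rewrite mem_splits /=; apply/mapP/idP => [[[c d]]|ab].
    by rewrite mem_splits /= => cd [-> ->]; rewrite addrC.
  by exists (b, a) => //; rewrite mem_splits /= addrC.
rewrite -big_split /= -[_ * _]/(_ * \sum_(q <- _) _) big_distrr /=.
rewrite !big_seq; apply: eq_bigr => -[a b]; rewrite mem_splits /= => /eqP e.
rewrite -mulrDl -natrD; congr (_%:R * _).
by move/ffunP: e => /(_ i); rewrite monD_mvar !ffunE.
Qed.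

Lemma mon_addE_mvar (m : mon) i j : (m + mvar i == mvar j) = (m == 0) && (i == j).
Proof.
apply/eqP/andP => [e|[/eqP -> /eqP ->]]; last by rewrite add0r.
have ij : i == j.
  have : (m + mvar i) i = mvar j i by rewrite e.
  by rewrite monD_mvar ffunE; case: (i == j).
split=> //; apply/eqP/(@mon_addI (mvar i)).
by rewrite e add0r (eqP ij).
Qed.

Lemma fder_var i j : fder i (fvar j) = (i == j)%:R.
Proof.
apply/funext => m; rewrite /fder /fvar mon_addE_mvar.
case: (eqVneq i j) => _; last by rewrite andbF mulr0.
rewrite andbT -[RHS]/((m == 0)%:R); case: eqP => [->|_]; last by rewrite mulr0.
by rewrite ffunE mulr1.
Qed.

Lemma fder_nat i n : fder i (n%:R : fps) = 0.
Proof.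
rewrite raddfMn /=; suff -> : fder i 1 = 0 by rewrite mul0rn.
apply/funext => m; rewrite /fder [X in _ * X](_ : _ = (m + mvar i == 0)%:R) //.
case: eqP => [e|_]; last by rewrite mulr0.
have : (m + mvar i) i = (0 : mon) i by rewrite e.
by rewrite monD_mvar ffunE.
Qed.

End PowerSeries.

(* The ground field is meant to be C; the odd-odd bracket of closed forms needs
   characteristic 0 to be divergence-free. *)
Section E510.
Variable K : numFieldType.
Local Notation fps := (fps K).

(* X stands for \sum_i X i \partial_i. *)
Definition vfield := {ffun 'I_5 -> fps}.

(* w stands for \sum_(j < k) w (j, k) dx_j /\ dx_k; in [closed2] below, w is
   required to be antisymmetric. *)
Definition form2 := {ffun 'I_5 * 'I_5 -> fps}.

Implicit Types (X Y : vfield) (w z : form2).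

Definition divfree : {pred vfield} := fun X => \sum_i fder i (X i) == 0.

Definition closed2 : {pred form2} := fun w =>
  [forall j, forall k, w (k, j) == - w (j, k)] &&
  [forall i, forall j, forall k,
     fder i (w (j, k)) + fder j (w (k, i)) + fder k (w (i, j)) == 0].

Lemma divfreeP X : reflect (\sum_i fder i (X i) = 0) (X \in divfree).
Proof. exact: eqP. Qed.

Lemma closed2P w :
  reflect ((forall j k, w (k, j) = - w (j, k)) /\
           forall i j k,
             fder i (w (j, k)) + fder j (w (k, i)) + fder k (w (i, j)) = 0)
          (w \in closed2).
Proof.
apply: (iffP andP) => -[h1 h2]; split.
- by move=> j k; apply/eqP; move: h1 => /forallP/(_ j)/forallP/(_ k).
- move=> i j k; apply/eqP.
  by move: h2 => /forallP/(_ i)/forallP/(_ j)/forallP/(_ k).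
- by apply/forallP => j; apply/forallP => k; rewrite h1.
by apply/forallP => i; apply/forallP => j; apply/forallP => k; rewrite h2.
Qed.

Lemma divfree_submod : submod_closed divfree.
Proof.
split=> [|c X Y /divfreeP hX /divfreeP hY]; apply/divfreeP.
  by rewrite big1 // => i _; rewrite ffunE linear0.
under eq_bigr => i _ do rewrite !ffunE linearP.
by rewrite big_split /= -scaler_sumr hX hY scaler0 addr0.
Qed.

Lemma closed2_submod : submod_closed closed2.
Proof.
split=> [|c w z /closed2P[w1 w2] /closed2P[z1 z2]]; apply/closed2P; split.
- by move=> j k; rewrite !ffunE oppr0.
- by move=> i j k; rewrite !ffunE !linear0 !addr0.
- by move=> j k; rewrite !ffunE w1 z1 scalerN opprD.
move=> i j k; rewrite !ffunE !fder_is_linear.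
rewrite [X in X + _]addrACA -scalerDr addrACA -scalerDr.
by rewrite w2 z2 scaler0 addr0.
Qed.

HB.instance Definition _ :=
  GRing.isSubmodClosed.Build K vfield divfree divfree_submod.
HB.instance Definition _ :=
  GRing.isSubmodClosed.Build K form2 closed2 closed2_submod.

(* The even part: divergence-free formal vector fields. *)
Record S5 := MkS5 { vfield_of :> vfield; _ : vfield_of \in divfree }.
HB.instance Definition _ := [isSub for vfield_of].
HB.instance Definition _ := [Choice of S5 by <:].
HB.instance Definition _ := [SubChoice_isSubLmodule of S5 by <:].

(* The odd part: closed formal 2-forms. *)
Record Om2 := MkOm2 { form_of :> form2; _ : form_of \in closed2 }.
HB.instance Definition _ := [isSub for form_of].
HB.instance Definition _ := [Choice of Om2 by <:].
HB.instance Definition _ := [SubChoice_isSubLmodule of Om2 by <:].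

Definition vbracket X Y : vfield :=
  [ffun i => \sum_j (X j * fder j (Y i) - Y j * fder j (X i))].

(* The Lie derivative of w along X, from L_X (dx_j) = d (X j). *)
Definition lie_der X w : form2 :=
  [ffun q => \sum_l (X l * fder l (w q) + fder q.1 (X l) * w (l, q.2)
                      + fder q.2 (X l) * w (q.1, l))].

(* The sign of the map t if it is a permutation, and 0 otherwise. *)
Definition eps (t : 'I_5 -> 'I_5) : K :=
  \sum_(s : 'S_5 | [forall a, s a == t a]) (-1) ^+ s.

Definition eps5 (i j k l m : 'I_5) : K := eps (tnth [tuple i; j; k; l; m]).

(* The odd-odd bracket, with [f d_jk, g d_lm] = \sum_i eps_ijklm f g \partial_i. *)
Definition obracket w z : vfield :=
  [ffun i => \sum_(p : 'I_5 * 'I_5 | (p.1 < p.2)%N)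
             \sum_(q : 'I_5 * 'I_5 | (q.1 < q.2)%N)
               eps5 i p.1 p.2 q.1 q.2 *: (w p * z q)].

Lemma vbracket_divfree X Y :
  X \in divfree -> Y \in divfree -> vbracket X Y \in divfree.
Proof.
move=> /divfreeP hX /divfreeP hY; apply/divfreeP.
have step (A B : vfield) : \sum_i fder i (B i) = 0 ->
    \sum_i \sum_j fder i (A j * fder j (B i)) =
    \sum_i \sum_j fder i (A j) * fder j (B i).
  move=> hB; transitivity (\sum_i \sum_j fder i (A j) * fder j (B i) +
     \sum_j A j * fder j (\sum_i fder i (B i))).
    rewrite [X in _ + X](eq_bigr (fun j => \sum_i A j * fder i (fder j (B i)))).
      rewrite [X in _ + X]exchange_big -big_split; apply: eq_bigr => i _.
      by rewrite -big_split; apply: eq_bigr => j _; rewrite fderM.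
    move=> j _; rewrite linear_sum big_distrr.
    by apply: eq_bigr => i _ /=; rewrite fder_comm.
  by rewrite hB [X in _ + X]big1 ?addr0 // => j _; rewrite linear0 mulr0.
transitivity (\sum_i \sum_j fder i (X j * fder j (Y i)) -
              \sum_i \sum_j fder i (Y j * fder j (X i))).
  rewrite -[RHS]sumrB; apply: eq_bigr => i _.
  rewrite ffunE linear_sum -[RHS]sumrB.
  by apply: eq_bigr => j _; rewrite linearB.
rewrite !step // [X in _ - X]exchange_big; apply/eqP; rewrite subr_eq0; apply/eqP.
by apply: eq_bigr => i _; apply: eq_bigr => j _; rewrite mulrC.
Qed.

Lemma lie_der_closed2 X w : w \in closed2 -> lie_der X w \in closed2.
Proof.
move=> /closed2P[anti clo].
pose b k := \sum_l X l * w (l, k).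
have lieE j k : lie_der X w (j, k) = fder j (b k) - fder k (b j).
  rewrite ffunE /= /b (linear_sum (fder j)) (linear_sum (fder k)) -sumrB; apply: eq_bigr => l _ /=.
  rewrite !fderM (anti j l) linearN /= mulrN.
  have -> : fder l (w (j, k)) = fder j (w (l, k)) + fder k (w (j, l)).
    have := clo l j k; rewrite (anti l k) (anti j l) !linearN /= => /eqP.
    by rewrite -addrA -opprD subr_eq0 => /eqP.
  by ring.
apply/closed2P; split=> [j k | i j k]; rewrite !lieE; first by rewrite opprB.
rewrite !linearB /= (fder_comm i j) (fder_comm j k) (fder_comm k i).
by ring.
Qed.

Lemma eps_perm (c : 'S_5) t : eps (t \o c) = (-1) ^+ c * eps t.
Proof.
rewrite /eps (reindex_inj (mulgI c)) /= big_distrr /=.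
apply: eq_big => [s|s _]; last by rewrite odd_permM signr_addb.
apply/forallP/forallP => h a; last by rewrite permM.
by have := h ((c^-1)%g a); rewrite permM /= permKV.
Qed.

Lemma eps_swap (a b : 'I_5) t : a != b -> eps (t \o tperm a b) = - eps t.
Proof. by move=> ab; rewrite eps_perm odd_tperm ab expr1 mulN1r. Qed.

Lemma eps5_swap12 i j k l m : eps5 j i k l m = - eps5 i j k l m.
Proof.
rewrite -(@eps_swap (@Ordinal 5 0 isT) (@Ordinal 5 1 isT)) //.
by congr eps; apply/funext => -[[|[|[|[|[|?]]]]] ?] //=; rewrite permE.
Qed.

Lemma eps5_swap23 i j k l m : eps5 i k j l m = - eps5 i j k l m.
Proof.
rewrite -(@eps_swap (@Ordinal 5 1 isT) (@Ordinal 5 2 isT)) //.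
by congr eps; apply/funext => -[[|[|[|[|[|?]]]]] ?] //=; rewrite permE.
Qed.

Lemma eps5_pairs i j k l m : eps5 i l m j k = eps5 i j k l m.
Proof.
rewrite -[RHS]opprK -(@eps_swap (@Ordinal 5 1 isT) (@Ordinal 5 3 isT)) //.
rewrite -(@eps_swap (@Ordinal 5 2 isT) (@Ordinal 5 4 isT)) //.
by congr eps; apply/funext => -[[|[|[|[|[|?]]]]] ?] //=; rewrite !permE.
Qed.

Lemma obracketC w z : obracket w z = obracket z w.
Proof.
apply/ffunP => i; rewrite !ffunE exchange_big /=.
apply: eq_bigr => q _; apply: eq_bigr => p _.
by rewrite mulrC eps5_pairs.
Qed.

Lemma sum_pairs_eq0 w l m : w \in closed2 ->
  \sum_i \sum_(p : 'I_5 * 'I_5 | (p.1 < p.2)%N)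
     eps5 i p.1 p.2 l m *: fder i (w p) = 0.
Proof.
move=> /closed2P[anti clo].
pose F i j k : fps := eps5 i j k l m *: fder i (w (j, k)).
have FC i j k : F i k j = F i j k.
  by rewrite /F eps5_swap23 (anti j k) linearN /= scalerN scaleNr opprK.
pose S := \sum_i \sum_(p : 'I_5 * 'I_5 | (p.1 < p.2)%N) F i p.1 p.2.
have rot (G : 'I_5 -> 'I_5 -> 'I_5 -> fps) :
    \sum_i \sum_j \sum_k G j k i = \sum_i \sum_j \sum_k G i j k.
  by rewrite exchange_big; apply: eq_bigr => i _; rewrite exchange_big.
have T0 : (\sum_i \sum_j \sum_k F i j k) *+ 3 = 0.
  transitivity (\sum_i \sum_j \sum_k F i j k + \sum_i \sum_j \sum_k F j k i +
                \sum_i \sum_j \sum_k F k i j).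
    rewrite (rot F) (rot (fun i j k => F j k i)) (rot F).
    by rewrite mulrSr mulr2n.
  rewrite -!big_split /= big1 // => i _; rewrite -!big_split /= big1 // => j _.
  rewrite -!big_split /= big1 // => k _; rewrite /F.
  have -> : eps5 k i j l m = eps5 i j k l m.
    by rewrite eps5_swap12 eps5_swap23 opprK.
  have -> : eps5 j k i l m = eps5 i j k l m.
    by rewrite eps5_swap23 eps5_swap12 opprK.
  by rewrite -!scalerDr clo scaler0.
have T2 : \sum_i \sum_j \sum_k F i j k = S *+ 2.
  rewrite /S -sumrMnl; apply: eq_bigr => i _; rewrite pair_big /=.
  rewrite (bigID (fun p : 'I_5 * 'I_5 => (p.1 < p.2)%N)) mulr2n /=; congr (_ + _).
  rewrite (bigID (fun p : 'I_5 * 'I_5 => (p.2 < p.1)%N)) /= [X in _ + X]big1 ?addr0.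
    rewrite (reindex_inj (h := fun p : 'I_5 * 'I_5 => (p.2, p.1))) /=;
      last by move=> [a b] [c d] [-> ->].
    by apply: eq_big => [p|p _]; [case: ltngtP | rewrite FC].
  move=> [a b] /=; case: ltngtP => // /val_inj -> _.
  have /eqP := eps5_swap23 i b b l m.
  by rewrite -addr_eq0 -mulr2n mulrn_eq0 /= /F => /eqP ->; rewrite scale0r.
have /eqP : S *+ 6 = 0 by rewrite (mulrnA S 2 3) -T2.
rewrite -scaler_nat scaler_eq0 pnatr_eq0 /= /S /F => /eqP S0.
by rewrite -[RHS]S0; apply: eq_bigr => i _; apply: eq_bigr => -[a b].
Qed.

Lemma obracket_divfree w z :
  w \in closed2 -> z \in closed2 -> obracket w z \in divfree.
Proof.
move=> hw hz; apply/divfreeP.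
pose D (u v : form2) := \sum_i \sum_(p : 'I_5 * 'I_5 | (p.1 < p.2)%N)
   \sum_(q : 'I_5 * 'I_5 | (q.1 < q.2)%N)
      eps5 i p.1 p.2 q.1 q.2 *: (fder i (u p) * v q).
have D0 (u v : form2) : u \in closed2 -> D u v = 0.
  move=> hu; rewrite /D; under eq_bigr => i _ do rewrite exchange_big /=.
  rewrite exchange_big /= big1 // => q _.
  transitivity ((\sum_i \sum_(p : 'I_5 * 'I_5 | (p.1 < p.2)%N)
     eps5 i p.1 p.2 q.1 q.2 *: fder i (u p)) * v q).
    rewrite big_distrl; apply: eq_bigr => i _; rewrite big_distrl.
    by apply: eq_bigr => p _ /=; rewrite -scalerAl.
  by rewrite sum_pairs_eq0 ?mul0r.
transitivity (D w z + D z w); last by rewrite !D0 ?addr0.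
rewrite /D -big_split; apply: eq_bigr => i _ /=.
rewrite ffunE [X in _ + X]exchange_big /= -big_split linear_sum.
apply: eq_bigr => p _ /=; rewrite -big_split linear_sum; apply: eq_bigr => q _ /=.
rewrite linearZ /= fderM scalerDr; congr (_ + _).
by rewrite eps5_pairs [w p * _]mulrC.
Qed.


Definition E510 := (S5 * Om2)%type.

Definition S5_bracket (X Y : S5) : S5 := MkS5 (vbracket_divfree (valP X) (valP Y)).
Definition S5_act (X : S5) (w : Om2) : Om2 := MkOm2 (lie_der_closed2 X (valP w)).
Definition Om2_bracket (w z : Om2) : S5 := MkS5 (obracket_divfree (valP w) (valP z)).

Definition bracket (x y : E510) : E510 :=
  (S5_bracket x.1 y.1 + Om2_bracket x.2 y.2, S5_act x.1 y.2 - S5_act y.1 x.2).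

(* x is homogeneous of parity b. *)
Definition homog (b : bool) (x : E510) : Prop := if b then x.1 = 0 else x.2 = 0.

(* All the components of x have their degree in P. *)
Definition deg_in (P : pred int) (x : E510) : Prop :=
  (forall i m, vfield_of x.1 i m != 0 -> P ((2 * mdeg5 m)%:Z - 2)) /\
  (forall q m, form_of x.2 q m != 0 -> P ((2 * mdeg5 m)%:Z - 1)).

Definition L0 := deg_in (fun j => j == 0).
Definition Lplus := deg_in (fun j => 0 < j).
Definition Lge0 := deg_in (fun j => 0 <= j).

Definition lo (i : 'I_4) : 'I_5 := widen_ord (leqnSn 4) i.
Definition hi (i : 'I_4) : 'I_5 := lift ord0 i.

Definition xd_vfield (i j : 'I_5) : vfield := [ffun k => (k == j)%:R * fvar K i].

Lemma div_xd i j : \sum_k fder k (xd_vfield i j k) = (i == j)%:R.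
Proof.
rewrite (bigD1 j) //= big1 => [|k kj].
  by rewrite ffunE eqxx mul1r fder_var addr0 eq_sym.
by rewrite ffunE (negPf kj) mul0r linear0.
Qed.

Lemma xd_divfree i j : i != j -> xd_vfield i j \in divfree.
Proof. by move=> ij; apply/divfreeP; rewrite div_xd (negPf ij). Qed.

(* x_i \partial_j for i != j, see [xdE]. *)
Definition xd (i j : 'I_5) : E510 := (insubd 0 (xd_vfield i j), 0).

Lemma xdE i j : i != j -> vfield_of (xd i j).1 = xd_vfield i j.
Proof. by move=> ij; rewrite /= -[LHS]/(val _) val_insubd xd_divfree. Qed.

Lemma hh_divfree i :
  xd_vfield (lo i) (lo i) - xd_vfield (hi i) (hi i) \in divfree.
Proof.
apply/divfreeP.
transitivity (\sum_k (fder k (xd_vfield (lo i) (lo i) k) -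
                      fder k (xd_vfield (hi i) (hi i) k))).
  by apply: eq_bigr => k _; rewrite -linearB; congr fder; rewrite !ffunE.
by rewrite sumrB !div_xd !eqxx subrr.
Qed.

(* h_i = x_i \partial_i - x_(i+1) \partial_(i+1) *)
Definition hh (i : 'I_4) : E510 := (MkS5 (hh_divfree i), 0).

(* f dx_j /\ dx_k *)
Definition fd_form (f : fps) (j k : 'I_5) : form2 :=
  [ffun q => ((q == (j, k))%:R - (q == (k, j))%:R) * f].

Definition pair5 := {p : 'I_5 * 'I_5 | (p.1 < p.2)%N}.

Lemma fd_anti f j k p q : fd_form f j k (q, p) = - fd_form f j k (p, q).
Proof. by rewrite !ffunE !xpair_eqE ![_ && (q == _)]andbC -mulNr opprB. Qed.

Lemma d_closed2 (p : pair5) : fd_form 1 (val p).1 (val p).2 \in closed2.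
Proof.
apply/closed2P; split=> [j k|i j k]; first exact: fd_anti.
by rewrite !ffunE !mulr1 !linearB /= !fder_nat subr0 !addr0.
Qed.

(* d_ij = dx_i /\ dx_j, for p = (i, j). *)
Definition dd (p : pair5) : E510 := (0, MkOm2 (d_closed2 p)).

Local Notation o5 k := (@Ordinal 5 k isT).

Lemma x5d45_closed2 : fd_form (fvar K (o5 4)) (o5 3) (o5 4) \in closed2.
Proof.
apply/closed2P; split=> [j k|i j k]; first exact: fd_anti.
rewrite !ffunE !fderM !linearB /= !fder_nat !fder_var !xpair_eqE.
rewrite subr0 !mul0r !add0r -!mulnb !natrM.
by ring.
Qed.

(* x_5 d_45, with 1-based indices. *)
Definition x5d45 : E510 := (0, MkOm2 x5d45_closed2).

(* The coefficient of d_p in the degree -1 component of y. *)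
Definition coord (p : pair5) (y : E510) : K := form_of y.2 (val p) 0.

(* a is a representation on M of the subalgebra P of E(5,10). *)
Definition is_rep (P : E510 -> Prop) (M : lmodType K) (a : E510 -> M -> M) :=
  [/\ forall x, P x -> linear (a x),
      forall c x y v, P x -> P y -> a (c *: x + y) v = c *: a x v + a y v
    & forall b1 b2 x y v, P x -> P y -> homog b1 x -> homog b2 y ->
        a (bracket x y) v = a x (a y v) - (-1) ^+ (b1 && b2) *: a y (a x v)].

(* The L_0-module V(lam), with highest weight vector v, as an L_{>= 0}-module:
   a x is only meaningful for x in L_{>= 0}. *)
Record is_irrep (lam : 4.-tuple nat) (V : vectType K) (a : E510 -> V -> V)
    (v : V) : Prop := {
  irrep_rep : is_rep Lge0 a;
  irrep_Lplus : forall x u, Lplus x -> a x u = 0;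
  irrep_irr : forall W : {vspace V},
    (forall x u, L0 x -> u \in W -> a x u \in W) -> W = 0%VS \/ W = fullv;
  irrep_neq0 : v <> 0;
  irrep_borel : forall i j : 'I_5, (i < j)%N -> a (xd i j) v = 0;
  irrep_weight : forall i, a (hh i) v = (tnth lam i)%:R *: v }.

Definition is_super_morph (A : algType K) (f : E510 -> A) :=
  linear f /\
  forall b1 b2 x y, homog b1 x -> homog b2 y ->
    f (bracket x y) = f x * f y - (-1) ^+ (b1 && b2) * (f y * f x).

(* U is the universal enveloping superalgebra U(L), with iota : L -> U. *)
Record is_enveloping (U : algType K) (iota : E510 -> U) : Prop := {
  env_morph : is_super_morph iota;
  env_ex : forall (A : algType K) (f : E510 -> A), is_super_morph f ->
    exists g : {lrmorphism U -> A}, forall x, g (iota x) = f x;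
  env_uniq : forall (A : algType K) (g1 g2 : {lrmorphism U -> A}),
    (forall x, g1 (iota x) = g2 (iota x)) -> forall u, g1 u = g2 u }.

(* K-bilinear maps on U(L) x V that are balanced over U(L_{>= 0}); as L_{>= 0}
   generates U(L_{>= 0}), it suffices to consider the elements of L_{>= 0}. *)
Record is_balanced (U : algType K) (iota : E510 -> U) (V : lmodType K)
    (a : E510 -> V -> V) (N : lmodType K) (f : U -> V -> N) : Prop := {
  bal_linl : forall v, linear (f^~ v);
  bal_linr : forall u, linear (f u);
  bal_mid : forall u x v, Lge0 x -> f (u * iota x) v = f u (a x v) }.

(* M, with the left action aM of U = U(L), is the induced module
   U(L) \otimes_{U(L_{>= 0})} V, and ten u v is the pure tensor u \otimes v. *)
Record is_induced (U : algType K) (iota : E510 -> U) (V : lmodType K)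
    (a : E510 -> V -> V) (M : lmodType K) (aM : U -> M -> M)
    (ten : U -> V -> M) : Prop := {
  ind_bal : is_balanced iota a ten;
  ind_ex : forall (N : lmodType K) (f : U -> V -> N), is_balanced iota a f ->
    exists g : {linear M -> N}, forall u v, g (ten u v) = f u v;
  ind_uniq : forall (N : lmodType K) (g1 g2 : {linear M -> N}),
    (forall u v, g1 (ten u v) = g2 (ten u v)) -> forall m, g1 m = g2 m;
  ind_lin : forall u, linear (aM u);
  ind_act : forall u u' v, aM u (ten u' v) = ten (u * u') v }.

Definition singular (M : lmodType K) (act : E510 -> M -> M) (xi : M) :=
  [/\ xi <> 0, forall i : 'I_4, act (xd (lo i) (hi i)) xi = 0
    & act x5d45 xi = 0].

Section WV.
Variables (V : vectType K) (a : E510 -> V -> V).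

(* W \otimes V: the family u stands for \sum_p d_p \otimes u p. *)
Local Notation WV := {ffun pair5 -> V}.

Definition pure (p : pair5) (v : V) : WV := [ffun q => if q == p then v else 0].

(* x \otimes y acting on W \otimes V, with x in L_0 acting on W = L_{-1} by the
   bracket. *)
Definition tensor_op (x y : E510) (u : WV) : WV :=
  [ffun q => \sum_p coord q (bracket x (dd p)) *: a y (u p)].

Definition hstar_coef (i j : 'I_4) : K :=
  (nth 0 (nth [::] [:: [:: 4; 3; 2; 1];
                       [:: 3; 6; 4; 2];
                       [:: 2; 4; 6; 3];
                       [:: 1; 2; 3; 4] ] i) j)%N%:R / 5.

Definition hstar (i : 'I_4) : E510 := \sum_j hstar_coef i j *: hh j.

Definition ctilde (u : WV) : WV :=
  10^-1 *: (\sum_i tensor_op (hh i) (hstar i) u +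
            \sum_(p : 'I_5 * 'I_5 | p.1 != p.2)
               tensor_op (xd p.1 p.2) (xd p.2 p.1) u).

(* \sum_p d_p u_p in M *)
Definition deg1 (U : algType K) (iota : E510 -> U) (M : lmodType K)
    (ten : U -> V -> M) (u : WV) : M := \sum_p ten (iota (dd p)) (u p).

End WV.

(* Coordinates with respect to the fundamental weights. *)
Definition weight := 'rV[int]_4.

Definition adjacent (i j : 'I_4) : bool := (i.+1 == j) || (j.+1 == i).

Definition cartan : 'M[int]_4 :=
  \matrix_(i, j) (if i == j then 2 else if adjacent i j then -1 else 0).

Definition sroot (i : 'I_4) : weight := row i cartan.

Definition omega2 : weight := \row_j (j == 1 :> nat)%:R.
Definition delta : weight := const_mx 1.

(* The weights of the dx_i under the h_j, and then of the d_ij. *)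
Definition wt_dx (i : 'I_5) : weight := \row_j ((i == lo j)%:R - (i == hi j)%:R).
Definition wt (p : pair5) : weight := wt_dx (val p).1 + wt_dx (val p).2.

Definition wt_le (t s : weight) : bool :=
  `[< exists n : 'I_4 -> nat, s - t = \sum_i sroot i *+ n i >].
Definition wt_lt (t s : weight) : bool := (t != s) && wt_le t s.

(* The form on weights induced by the Killing form: its Gram matrix on the
   simple roots, the coordinates of a weight with respect to the simple roots,
   and its value on two weights. *)
Definition gram : 'M[K]_4 :=
  \matrix_(i, j) (if i == j then 5^-1 else if adjacent i j then - 10^-1 else 0).

Definition root_coord (s : weight) : 'rV[K]_4 :=
  map_mx intr s *m invmx (map_mx intr cartan).

Definition wform (s t : weight) : K :=
  (root_coord s *m gram *m (root_coord t)^T) 0 0.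

Definition chi (lam s : weight) : K :=
  2^-1 * (wform (s + lam) (s + lam + delta *+ 2)
          - wform omega2 (omega2 + delta *+ 2) - wform lam (lam + delta *+ 2)).

Definition weights2 : seq weight := undup [seq wt p | p <- enum {: pair5}].

Definition to_weight (lam : 4.-tuple nat) : weight := \row_i (tnth lam i)%:Z.

(* The product of the (c~ - chi_s) / (chi_t - chi_s), over the weights s of
   V(omega_2) with t < s <= omega_2, applied to u. *)
Definition ctilde_prod (V : vectType K) (a : E510 -> V -> V)
    (lam : 4.-tuple nat) (t : weight) (u : {ffun pair5 -> V}) : {ffun pair5 -> V} :=
  let l := to_weight lam in
  foldr (fun s y => (chi l t - chi l s)^-1 *: (ctilde a y - chi l s *: y)) u
    [seq s <- weights2 | wt_lt t s && wt_le s omega2].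

End E510.

Definition p12 : pair5 := exist _ (@Ordinal 5 0 isT, @Ordinal 5 1 isT) isT.
Definition p15 : pair5 := exist _ (@Ordinal 5 0 isT, @Ordinal 5 4 isT) isT.
Definition p45 : pair5 := exist _ (@Ordinal 5 3 isT, @Ordinal 5 4 isT) isT.

(* Main.v *)
Require Import Defs.
From HB Require Import structures.
From mathcomp Require Import all_boot all_order all_fingroup all_algebra.
From mathcomp Require Import boolp classical_sets functions.
From mathcomp Require Import ring zify reals complex.

Set Implicit Arguments.
Unset Strict Implicit.
Unset Printing Implicit Defensive.

Import Order.TTheory GRing.Theory Num.Theory.
Local Open Scope ring_scope.

(* An element of W \otimes V is a family u : {ffun pair5 -> V}, and deg1 u is singular
   iff u is nonzero, is killed by the raising operators of sl_5 acting on W \otimes V,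
   and satisfies one further linear condition, the vanishing of a vector D5 u of V.
   This rests on the injectivity of deg1 and of ten 1, that is, on a small part of the
   PBW theorem: vectors of M are told apart by mapping M to a concrete E(5,10)-module.
   Starting from a trivial module and iterating E |-> Hom(L, E), one obtains modules in
   which the tensors of a given degree embed by evaluating vector fields at 0. Since V
   embeds in the tensors (any two irreducible highest weight modules of the same weight
   are isomorphic, as the contravariant Hermitian form on tensors is positive), wedging
   with the volume form of \C^5 gives an L_{>=0}-equivariant map from V, which extends
   to M.

   The lexicographically last component of a raised vector u is a multiple of v, at some
   pair p. Applying raising operators to D5 u = 0 and reading off the coefficients at p
   gives linear equations for lambda, which are only solvable if p is 12, 15 or 45; they
   are exactly the conditions in (i), (ii), (iii), and these exclude each other. Hence
   for each lambda the singular vectors of degree one form at most a line.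

   The operator c~ is the split Casimir operator: it commutes with sl_5 and acts by
   chi_(sigma + lambda) on raised vectors of weight sigma + lambda, as one sees from the
   last component. By induction on weights the product of the c~ - chi_s over all
   s >= sigma kills d_sigma v, so the product over s > sigma makes it a raised vector.
   The latter is nonzero, because c~ is self-adjoint and d_sigma v pairs nontrivially
   with an explicitly given singular vector of the same weight, of which it is therefore
   a multiple. *)

(** [U] and [M] are known only through universal properties, so no basis of [M] is at hand and test
    modules have to be built by other means. In Hom(L, E) the functionals Y |-> Y(0), with values in
    E, form copies of the dual of L_{-2}: they vanish on L_{>=-1}, which L_{>=0} preserves and into
    which L_+ maps L, so that L_{>=0} acts on iterated functionals through sl_5. A constant form d_p
    leaves this space by contracting a tensor index with the fields [d_p, d_q]. The tensors
    containing V may have too few indices for that (none if V is trivial); the volume form is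
    sl_5-invariant and supplies five. Raising the equation D5 u = 0 yields, besides some vanishing
    components, only equalities between diagonal components D5 u k k i j, whose common value stays
    unknown; comparing two of them at the leading pair gives equations in lambda alone. The bounds n
    >= 1 and m >= 1 are of another nature: there the leading component lies in the image of a
    raising operator of V, which the contravariant form forbids if the two weight coordinates
    agree. *)

Local Notation o5 k := (@Ordinal 5 k isT).

(* Reflexive proof of equations in a module from equations in its scalars. *)
Section LinearCombinations.
Variables (K : pzRingType) (V : lmodType K).

Inductive lexpr :=
  LVar of nat | LZero | LAdd of lexpr & lexpr | LOpp of lexpr | LScale of K & lexpr.

Fixpoint leval (env : seq V) e : V :=
  match e with
  | LVar i => nth 0 env i
  | LZero => 0
  | LAdd a b => leval env a + leval env b
  | LOpp a => - leval env a
  | LScale c a => c *: leval env a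
  end.

(** [eqn] instead of [==] lets [cbn] decide the test on numerals in [lincomb_coefs]. *)
Fixpoint lcoef e (i : nat) : K :=
  match e with
  | LVar j => if eqn j i then 1 else 0
  | LZero => 0
  | LAdd a b => lcoef a i + lcoef b i
  | LOpp a => - lcoef a i
  | LScale c a => c * lcoef a i
  end.

Lemma levalE env e : leval env e = \sum_(i < size env) lcoef e i *: env`_i.
Proof.
elim: e => /= [j||a -> b ->|a ->|c a ->].
- have [lt|ge] := ltnP j (size env).
    have jj : eqn j j by exact/eqnP.
    rewrite (bigD1 (Ordinal lt)) //= jj scale1r big1 ?addr0 // => i ne.
    suff -> : eqn j i = false by rewrite scale0r.
    by apply/negP => /eqnP e; case/eqP: ne; exact/val_inj.
  rewrite nth_default // big1 // => i _.
  suff -> : eqn j i = false by rewrite scale0r.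
  by apply/negP => /eqnP e; move: ge; rewrite e leqNgt ltn_ord.
- by rewrite big1 // => i _; rewrite scale0r.
- by rewrite -big_split; apply: eq_bigr => i _; rewrite scalerDl.
- by rewrite -sumrN; apply: eq_bigr => i _; rewrite scaleNr.
by rewrite scaler_sumr; apply: eq_bigr => i _; rewrite scalerA.
Qed.

(** A recursive conjunction rather than a bounded quantifier, so that [split] leaves one scalar
    equation per variable for [ring]. *)
Fixpoint eq_coefs e1 e2 (n : nat) : Prop :=
  if n is n'.+1 then lcoef e1 n' = lcoef e2 n' /\ eq_coefs e1 e2 n' else True.

Lemma lincomb_eq env e1 e2 : eq_coefs e1 e2 (size env) -> leval env e1 = leval env e2.
Proof.
move=> h; rewrite !levalE; apply: eq_bigr => i _; congr (_ *: _).
elim: (size env) h i => [|n IH] /=; first by move=> _ [].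
move=> [hn h] [i lt] /=; move: (lt); rewrite ltnS leq_eqVlt => /orP[/eqP -> //|lt'].
exact: (IH h (Ordinal lt')).
Qed.

End LinearCombinations.

Ltac lc_index x env :=
  match env with
  | ?y :: _ => let _ := match goal with _ => unify x y end in constr:(0%N)
  | _ :: ?e => let n := lc_index x e in constr:(S n)
  end.
Ltac lc_insert x env :=
  match env with
  | _ => let n := lc_index x env in env
  | _ => constr:(x :: env)
  end.
Ltac lc_vars t env :=
  lazymatch t with
  | (?a + ?b)%R => let e := lc_vars a env in lc_vars b e
  | (- ?a)%R => lc_vars a env
  | (_ *: ?a)%R => lc_vars a env
  | (?a *+ _)%R => lc_vars a env
  | 0%R => env
  | _ => lc_insert t env
  end.
Ltac lc_reify K t env :=
  lazymatch t with
  | (?a + ?b)%R => let x := lc_reify K a env in let y := lc_reify K b env in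
                   constr:(LAdd x y)
  | (- ?a)%R => let x := lc_reify K a env in constr:(LOpp x)
  | (?c *: ?a)%R => let x := lc_reify K a env in constr:(LScale c x)
  | (?a *+ ?n)%R => let x := lc_reify K a env in constr:(LScale (n%:R : K) x)
  | 0%R => constr:(LZero K)
  | _ => let n := lc_index t env in constr:(LVar K n)
  end.
Ltac lincomb_coefs :=
  rewrite -?scaler_nat;
  lazymatch goal with
  | |- @eq ?T ?a ?b =>
    (* The scalar ring need not be visible in [T]; typing a scaled copy of [a] reveals it. *)
    lazymatch type of (fun c : _ => (c *: a)%R) with
    | ?K -> _ =>
      let env := lc_vars a (@nil T) in
      let env := lc_vars b env in
      let x := lc_reify K a env in
      let y := lc_reify K b env in
      apply: (@lincomb_eq _ _ env x y); cbn [eq_coefs lcoef eqn size];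
      do ?split
    end
  end.
Ltac lincomb := lincomb_coefs; ring.

(** * Jacobi identities for E(5,10) *)

(** Reduces Jacobi identities to [ring]: written as double sums, they hold only after adding the
    terms for (i, j) and (j, i), where the mixed second derivatives cancel. *)
Lemma sum_sym_eq0 (K : numFieldType) (V : lmodType K) (I : finType)
    (F : I -> I -> V) :
  (forall i j, F i j + F j i = 0) -> \sum_i \sum_j F i j = 0.
Proof.
move=> F0; have : (2 : K) *: \sum_i \sum_j F i j = 0.
  rewrite scaler_nat mulr2n [X in _ + X]exchange_big -big_split big1 // => i _.
  by rewrite -big_split big1 // => j _; exact: F0.
by move/eqP; rewrite scaler_eq0 pnatr_eq0 => /eqP.
Qed.

Section Jacobi.
Variable K : numFieldType.
Implicit Types (X Y Z : vfield K) (w z u : form2 K).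

Lemma fderD i (f g : fps K) : fder i (f + g) = fder i f + fder i g.
Proof. exact: linearD. Qed.

Lemma fderB i (f g : fps K) : fder i (f - g) = fder i f - fder i g.
Proof. exact: linearB. Qed.

Lemma vbracket_jacobi X Y Z :
  vbracket X (vbracket Y Z) - vbracket Y (vbracket X Z) =
  vbracket (vbracket X Y) Z.
Proof.
apply/ffunP => i; rewrite !ffunE; apply/eqP; rewrite -subr_eq0; apply/eqP.
rewrite -!sumrB.
transitivity (\sum_j \sum_l (
   X j * (fder j (Y l) * fder l (Z i) + Y l * fder j (fder l (Z i))
         - fder j (Z l) * fder l (Y i) - Z l * fder j (fder l (Y i)))
   - (Y l * fder l (Z j) - Z l * fder l (Y j)) * fder j (X i)
   - Y j * (fder j (X l) * fder l (Z i) + X l * fder j (fder l (Z i))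
         - fder j (Z l) * fder l (X i) - Z l * fder j (fder l (X i)))
   + (X l * fder l (Z j) - Z l * fder l (X j)) * fder j (Y i)
   - (X l * fder l (Y j) - Y l * fder l (X j)) * fder j (Z i)
   + Z j * (fder j (X l) * fder l (Y i) + X l * fder j (fder l (Y i))
         - fder j (Y l) * fder l (X i) - Y l * fder j (fder l (X i))))).
  apply: eq_bigr => j _; rewrite !ffunE !linear_sum /=.
  rewrite !big_distrr !big_distrl /= -!sumrB.
  apply: eq_bigr => l _ /=; rewrite !(fderB, fderM); ring.
apply: sum_sym_eq0 => j l.
rewrite (fder_comm l j (Z i)) (fder_comm l j (X i)) (fder_comm l j (Y i)); ring.
Qed.

Lemma lie_der_vbracket X Y w :
  lie_der X (lie_der Y w) - lie_der Y (lie_der X w) = lie_der (vbracket X Y) w.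
Proof.
apply/ffunP => -[j k]; rewrite !ffunE /=; apply/eqP; rewrite -subr_eq0; apply/eqP.
rewrite -!sumrB.
transitivity (\sum_m \sum_l (
  let T (X Y : vfield K) :=
   X m * (fder m (Y l) * fder l (w (j, k)) + Y l * fder m (fder l (w (j, k)))
         + fder m (fder j (Y l)) * w (l, k) + fder j (Y l) * fder m (w (l, k))
         + fder m (fder k (Y l)) * w (j, l) + fder k (Y l) * fder m (w (j, l)))
   + fder j (X m) * (Y l * fder l (w (m, k)) + fder m (Y l) * w (l, k)
                     + fder k (Y l) * w (m, l))
   + fder k (X m) * (Y l * fder l (w (j, m)) + fder j (Y l) * w (l, m)
                     + fder m (Y l) * w (j, l)) in
   T X Y - T Y X
   - ((X l * fder l (Y m) - Y l * fder l (X m)) * fder m (w (j, k))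
   + (fder j (X l) * fder l (Y m) + X l * fder j (fder l (Y m))
      - fder j (Y l) * fder l (X m) - Y l * fder j (fder l (X m))) * w (m, k)
   + (fder k (X l) * fder l (Y m) + X l * fder k (fder l (Y m))
      - fder k (Y l) * fder l (X m) - Y l * fder k (fder l (X m))) * w (j, m)))).
  apply: eq_bigr => m _; rewrite !ffunE !linear_sum /=.
  rewrite !big_distrr !big_distrl /= -!big_split /= -!sumrB.
  apply: eq_bigr => l _ /=; rewrite !(fderB, fderD, fderM); ring.
apply: sum_sym_eq0 => m l /=.
rewrite (fder_comm l j) (fder_comm m j) (fder_comm l k) (fder_comm m k)
  (fder_comm m l (w _)) (fder_comm l j) (fder_comm m j) (fder_comm l k) (fder_comm m k); ring.
Qed.

End Jacobi.

Definition sg2 (a b : nat) : int := if (a < b)%N then 1 else if a == b then 0 else -1.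

(** The sign of the Vandermonde product; unlike the sum over permutations in [eps], it computes. *)
Definition sg5 (i j k l m : nat) : int :=
  sg2 i j * sg2 i k * sg2 i l * sg2 i m * sg2 j k * sg2 j l * sg2 j m *
  sg2 k l * sg2 k m * sg2 l m.

Section Sign.
Variable K : numFieldType.

Let vdm (t : 'I_5 -> 'I_5) : K := \det (Vandermonde 5 (\row_j (t j)%:R)).

(** The Vandermonde determinant is alternating in its nodes, and 288 = 1! 2! 3! 4! is its value for
    the identity. *)
Lemma eps_vdm t : vdm t = 288 * eps K t.
Proof.
have vdm_id : vdm id = 288.
  rewrite /vdm det_Vandermonde !big_ord_recl !big_ord0 /=.
  rewrite !(big_mkcond (fun j => _ < _)%N) /= !big_ord_recl !big_ord0 /= !mxE /=.
  by rewrite /bump /=; ring.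
have [/injectiveP t_inj|/injectiveP t_ninj] := boolP (injectiveb t).
  rewrite /eps (big_pred1 (perm t_inj)) => [|s]; last first.
    apply/forallP/eqP => [h|-> a]; last by rewrite permE.
    by apply/permP => a; rewrite permE; exact/eqP/h.
  rewrite -vdm_id mulrC -det_perm -(det_tr (perm_mx _)) tr_perm_mx /vdm.
  rewrite mulrC -det_mulmx -col_permE.
  by congr (\det _); apply/matrixP => i j; rewrite !mxE permE.
rewrite /eps big_pred0 ?mulr0 => [|s]; last first.
  apply/negP => /forallP h; apply: t_ninj => a b ab.
  by apply: (@perm_inj _ s); rewrite (eqP (h a)) (eqP (h b)).
have [a [b [ab tab]]] : exists a b, a != b /\ t a = t b.
  move/injectiveP: t_ninj => /injectivePn[a [b ab tab]].
  by exists a, b.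
rewrite /vdm -det_tr; apply: (determinant_alternate ab) => i.
by rewrite !mxE tab.
Qed.

Lemma sg5_vdm (i j k l m : 'I_5) : 288 * sg5 i j k l m =
  (j%:Z - i%:Z) * (k%:Z - i%:Z) * (l%:Z - i%:Z) * (m%:Z - i%:Z) *
  (k%:Z - j%:Z) * (l%:Z - j%:Z) * (m%:Z - j%:Z) *
  (l%:Z - k%:Z) * (m%:Z - k%:Z) * (m%:Z - l%:Z).
Proof.
pose good (i j k l m : nat) := 288 * sg5 i j k l m ==
  (j%:Z - i%:Z) * (k%:Z - i%:Z) * (l%:Z - i%:Z) * (m%:Z - i%:Z) *
  (k%:Z - j%:Z) * (l%:Z - j%:Z) * (m%:Z - j%:Z) *
  (l%:Z - k%:Z) * (m%:Z - k%:Z) * (m%:Z - l%:Z).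
pose r := iota 0 5.
have all_good : all (fun i => all (fun j => all (fun k => all (fun l =>
    all (good i j k l) r) r) r) r) r by vm_compute.
have mem_r (a : 'I_5) : (a : nat) \in r by rewrite mem_iota /=.
have /allP/(_ _ (mem_r i))/allP/(_ _ (mem_r j))/allP/(_ _ (mem_r k)) := all_good.
by move=> /allP/(_ _ (mem_r l))/allP/(_ _ (mem_r m))/eqP.
Qed.

Lemma eps5E i j k l m : eps5 K i j k l m = (sg5 i j k l m)%:~R.
Proof.
have n288 : (288 : K) != 0 by rewrite pnatr_eq0.
apply: (mulfI n288); rewrite -eps_vdm /vdm.
have -> : (288 : K) = (288 : int)%:~R by [].
rewrite -intrM sg5_vdm det_Vandermonde.
rewrite !big_ord_recl !big_ord0 /=.
rewrite !(big_mkcond (fun j => _ < _)%N) /= !big_ord_recl !big_ord0 /= !mxE.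
rewrite !(tnth_nth ord0) /= !intrM !intrD !intrN /=; ring.
Qed.

Lemma sum_pairs (V : nmodType) (F : 'I_5 * 'I_5 -> V) :
  \sum_(p : 'I_5 * 'I_5 | (p.1 < p.2)%N) F p =
  F (o5 0, o5 1) + F (o5 0, o5 2) + F (o5 0, o5 3) + F (o5 0, o5 4) +
  F (o5 1, o5 2) + F (o5 1, o5 3) + F (o5 1, o5 4) +
  F (o5 2, o5 3) + F (o5 2, o5 4) + F (o5 3, o5 4).
Proof.
transitivity (\sum_(i : 'I_5) \sum_(j : 'I_5 | (i < j)%N) F (i, j)).
  by rewrite pair_big_dep /=; apply: eq_bigr => -[].
under eq_bigr => i _ do rewrite big_mkcond /=.
rewrite !big_ord_recl !big_ord0 /= !(addr0, add0r) !addrA.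
do !congr (_ + _); congr F; congr (_, _); exact: val_inj.
Qed.

Lemma sum_o5 (V : nmodType) (F : 'I_5 -> V) :
  \sum_i F i = F (o5 0) + F (o5 1) + F (o5 2) + F (o5 3) + F (o5 4).
Proof.
rewrite !big_ord_recl !big_ord0 /= !(addr0, add0r) !addrA.
do !congr (_ + _); congr F; exact: val_inj.
Qed.

End Sign.

Lemma ord5_ind (P : 'I_5 -> Prop) :
  P (o5 0) -> P (o5 1) -> P (o5 2) -> P (o5 3) -> P (o5 4) -> forall i, P i.
Proof.
move=> P0 P1 P2 P3 P4 [[|[|[|[|[|i]]]]] lt] //.
- by rewrite (_ : Ordinal lt = o5 0) //; exact: val_inj.
- by rewrite (_ : Ordinal lt = o5 1) //; exact: val_inj.
- by rewrite (_ : Ordinal lt = o5 2) //; exact: val_inj.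
- by rewrite (_ : Ordinal lt = o5 3) //; exact: val_inj.
- by rewrite (_ : Ordinal lt = o5 4) //; exact: val_inj.
Qed.

(** * The odd bracket as a polarized Pfaffian *)

Section OddBracket.
Variable K : numFieldType.
Implicit Types (X Y : vfield K) (w z u : form2 K).

Definition pf (R : pzRingType) (w z : 'I_5 * 'I_5 -> R) (a b c d : 'I_5) : R :=
  w (a, b) * z (c, d) - w (a, c) * z (b, d) + w (a, d) * z (b, c)
  + w (c, d) * z (a, b) - w (b, d) * z (a, c) + w (b, c) * z (a, d).

(** The field whose contraction with the volume form is the 4-form w /\ z, the coefficients of the
    latter being given by [pf]. *)
Definition pfv (R : pzRingType) (w z : 'I_5 * 'I_5 -> R) (i : 'I_5) : R :=
  match val i with
  | 0 => pf w z (o5 1) (o5 2) (o5 3) (o5 4)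
  | 1 => - pf w z (o5 0) (o5 2) (o5 3) (o5 4)
  | 2 => pf w z (o5 0) (o5 1) (o5 3) (o5 4)
  | 3 => - pf w z (o5 0) (o5 1) (o5 2) (o5 4)
  | _ => pf w z (o5 0) (o5 1) (o5 2) (o5 3)
  end.

Lemma eps_sumE (V : lmodType K) (F : 'I_5 * 'I_5 -> 'I_5 * 'I_5 -> V) i :
  let G a b c d := F (a, b) (c, d) - F (a, c) (b, d) + F (a, d) (b, c)
    + F (b, c) (a, d) - F (b, d) (a, c) + F (c, d) (a, b) in
  \sum_(p : 'I_5 * 'I_5 | (p.1 < p.2)%N) \sum_(q : 'I_5 * 'I_5 | (q.1 < q.2)%N)
     eps5 K i p.1 p.2 q.1 q.2 *: F p q =
  match val i with
  | 0 => G (o5 1) (o5 2) (o5 3) (o5 4)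
  | 1 => - G (o5 0) (o5 2) (o5 3) (o5 4)
  | 2 => G (o5 0) (o5 1) (o5 3) (o5 4)
  | 3 => - G (o5 0) (o5 1) (o5 2) (o5 4)
  | _ => G (o5 0) (o5 1) (o5 2) (o5 3)
  end.
Proof.
(* With the sign turned into tests on integers, each term is decided by evaluating closed
   expressions. *)
pose sg (i j k l m : nat) (x : V) : V :=
  if sg5 i j k l m == 0 then 0 else if sg5 i j k l m == 1 then x else - x.
have sgE p q : eps5 K i p.1 p.2 q.1 q.2 *: F p q = sg i p.1 p.2 q.1 q.2 (F p q).
  move: p.1 p.2 q.1 q.2 => a b c d; rewrite eps5E /sg; case: eqP => [->|n0]; first by rewrite scale0r.
  case: eqP => [->|n1]; first by rewrite scale1r.
  suff -> : sg5 i a b c d = -1 by rewrite scaleN1r.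
  have : (sg5 i a b c d == 0) || (sg5 i a b c d == 1) || (sg5 i a b c d == -1).
    rewrite /sg5; have s3 x y : (sg2 x y == 0) || (sg2 x y == 1) || (sg2 x y == -1).
      by rewrite /sg2; case: ifP => // _; case: ifP.
    have s3M (x y : int) : (x == 0) || (x == 1) || (x == -1) ->
        (y == 0) || (y == 1) || (y == -1) ->
        (x * y == 0) || (x * y == 1) || (x * y == -1).
      by move=> /orP[/orP[]|] /eqP -> /orP[/orP[]|] /eqP ->.
    by do 9! [apply: (s3M _ _ _ (s3 _ _))]; exact: s3.
  by move=> /orP[/orP[]|] /eqP.
move=> G; under eq_bigr => p _ do under eq_bigr => q _ do rewrite sgE.
rewrite sum_pairs !sum_pairs; cbn [fst snd]; rewrite /sg {sgE sg}.
elim/ord5_ind: i.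
all: do ![match goal with |- context [sg5 ?a ?b ?c ?d ?e == ?x] =>
  let v := eval vm_compute in (sg5 a b c d e == x) in
  change (sg5 a b c d e == x) with v; cbv iota end].
all: by rewrite !(addr0, add0r) /= /G ?opprD ?opprK ?addrA.
Qed.

Lemma obracketE w z i : obracket w z i = pfv w z i.
Proof.
rewrite ffunE eps_sumE /pfv /pf; move: (val i) => k.
by case: k => [|[|[|[|k]]]]; ring.
Qed.

End OddBracket.

(* The action on [pfv w z] of a derivation along a field of Jacobian [dx], once
   the transport terms are removed by the Leibniz rule. *)
Lemma pfv_trace0 (R : comPzRingType) (dx : 'I_5 -> 'I_5 -> R)
    (w z : 'I_5 * 'I_5 -> R) i :
  \sum_l dx l l = 0 ->
  (forall j k, w (k, j) = - w (j, k)) -> (forall j, w (j, j) = 0) ->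
  (forall j k, z (k, j) = - z (j, k)) -> (forall j, z (j, j) = 0) ->
  let lw (w : 'I_5 * 'I_5 -> R) q :=
    \sum_l (dx q.1 l * w (l, q.2) + dx q.2 l * w (q.1, l)) in
  - \sum_j pfv w z j * dx j i = pfv (lw w) z i + pfv w (lw z) i.
Proof.
move=> tr0 wa w0 za z0 lw.
have tr : dx (o5 0) (o5 0) = - (dx (o5 1) (o5 1) + dx (o5 2) (o5 2)
                        + dx (o5 3) (o5 3) + dx (o5 4) (o5 4)).
  by move/eqP: tr0; rewrite sum_o5 -!addrA addr_eq0 !addrA => /eqP.
rewrite sum_o5.
elim/ord5_ind: i; rewrite /pfv /pf /lw /= !sum_o5 /= !w0 !z0.
all: rewrite !(wa (o5 0) (o5 1), wa (o5 0) (o5 2), wa (o5 0) (o5 3), wa (o5 0) (o5 4),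
  wa (o5 1) (o5 2), wa (o5 1) (o5 3), wa (o5 1) (o5 4), wa (o5 2) (o5 3),
  wa (o5 2) (o5 4), wa (o5 3) (o5 4)).
all: rewrite !(za (o5 0) (o5 1), za (o5 0) (o5 2), za (o5 0) (o5 3), za (o5 0) (o5 4),
  za (o5 1) (o5 2), za (o5 1) (o5 3), za (o5 1) (o5 4), za (o5 2) (o5 3),
  za (o5 2) (o5 4), za (o5 3) (o5 4)).
all: ring: tr.
Qed.

(** A skew 5 x 5 matrix kills the vector of its signed 4 x 4 Pfaffians; this is the derivative of
    that cubic identity at [w] in the direction [u]. *)
Lemma pfv_cubic (R : comPzRingType) (w u : 'I_5 * 'I_5 -> R) k :
  (forall j k, w (k, j) = - w (j, k)) -> (forall j, w (j, j) = 0) ->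
  (forall j k, u (k, j) = - u (j, k)) -> (forall j, u (j, j) = 0) ->
  \sum_l (pfv w w l * u (l, k) + 2 * pfv w u l * w (l, k)) = 0.
Proof.
move=> wa w0 ua u0.
elim/ord5_ind: k; rewrite /pfv /pf sum_o5 /= !w0 !u0.
all: rewrite ?(wa (o5 0) (o5 1), wa (o5 0) (o5 2), wa (o5 0) (o5 3), wa (o5 0) (o5 4),
  wa (o5 1) (o5 2), wa (o5 1) (o5 3), wa (o5 1) (o5 4), wa (o5 2) (o5 3),
  wa (o5 2) (o5 4), wa (o5 3) (o5 4)).
all: rewrite ?(ua (o5 0) (o5 1), ua (o5 0) (o5 2), ua (o5 0) (o5 3), ua (o5 0) (o5 4),
  ua (o5 1) (o5 2), ua (o5 1) (o5 3), ua (o5 1) (o5 4), ua (o5 2) (o5 3),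
  ua (o5 2) (o5 4), ua (o5 3) (o5 4)).
all: ring.
Qed.

Section Pfv.
Variable R : comPzRingType.
Implicit Types w z : 'I_5 * 'I_5 -> R.

Lemma pfvC w z i : pfv w z i = pfv z w i.
Proof. by rewrite /pfv /pf; case: (val i) => [|[|[|[|k]]]]; ring. Qed.

Lemma pfvDl w w' z i :
  pfv (fun q => w q + w' q) z i = pfv w z i + pfv w' z i.
Proof. by rewrite /pfv /pf; case: (val i) => [|[|[|[|k]]]]; ring. Qed.

Lemma pfvZl c w z i : pfv (fun q => c * w q) z i = c * pfv w z i.
Proof. by rewrite /pfv /pf; case: (val i) => [|[|[|[|k]]]]; ring. Qed.

Lemma pfv_suml (F : 'I_5 -> 'I_5 * 'I_5 -> R) z i :
  pfv (fun q => \sum_l F l q) z i = \sum_l pfv (F l) z i.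
Proof.
rewrite sum_o5 -!pfvDl; by congr pfv; apply/funext => q; rewrite sum_o5.
Qed.

End Pfv.

Section Jacobi2.
Variable K : numFieldType.
Implicit Types (X Y : vfield K) (w z u : form2 K).

Lemma antisym_diag (R : numFieldType) (V : lmodType R) (f : 'I_5 * 'I_5 -> V) :
  (forall j k, f (k, j) = - f (j, k)) -> forall j, f (j, j) = 0.
Proof.
move=> fa j; have /eqP := fa j j.
rewrite -addr_eq0 -mulr2n -scaler_nat scaler_eq0 pnatr_eq0 /=.
by move/eqP.
Qed.

Lemma fder_pfv j (w z : 'I_5 * 'I_5 -> fps K) i :
  fder j (pfv w z i) =
  pfv (fun q => fder j (w q)) z i + pfv w (fun q => fder j (z q)) i.
Proof.
have fpf a b c d : fder j (pf w z a b c d) =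
    pf (fun q => fder j (w q)) z a b c d + pf w (fun q => fder j (z q)) a b c d.
  by rewrite /pf !(linearD, linearN) /= !fderM; ring.
by rewrite /pfv; case: (val i) => [|[|[|[|k]]]]; rewrite ?linearN /= fpf ?opprD.
Qed.

Lemma lie_der_pfvl X w (z : 'I_5 * 'I_5 -> fps K) i :
  pfv (lie_der X w) z i = \sum_l X l * pfv (fun q => fder l (w q)) z i +
  pfv (fun q => \sum_l (fder q.1 (X l) * w (l, q.2)
                        + fder q.2 (X l) * w (q.1, l))) z i.
Proof.
transitivity (pfv (fun q => \sum_l X l * fder l (w q) +
   \sum_l (fder q.1 (X l) * w (l, q.2) + fder q.2 (X l) * w (q.1, l))) z i).
  apply: (congr1 (fun f => pfv f z i)); apply/funext => q.
  rewrite [LHS]ffunE -[RHS]big_split.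
  by apply: eq_bigr => l _; exact/esym/addrA.
rewrite pfvDl pfv_suml; congr (_ + _); apply: eq_bigr => l _; exact: pfvZl.
Qed.

(** A divergence-free [X] preserves the volume form, so passing from the 4-form w /\ z to its field
    commutes with the Lie derivative; in coordinates this is the Leibniz rule together with
    [pfv_trace0]. *)
Lemma vbracket_obracket X w z :
  X \in @divfree K -> w \in @closed2 K -> z \in @closed2 K ->
  vbracket X (obracket w z) = obracket (lie_der X w) z + obracket w (lie_der X z).
Proof.
move=> /divfreeP X0 /closed2P[wa _] /closed2P[za _].
apply/ffunP => i; rewrite [RHS]ffunE !obracketE ffunE.
rewrite lie_der_pfvl (pfvC w) lie_der_pfvl.
have := @pfv_trace0 _ (fun j i => fder j (X i)) _ _ i X0 wa (antisym_diag wa)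
  za (antisym_diag za).
set P := (X in X = _ -> _) => E.
have -> : \sum_j (X j * fder j (obracket w z i) - obracket w z j * fder j (X i)) =
   \sum_l X l * pfv (fun q => fder l (w q)) z i +
   \sum_l X l * pfv (fun q => fder l (z q)) w i + P.
  rewrite sumrB; congr (_ + _); last first.
    by rewrite /P; congr (- _); apply: eq_bigr => j _; rewrite obracketE.
  rewrite -big_split; apply: eq_bigr => j _.
  by rewrite obracketE fder_pfv mulrDr; congr (_ + X j * _); exact: pfvC.
by rewrite E addrACA; congr (_ + (_ + _)); exact: pfvC.
Qed.

(** Cartan's formula: on closed forms the Lie derivative is d of the contraction with [X]. *)
Lemma lie_derE X w j k : w \in @closed2 K ->
  lie_der X w (j, k) =
  fder j (\sum_l X l * w (l, k)) - fder k (\sum_l X l * w (l, j)).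
Proof.
move=> /closed2P[anti clo].
rewrite ffunE /= (linear_sum (fder j)) (linear_sum (fder k)) -sumrB.
apply: eq_bigr => l _ /=; rewrite !fderM (anti j l) linearN /= mulrN.
have -> : fder l (w (j, k)) = fder j (w (l, k)) + fder k (w (j, l)).
  have := clo l j k; rewrite (anti l k) (anti j l) !linearN /= => /eqP.
  by rewrite -addrA -opprD subr_eq0 => /eqP.
ring.
Qed.

(** The Jacobi identity for three odd elements, two of them equal. By Cartan's formula it is enough
    that the contractions cancel, which is [pfv_cubic]. *)
Lemma lie_der_obracket w u : w \in @closed2 K -> u \in @closed2 K ->
  lie_der (obracket w w) u + lie_der (obracket w u) w *+ 2 = 0.
Proof.
move=> hw hu; apply/ffunP => -[j k]; have addE (a b : form2 K) q : (a + b) q = a q + b q by rewrite ffunE.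
rewrite mulr2n !addE [RHS]ffunE !lie_derE //.
have b0 c : \sum_l obracket w w l * u (l, c) + \sum_l obracket w u l * w (l, c)
            + \sum_l obracket w u l * w (l, c) = 0.
  move/closed2P: hw => [wa _]; move/closed2P: hu => [ua _].
  rewrite -[RHS](pfv_cubic c wa (antisym_diag wa) ua (antisym_diag ua)).
  by rewrite !sum_o5 /= !obracketE; ring.
have D (A B C A' B' C' : fps K) : A + B + C = 0 -> A' + B' + C' = 0 ->
   fder j A - fder k A' + (fder j B - fder k B' + (fder j C - fder k C')) = 0.
  move=> E E'; transitivity (fder j (A + B + C) - fder k (A' + B' + C')).
    rewrite !linearD /=; ring.
  by rewrite E E' !linear0 addr0.
exact: D (b0 k) (b0 j).
Qed.

End Jacobi2.

(** * Modules of linear maps *)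

Section LinearMaps.
Variables (K : fieldType) (U V : lmodType K).

Definition is_linear : {pred U -> V} := fun f => `[< linear f >].

Lemma is_linear_submod : submod_closed is_linear.
Proof.
split=> [|c f g /asboolP hf /asboolP hg]; apply/asboolP => a x y.
  by rewrite /= scaler0 addr0.
have -> z : (c *: f + g) z = c *: f z + g z by [].
by rewrite hf hg !scalerDr !scalerA [c * a]mulrC addrACA.
Qed.

HB.instance Definition _ :=
  GRing.isSubmodClosed.Build K (U -> V) is_linear is_linear_submod.

Record LinMap := MkHom { hom_fun :> U -> V; _ : hom_fun \in is_linear }.
HB.instance Definition _ := [isSub for hom_fun].
HB.instance Definition _ := [Choice of LinMap by <:].
HB.instance Definition _ := [SubChoice_isSubLmodule of LinMap by <:].

Lemma homP (f : LinMap) : linear f.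
Proof. exact/asboolP/(valP f). Qed.

HB.instance Definition _ (f : LinMap) := GRing.isLinear.Build K U V _ f (homP f).

Lemma homE (c : K) (f g : LinMap) x : (c *: f + g) x = c *: f x + g x.
Proof. by []. Qed.

Lemma hom_addE (f g : LinMap) x : (f + g) x = f x + g x.
Proof. by []. Qed.

Lemma hom_oppE (f : LinMap) x : (- f) x = - f x.
Proof. by []. Qed.

Lemma hom_ext (f g : LinMap) : f =1 g -> f = g.
Proof. by move=> fg; apply/val_inj/funext. Qed.

Definition mkhom (f : U -> V) (fL : linear f) : LinMap := MkHom (asboolT fL).

End LinearMaps.

(* The summand K^o only serves to make the endomorphism ring nontrivial. *)
Definition Endo (K : fieldType) (E : lmodType K) :=
  let E' : lmodType K := (E * K^o)%type in LinMap E' E'.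

Section Endomorphisms.
Variables (K : fieldType) (E : lmodType K).
Local Notation E' := ((E * K^o)%type : lmodType K).
Local Notation Endo := (Endo E).

HB.instance Definition _ := GRing.Lmodule.on Endo.

Implicit Types f g h : Endo.

Lemma endo1_linear : linear (fun x : E' => x). Proof. by []. Qed.
Lemma endo_mul_linear f g : linear (fun x : E' => f (g x)).
Proof. by move=> c x y; rewrite !linearP. Qed.

Definition endo1 : Endo := mkhom endo1_linear.
Definition endo_mul f g : Endo := mkhom (endo_mul_linear f g).

Lemma endo_mulA : associative endo_mul. Proof. by move=> f g h; exact: hom_ext. Qed.
Lemma endo_mul1 : left_id endo1 endo_mul. Proof. by move=> f; exact: hom_ext. Qed.
Lemma endo_mulr1 : right_id endo1 endo_mul. Proof. by move=> f; exact: hom_ext. Qed.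
Lemma endo_mulDl : left_distributive endo_mul +%R.
Proof. by move=> f g h; exact: hom_ext. Qed.
Lemma endo_mulDr : right_distributive endo_mul +%R.
Proof. by move=> f g h; apply: hom_ext => x; exact: (linearD f). Qed.
Lemma endo1_neq0 : endo1 != 0.
Proof.
apply/eqP => /(congr1 (fun f : Endo => (f (0, 1)).2)) /eqP.
by rewrite /= oner_eq0.
Qed.

HB.instance Definition _ := GRing.Zmodule_isNzRing.Build Endo
  endo_mulA endo_mul1 endo_mulr1 endo_mulDl endo_mulDr endo1_neq0.

Lemma endo_scaleAl (c : K) f g : c *: (f * g) = (c *: f) * g.
Proof. exact: hom_ext. Qed.

HB.instance Definition _ := GRing.Lmodule_isLalgebra.Build K Endo endo_scaleAl.

Lemma endo_scaleAr (c : K) f g : c *: (f * g) = f * (c *: g).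
Proof. by apply: hom_ext => x; exact/esym/(linearZ_LR f). Qed.

HB.instance Definition _ := GRing.Lalgebra_isAlgebra.Build K Endo endo_scaleAr.

Lemma endo_mulE f g x : (f * g) x = f (g x). Proof. by []. Qed.

Lemma endo_of_linear (t : E -> E) : linear t -> linear (fun x : E' => (t x.1, 0) : E').
Proof. move=> tL c x y; rewrite tL; congr pair.
by rewrite -[RHS]/(c * 0 + 0) mulr0 addr0. Qed.

End Endomorphisms.

Lemma mul3_linearr (K : fieldType) (A : comAlgType K) c (x y z a a' b b' d d' : A) :
  x * (c *: a + a') + y * (c *: b + b') + z * (c *: d + d') =
  c *: (x * a + y * b + z * d) + (x * a' + y * b' + z * d').
Proof. by rewrite !mulrDr -!scalerAr; lincomb. Qed.

Lemma mul3_linearl (K : fieldType) (A : comAlgType K) c (x y z a a' b b' d d' : A) :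
  (c *: a + a') * x + (c *: b + b') * y + (c *: d + d') * z =
  c *: (a * x + b * y + d * z) + (a' * x + b' * y + d' * z).
Proof. by rewrite !mulrDl -!scalerAl; lincomb. Qed.

(** * The adjoint action and modules of the form Hom(L, E) *)

Section Adjoint.
Variable K : numFieldType.
Implicit Types (X Y : S5 K) (w z : Om2 K) (y : E510 K).

Lemma S5_ext X Y : (forall i, vfield_of X i = vfield_of Y i) -> X = Y.
Proof. by move=> XY; apply/val_inj/ffunP. Qed.

Lemma Om2_ext w z : (forall q, form_of w q = form_of z q) -> w = z.
Proof. by move=> wz; apply/val_inj/ffunP. Qed.

Lemma S5E (c : K) X Y i : vfield_of (c *: X + Y) i = c *: vfield_of X i + vfield_of Y i.
Proof. by rewrite /= !ffunE. Qed.

Lemma Om2E (c : K) w z q : form_of (c *: w + z) q = c *: form_of w q + form_of z q.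
Proof. by rewrite /= !ffunE. Qed.

Lemma S5_bracketC X Y : S5_bracket X Y = - S5_bracket Y X.
Proof.
apply: S5_ext => i; rewrite /= !ffunE -sumrN.
by apply: eq_bigr => j _; rewrite opprB.
Qed.

Lemma S5_bracket_linear X : linear (S5_bracket X).
Proof.
move=> c Y Z; apply: S5_ext => i; rewrite S5E /= !ffunE.
rewrite scaler_sumr -big_split /=; apply: eq_bigr => j _.
by rewrite !ffunE linearP /= mulrDl mulrDr scalerBr -!scalerAl -scalerAr opprD addrACA.
Qed.

Lemma S5_bracket_linearl X c Y Z :
  S5_bracket (c *: Y + Z) X = c *: S5_bracket Y X + S5_bracket Z X.
Proof. by rewrite S5_bracketC S5_bracket_linear opprD -scalerN -!S5_bracketC. Qed.

Lemma S5_act_linear X : linear (S5_act X).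
Proof.
move=> c w z; apply: Om2_ext => q; rewrite Om2E /= !ffunE.
rewrite scaler_sumr -big_split /=; apply: eq_bigr => j _.
by rewrite !ffunE linearP; exact: mul3_linearr.
Qed.

Lemma S5_act_linearl w c X Y :
  S5_act (c *: X + Y) w = c *: S5_act X w + S5_act Y w.
Proof.
apply: Om2_ext => q; rewrite Om2E /= !ffunE.
rewrite scaler_sumr -big_split /=; apply: eq_bigr => j _.
by rewrite !ffunE !linearP; exact: mul3_linearl.
Qed.

Lemma Om2_bracketC w z : Om2_bracket w z = Om2_bracket z w.
Proof. by apply: val_inj; exact: obracketC. Qed.

Lemma Om2_bracket_linear w : linear (Om2_bracket w).
Proof.
move=> c z z'; apply: S5_ext => i; rewrite S5E /= !ffunE.
rewrite scaler_sumr -big_split /=; apply: eq_bigr => p _.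
rewrite scaler_sumr -big_split /=; apply: eq_bigr => q _.
by rewrite !ffunE mulrDr scalerDr -scalerAr !scalerA [c * _]mulrC.
Qed.

Lemma Om2_bracket_linearl z c w w' :
  Om2_bracket (c *: w + w') z = c *: Om2_bracket w z + Om2_bracket w' z.
Proof. by rewrite Om2_bracketC Om2_bracket_linear !(Om2_bracketC z). Qed.

HB.instance Definition _ X :=
  GRing.isLinear.Build K (S5 K) (S5 K) _ (S5_bracket X) (S5_bracket_linear X).
HB.instance Definition _ X :=
  GRing.isLinear.Build K (Om2 K) (Om2 K) _ (S5_act X) (S5_act_linear X).
HB.instance Definition _ w :=
  GRing.isLinear.Build K (Om2 K) (S5 K) _ (Om2_bracket w) (Om2_bracket_linear w).

Lemma S5_act0 w : S5_act 0 w = 0.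
Proof. exact: (linear0 (mkhom (S5_act_linearl w))). Qed.

Lemma S5_bracket0 Y : S5_bracket 0 Y = 0.
Proof. exact: (linear0 (mkhom (S5_bracket_linearl Y))). Qed.

Lemma Om2_bracket0 w : Om2_bracket 0 w = 0.
Proof. exact: (linear0 (mkhom (Om2_bracket_linearl w))). Qed.

Lemma S5_jacobi X Y Z :
  S5_bracket X (S5_bracket Y Z) - S5_bracket Y (S5_bracket X Z) =
  S5_bracket (S5_bracket X Y) Z.
Proof. by apply: val_inj; exact: vbracket_jacobi. Qed.

Lemma S5_act_bracket X Y w :
  S5_act X (S5_act Y w) - S5_act Y (S5_act X w) = S5_act (S5_bracket X Y) w.
Proof. by apply: val_inj; exact: lie_der_vbracket. Qed.

Lemma S5_Om2_bracket X w z : S5_bracket X (Om2_bracket w z) =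
  Om2_bracket (S5_act X w) z + Om2_bracket w (S5_act X z).
Proof. by apply: val_inj; exact: (vbracket_obracket (valP X) (valP w) (valP z)). Qed.

Lemma Om2_bracket_act w z :
  S5_act (Om2_bracket w w) z = - (S5_act (Om2_bracket w z) w *+ 2).
Proof.
apply/eqP; rewrite -addr_eq0; apply/eqP.
by apply: val_inj; exact: (lie_der_obracket (valP w) (valP z)).
Qed.

Definition adX X y : E510 K := (S5_bracket X y.1, S5_act X y.2).
Definition adW w y : E510 K := (Om2_bracket w y.2, - S5_act y.1 w).
(** The parity automorphism, the source of the signs in [homW]. *)
Definition sg y : E510 K := (y.1, - y.2).

Lemma sgK y : sg (sg y) = y.
Proof. by case: y => a b; rewrite /sg /= opprK. Qed.

Lemma sgN y : sg (- y) = - sg y.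
Proof. by []. Qed.

Lemma sg_linear : linear sg.
Proof. by move=> c y y'; congr pair; rewrite /= opprD scalerN. Qed.

Lemma adX_linear X : linear (adX X).
Proof. by move=> c y y'; congr pair; rewrite /= linearP. Qed.

Lemma adW_linear w : linear (adW w).
Proof.
move=> c y y'; congr pair; rewrite /= ?linearP //.
by rewrite S5_act_linearl opprD scalerN.
Qed.

Lemma adX_linearl y c X Y : adX (c *: X + Y) y = c *: adX X y + adX Y y.
Proof. by congr pair; rewrite /= (S5_bracket_linearl, S5_act_linearl). Qed.

Lemma adW_linearl y c w z : adW (c *: w + z) y = c *: adW w y + adW z y.
Proof.
congr pair; rewrite /= ?Om2_bracket_linearl //.
by rewrite linearP /= opprD scalerN.
Qed.

Lemma adX_sg X y : adX X (sg y) = sg (adX X y).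
Proof. by congr pair; rewrite /= linearN. Qed.

Lemma adW_sg w y : adW w (sg y) = - sg (adW w y).
Proof. by congr pair; [exact: linearN | rewrite /= opprK]. Qed.

Lemma adXX X Y y : adX X (adX Y y) - adX Y (adX X y) = adX (S5_bracket X Y) y.
Proof. by congr pair; [exact: S5_jacobi | exact: S5_act_bracket]. Qed.

Lemma adXW X w y : adX X (adW w y) - adW w (adX X y) = adW (S5_act X w) y.
Proof.
congr pair; first by rewrite /= S5_Om2_bracket addrK.
by rewrite /= linearN /= -S5_act_bracket opprK addKr.
Qed.

Lemma adWW w y : adW w (adW w y) *+ 2 = adX (Om2_bracket w w) y.
Proof.
rewrite mulr2n; congr pair; rewrite /=.
  rewrite linearN /= (S5_bracketC _ y.1) S5_Om2_bracket.
  by rewrite (Om2_bracketC (S5_act _ _)) opprD.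
by rewrite Om2_bracket_act mulr2n opprD.
Qed.

End Adjoint.

(** The relation for two odd elements is required on the diagonal only; [actWz] polarizes it. *)
Record lrep (K : numFieldType) (E : lmodType K) := LRep {
  actX : S5 K -> E -> E;
  actW : Om2 K -> E -> E;
  actX_linear : forall X, linear (actX X);
  actW_linear : forall w, linear (actW w);
  actX_linearl : forall T c X Y, actX (c *: X + Y) T = c *: actX X T + actX Y T;
  actW_linearl : forall T c w z, actW (c *: w + z) T = c *: actW w T + actW z T;
  actXX : forall X Y T,
    actX X (actX Y T) - actX Y (actX X T) = actX (S5_bracket X Y) T;
  actXW : forall X w T,
    actX X (actW w T) - actW w (actX X T) = actW (S5_act X w) T;
  actWW : forall w T, actW w (actW w T) *+ 2 = actX (Om2_bracket w w) T }.

HB.instance Definition _ (K : numFieldType) (E : lmodType K) (r : lrep E) X :=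
  GRing.isLinear.Build K E E _ (actX r X) (actX_linear r X).
HB.instance Definition _ (K : numFieldType) (E : lmodType K) (r : lrep E) w :=
  GRing.isLinear.Build K E E _ (actW r w) (actW_linear r w).

(* The signs are those of [L^* \otimes E], so that the action of an odd [w] does
   not refer to the parity of the elements of [E]. *)
Section HomRep.
Variables (K : numFieldType) (E : lmodType K) (r : lrep E).
Local Notation H := (LinMap (E510 K) E).
Implicit Types (X Y : S5 K) (w z : Om2 K) (T : H).

Let actXh X T (y : E510 K) : E := actX r X (T y) - T (adX X y).

Let actWh w T (y : E510 K) : E := actW r w (T (sg y)) + T (adW w (sg y)).

Lemma homX_linear X T : linear (actXh X T).
Proof.
by move=> c y z; rewrite /actXh adX_linear !linearP /=; lincomb.
Qed.

Lemma homW_linear w T : linear (actWh w T).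
Proof.
by move=> c y z; rewrite /actWh sg_linear adW_linear !linearP /=; lincomb.
Qed.

Definition homX X T : H := mkhom (homX_linear X T).
Definition homW w T : H := mkhom (homW_linear w T).

Lemma homXE X T y : homX X T y = actX r X (T y) - T (adX X y).
Proof. by []. Qed.

Lemma homWE w T y : homW w T y = actW r w (T (sg y)) + T (adW w (sg y)).
Proof. by []. Qed.

Lemma homX_lin X : linear (homX X).
Proof.
by move=> c T T'; apply: hom_ext => y; rewrite homE !homXE !homE linearP /=; lincomb.
Qed.

Lemma homW_lin w : linear (homW w).
Proof.
by move=> c T T'; apply: hom_ext => y; rewrite homE !homWE !homE linearP /=; lincomb.
Qed.

Lemma homX_linl T c X Y : homX (c *: X + Y) T = c *: homX X T + homX Y T.
Proof.
apply: hom_ext => y; rewrite homE !homXE actX_linearl adX_linearl !linearP /=.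
by lincomb.
Qed.

Lemma homW_linl T c w z : homW (c *: w + z) T = c *: homW w T + homW z T.
Proof.
apply: hom_ext => y; rewrite homE !homWE actW_linearl adW_linearl !linearP /=.
by lincomb.
Qed.

Lemma homXX X Y T : homX X (homX Y T) - homX Y (homX X T) = homX (S5_bracket X Y) T.
Proof.
apply: hom_ext => y; rewrite hom_addE hom_oppE !homXE !linearB /=.
by rewrite -actXX -adXX !linearB /=; lincomb.
Qed.

Lemma homXW X w T : homX X (homW w T) - homW w (homX X T) = homW (S5_act X w) T.
Proof.
apply: hom_ext => y; rewrite hom_addE hom_oppE !(homXE, homWE) !(linearB, linearD) /=.
by rewrite -actXW -adXW !linearB /= !adX_sg; lincomb.
Qed.

Lemma homWW w T : homW w (homW w T) *+ 2 = homX (Om2_bracket w w) T.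
Proof.
rewrite mulr2n; apply: hom_ext => y; rewrite hom_addE homXE !homWE.
have -> : sg (adW w (sg y)) = - adW w y.
  by rewrite adW_sg sgN sgK.
have -> : adW w (- adW w y) = - adW w (adW w y).
  exact: (linearN (mkhom (adW_linear w))).
rewrite sgK -actWW -adWW !mulr2n !(linearN, linearD) /=.
by lincomb.
Qed.

Definition hom_lrep : lrep H := LRep homX_lin homW_lin homX_linl homW_linl
  homXX homXW homWW.

End HomRep.

Section Operators.
Variables (K : numFieldType) (E : lmodType K) (r : lrep E).
Implicit Types (x y : E510 K) (T : E).

Definition lact x T : E := actX r x.1 T + actW r x.2 T.

Lemma lact_linear x : linear (lact x).
Proof. by move=> c T T'; rewrite /lact !linearP /=; lincomb. Qed.

Definition op x : Endo E := mkhom (endo_of_linear (lact_linear x)).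

Lemma actX0 T : actX r 0 T = 0.
Proof. exact: (linear0 (mkhom (actX_linearl r T))). Qed.
Lemma actW0 T : actW r 0 T = 0.
Proof. exact: (linear0 (mkhom (actW_linearl r T))). Qed.
Lemma actWN w T : actW r (- w) T = - actW r w T.
Proof. exact: (linearN (mkhom (actW_linearl r T))). Qed.
Lemma actXD X Y T : actX r (X + Y) T = actX r X T + actX r Y T.
Proof. exact: (linearD (mkhom (actX_linearl r T))). Qed.
Lemma actWD w z T : actW r (w + z) T = actW r w T + actW r z T.
Proof. exact: (linearD (mkhom (actW_linearl r T))). Qed.

Lemma actWz w z T :
  actW r w (actW r z T) + actW r z (actW r w T) = actX r (Om2_bracket w z) T.
Proof.
have B : Om2_bracket (w + z) (w + z) =
    Om2_bracket w w + Om2_bracket w z + Om2_bracket w z + Om2_bracket z z.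
  rewrite linearD /= (Om2_bracketC (w + z) w) (Om2_bracketC (w + z) z) !linearD /=.
  by rewrite (Om2_bracketC z w) addrA.
have := actWW r (w + z) T; rewrite B !actXD -!actWW !actWD !linearD /= => e.
apply: (@scalerI _ _ 2); first by rewrite pnatr_eq0.
move/eqP: e; rewrite -subr_eq0 => /eqP e; apply/eqP; rewrite -subr_eq0; apply/eqP.
by rewrite -[RHS]e; lincomb.
Qed.

Lemma op_super_morph : is_super_morph op.
Proof.
split.
  move=> c x y; apply: hom_ext => -[T k].
  rewrite homE /= /lact /= actX_linearl actW_linearl; congr pair; first by rewrite /=; lincomb.
  by rewrite -[RHS]/(c * 0 + 0) mulr0 addr0.
move=> b1 b2 [X w] [Y z] h1 h2; apply: hom_ext => -[T k].
rewrite hom_addE hom_oppE.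
have sE : ((-1) ^+ (b1 && b2) * (op (Y, z) * op (X, w))) (T, k) =
    (-1) ^+ (b1 && b2) *: (op (Y, z) * op (X, w)) (T, k).
  by case: (b1 && b2); rewrite ?expr1 ?expr0 ?mulN1r ?mul1r ?scaleN1r ?scale1r.
rewrite sE !endo_mulE /=; congr pair; last first.
  by rewrite -[RHS]/(0 - _ * 0) mulr0 subr0.
case: b1 h1 {sE} => /= ->; case: b2 h2 => /= ->; rewrite /lact /= ?expr1 ?expr0.
- rewrite !S5_act0 S5_bracket0 !subrr actW0 !actX0 !add0r addr0 -actWz.
  by lincomb.
- rewrite S5_bracket0 S5_act0 Om2_bracketC Om2_bracket0 add0r actX0 !actW0 sub0r.
  by rewrite actWN -actXW !(actX0, actW0, addr0, add0r); lincomb.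
- rewrite S5_bracketC S5_bracket0 S5_act0 Om2_bracket0 oppr0 add0r actX0 subr0.
  by rewrite -actXW !(actX0, actW0, addr0, add0r); lincomb.
- by rewrite !linear0 ?subrr ?addr0 !actW0 ?addr0 -actXX; lincomb.
Qed.

(** Frobenius reciprocity: the universal property of [U] turns the action on [E] into an algebra
    morphism, and that of [M] extends [Psi]. Only the values on tensors of degree at most one in L
    are recorded. *)
Lemma induced_map (V : vectType K) (a : E510 K -> V -> V)
    (U : algType K) (iota : E510 K -> U) (hU : is_enveloping iota)
    (M : lmodType K) (aM : U -> M -> M) (ten : U -> V -> M)
    (hM : is_induced iota a aM ten) (Psi : V -> E) :
  linear Psi -> (forall x v, Lge0 x -> Psi (a x v) = lact x (Psi v)) ->
  exists G : M -> E, [/\ linear G, forall v, G (ten 1 v) = Psi v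
    & forall x v, G (ten (iota x) v) = lact x (Psi v)].
Proof.
move=> PsiL PsiP; have [g gE] := env_ex hU op_super_morph.
pose f u v := g u (Psi v, 0).
have bal : is_balanced iota a f.
  split=> [v c u u'|u c v v'|u x v hx]; rewrite /f.
  - by rewrite linearP.
  - have -> : (Psi (c *: v + v'), 0 : K^o) = c *: (Psi v, 0) + (Psi v', 0).
      by rewrite PsiL; congr pair; rewrite -[RHS]/(c * 0 + 0) mulr0 addr0.
    by rewrite linearP.
  have -> : g (u * iota x) = g u * op x by rewrite -gE; exact: rmorphM.
  by rewrite PsiP.
have [G GE] := ind_ex hM bal.
exists (fun m => (G m).1); split=> [c m m'|v|x v].
- by rewrite linearP.
- by rewrite GE /f (_ : g 1 = 1) //; exact: rmorph1.
by rewrite GE /f gE.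
Qed.

End Operators.

Section EvalAt0.
Variable K : numFieldType.
Implicit Types f g : fps K.

Lemma splits0 (q : mon * mon) : (q \in splits 0) = (q == (0, 0)).
Proof.
rewrite mem_splits; case: q => a b; apply/eqP/eqP => [/ffunP e|[-> ->]]; last exact: addr0.
by congr pair; apply/ffunP => i; have := e i; rewrite !ffunE => /eqP;
  rewrite addn_eq0 => /andP[/eqP ? /eqP ?].
Qed.

Lemma fmul_at0 f g : (f * g) 0 = f 0 * g 0.
Proof.
rewrite -[LHS]/(\sum_(q <- splits 0) f q.1 * g q.2) (bigD1_seq (0, 0)) ?splits_uniq //=;
  last by rewrite splits0.
rewrite big1_seq ?addr0 // => q /andP[]; rewrite splits0 => /negP ne /eqP e.
by case: ne; rewrite e.
Qed.

Lemma fadd_at0 f g : (f + g) 0 = f 0 + g 0. Proof. by []. Qed.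
Lemma fopp_at0 f : (- f) 0 = - f 0. Proof. by []. Qed.
Lemma fscale_at0 c f : (c *: f) 0 = c * f 0. Proof. by []. Qed.

Lemma fsum_at0 (I : Type) (s : seq I) (P : pred I) (F : I -> fps K) :
  (\sum_(i <- s | P i) F i) 0 = \sum_(i <- s | P i) F i 0.
Proof. by apply: (big_morph (fun f : fps K => f 0)). Qed.

End EvalAt0.

(** * Tensors in the iterated modules Hom(L, -) *)

Section Tensors.
Variable K : numFieldType.

Fixpoint En (n : nat) : lmodType K :=
  if n is n'.+1 then LinMap (E510 K) (En n') else K^o.

Fixpoint tens (n : nat) : lmodType K :=
  if n is n'.+1 then {ffun 'I_5 -> tens n'} else K^o.

Lemma zero_linear (E E' : lmodType K) : linear (fun _ : E => 0 : E').
Proof. by move=> c x y; rewrite scaler0 addr0. Qed.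

Lemma zero_linearl (E E' : lmodType K) (T : E) (c : K) (X Y : E') :
  0 = c *: 0 + 0 :> E.
Proof. by rewrite scaler0 addr0. Qed.

Definition trivial_lrep (E : lmodType K) : lrep E :=
  @LRep _ _ (fun _ _ => 0) (fun _ _ => 0) (fun=> @zero_linear E E)
    (fun=> @zero_linear E E) (@zero_linearl E (S5 K)) (@zero_linearl E (Om2 K))
    (fun _ _ _ => subrr 0) (fun _ _ _ => subrr 0) (fun _ _ => mul0rn _ 2).

Fixpoint repn n : lrep (En n) :=
  if n is n'.+1 then hom_lrep (repn n') else trivial_lrep K^o.

Lemma at0_linear (E : lmodType K) (t : 'I_5 -> E) :
  linear (fun y : E510 K => \sum_i vfield_of y.1 i 0 *: t i).
Proof.
move=> c y z; rewrite scaler_sumr -big_split; apply: eq_bigr => i _ /=.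
by rewrite !ffunE scalerA -scalerDl.
Qed.

Definition at0 (E : lmodType K) (t : 'I_5 -> E) : LinMap (E510 K) E :=
  mkhom (at0_linear t).

Fixpoint emb n : tens n -> En n :=
  if n is n'.+1 return tens n -> En n then fun t => at0 (fun i => emb (t i))
  else id.

(** The matrix unit E_kl on tensor powers of K^5, where [t i] is the coefficient of the i-th basis
    vector in the first factor. *)
Fixpoint gl n (k l : 'I_5) : tens n -> tens n :=
  if n is n'.+1 return tens n -> tens n then
    fun t => [ffun i => gl k l (t i) + (i == k)%:R *: t l]
  else fun=> 0.

Lemma gl_linear n k l : linear (@gl n k l).
Proof.
elim: n => [|n IH] c t t' /=; first by rewrite scaler0 addr0.
by apply/ffunP => i; rewrite !ffunE IH; lincomb.
Qed.

HB.instance Definition _ n k l :=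
  GRing.isLinear.Build K (tens n) (tens n) _ (@gl n k l) (@gl_linear n k l).

Lemma emb_linear n : linear (@emb n).
Proof.
elim: n => [|n IH] c t t' //=; apply: hom_ext => y.
rewrite homE /= scaler_sumr -big_split; apply: eq_bigr => i _ /=.
by rewrite ffunE ffunE IH; lincomb.
Qed.

HB.instance Definition _ n :=
  GRing.isLinear.Build K (tens n) (En n) _ (@emb n) (@emb_linear n).

(** If [X] vanishes at 0, then [X, Y](0) depends only on Y(0) and on the linear part of [X]. So [X]
    acts through its linear part, the field x_j d/dx_i acting as E_ji. *)
Lemma actX_emb n (X : S5 K) (t : tens n) : (forall i, vfield_of X i 0 = 0) ->
  actX (repn n) X (emb t) =
  emb (\sum_i \sum_j fder j (vfield_of X i) 0 *: gl j i t).
Proof.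
move=> X0; elim: n t => [|n IH] t.
  by rewrite /= big1 // => i _; rewrite big1 // => j _; rewrite scaler0.
apply: hom_ext => y; rewrite [LHS]homXE /= linear_sum /=.
set D := fun i j => fder j (vfield_of X i) 0.
under eq_bigr => i _ do rewrite linearZ /= IH.
have E i : vfield_of (S5_bracket X y.1) i 0 = - \sum_j D i j * vfield_of y.1 j 0.
  rewrite /= ffunE fsum_at0 -sumrN; apply: eq_bigr => j _.
  by rewrite fadd_at0 fopp_at0 !fmul_at0 X0 mul0r sub0r [_ * D i j]mulrC.
under [X in _ - X]eq_bigr => i _ do rewrite E scaleNr scaler_suml.
rewrite sumrN opprK [X in _ + X]exchange_big -big_split /=.
apply: eq_bigr => k _.
have -> : (\sum_i \sum_j D i j *: [ffun k => gl j i (t k) + (k == j)%:R *: t i]) k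
    = \sum_i \sum_j D i j *: gl j i (t k) + \sum_i D i k *: t i.
  rewrite sum_ffunE -big_split; apply: eq_bigr => i _ /=.
  rewrite sum_ffunE (bigD1 k) //= [in RHS](bigD1 k) //= !ffunE eqxx scale1r scalerDr.
  rewrite addrAC; congr (_ + _ + _); apply: eq_bigr => j jk.
  by rewrite !ffunE eq_sym (negPf jk) scale0r addr0.
rewrite linearD scalerDr; congr (_ + _); rewrite linear_sum scaler_sumr.
by apply: eq_bigr => i _; rewrite linearZ /= scalerA mulrC.
Qed.

Lemma actW_emb n (w : Om2 K) (t : tens n) : (forall q, form_of w q 0 = 0) ->
  actW (repn n) w (emb t) = 0.
Proof.
move=> w0; elim: n t => [|n IH] t //; apply: hom_ext => y.
rewrite [LHS]homWE /= linear_sum big1 => [|i _]; last by rewrite linearZ /= IH scaler0.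
rewrite add0r big1 // => i _; rewrite ffunE fsum_at0 big1 ?scale0r // => p _.
by rewrite fsum_at0 big1 // => q _; rewrite fscale_at0 fmul_at0 w0 mul0r mulr0.
Qed.

Definition dvf (i : 'I_5) : vfield K := [ffun j => (j == i)%:R].

Lemma dvf_divfree i : dvf i \in @divfree K.
Proof. by apply/divfreeP; rewrite big1 // => j _; rewrite ffunE fder_nat. Qed.

Lemma fone_at0 : (1 : fps K) 0 = 1.
Proof. by rewrite -[LHS]/((0 == 0 :> mon)%:R) eqxx. Qed.

Lemma fnat_at0 (b : bool) : (b%:R : fps K) 0 = b%:R.
Proof. by case: b; [exact: fone_at0 |]. Qed.

Lemma emb_dvf n (t : tens n.+1) i : emb t (MkS5 (dvf_divfree i), 0) = emb (t i).
Proof.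
rewrite /= (bigD1 i) //= ffunE fnat_at0 eqxx scale1r big1 ?addr0 // => j ji.
by rewrite ffunE fnat_at0 (negPf ji) scale0r.
Qed.

Lemma emb_inj n : injective (@emb n).
Proof.
elim: n => [|n IH] t t' // /(congr1 (fun f : LinMap _ _ => f : _ -> _)) e.
by apply/ffunP => i; apply: IH; rewrite -!emb_dvf e.
Qed.

Lemma fd_form1 (p : pair5) (q : 'I_5 * 'I_5) : (q.1 < q.2)%N ->
  fd_form (1 : fps K) (val p).1 (val p).2 q = (q == val p)%:R.
Proof.
move: p q => [[a b] /= ab] [c d] /= cd; rewrite ffunE mulr1.
rewrite (_ : (c, d) == (b, a) = false) ?subr0 //.
by apply/negP => /eqP[ec ed]; move: cd; rewrite ec ed ltnNge ltnW.
Qed.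

Lemma Om2_bracket_dd (p q : pair5) i :
  vfield_of (Om2_bracket (MkOm2 (d_closed2 K p)) (MkOm2 (d_closed2 K q))) i 0 =
  eps5 K i (val p).1 (val p).2 (val q).1 (val q).2.
Proof.
rewrite /= ffunE (bigD1 (val p)) ?(valP p) //= [X in _ + X]big1 ?addr0; last first.
  move=> p' /andP[lt ne]; rewrite big1 // => q' lt'.
  by rewrite fd_form1 // (negPf ne) mul0r scaler0.
rewrite (bigD1 (val q)) ?(valP q) //= [X in _ + X]big1 ?addr0; last first.
  by move=> q' /andP[lt ne]; rewrite [X in _ * X]fd_form1 // (negPf ne) mulr0 scaler0.
by rewrite !fd_form1 ?(valP p) ?(valP q) // fscale_at0 fmul_at0 !fnat_at0 !eqxx !mulr1.
Qed.

(** Embedded tensors vanish on the odd part of L. After d_p has acted, the value at d_q is the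
    contraction of the first index with - [d_p, d_q]; this is how the d_p are told apart. *)
Lemma actW_dd_emb n (p q : pair5) (t : tens n.+1) :
  actW (repn n.+1) (MkOm2 (d_closed2 K p)) (emb t) (0, MkOm2 (d_closed2 K q)) =
  - \sum_i eps5 K i (val p).1 (val p).2 (val q).1 (val q).2 *: emb (t i).
Proof.
rewrite [LHS]homWE /= big1 => [|i _]; last by rewrite ffunE scale0r.
rewrite linear0 add0r -sumrN; apply: eq_bigr => i _; rewrite -scaleNr; congr (_ *: _).
rewrite -Om2_bracket_dd -fopp_at0.
have e : Om2_bracket (MkOm2 (d_closed2 K p)) (- MkOm2 (d_closed2 K q)) =
  - Om2_bracket (MkOm2 (d_closed2 K p)) (MkOm2 (d_closed2 K q)) by exact: linearN.
by move/(congr1 (fun X => vfield_of X i 0)): e => /= ->; rewrite ffunE.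
Qed.

End Tensors.

(** * Highest weight theory for gl_5 *)

(** A subspace of maximal dimension inside [P] contains every element of [P], since adjoining one
    keeps it inside [P]. *)
Lemma pred_vspace (K : fieldType) (V : vectType K) (P : V -> Prop) :
  P 0 -> (forall c x y, P x -> P y -> P (c *: x + y)) ->
  exists W : {vspace V}, forall x, x \in W <-> P x.
Proof.
move=> P0 PL.
pose good d := `[< exists2 W : {vspace V}, \dim W = d & forall x, x \in W -> P x >].
have ex : exists d, good d.
  by exists 0; apply/asboolP; exists 0%VS; rewrite ?dimv0 // => x; rewrite memv0 => /eqP ->.
have bound d : good d -> (d <= \dim {:V})%N.
  by move=> /asboolP[W <- _]; rewrite dimvS ?subvf.
case: (ex_maxnP ex bound) => d /asboolP[W dW WP] dmax.
exists W => x; split=> [/WP //|Px].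
apply/negP => /negP xW; have : good (\dim (W + <[x]>)).
  apply/asboolP; exists (W + <[x]>)%VS => // y /memv_addP[w wW [z /vlineP[c ->] ->]].
  by rewrite addrC; exact/PL/WP.
move=> /dmax; rewrite -dW leqNgt => /negP; apply.
rewrite ltn_neqAle dimvS ?addvSl // andbT; apply/negP => /eqP e.
have /eqP WE : W == (W + <[x]>)%VS by rewrite eqEdim addvSl e leqnn.
by move/negP: xW; apply; rewrite WE (subvP (addvSr _ _)) // memv_line.
Qed.

Section GlModules.
Variable K : numFieldType.

Record is_gl (X : lmodType K) (e : 'I_5 -> 'I_5 -> X -> X) : Prop := {
  gl_lin : forall i j, linear (e i j);
  gl_comm : forall i j k l x, e i j (e k l x) - e k l (e i j x) =
     (j == k)%:R *: e i l x - (i == l)%:R *: e k j x }.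

Record is_hw (X : lmodType K) (e : 'I_5 -> 'I_5 -> X -> X) (mu : 'I_5 -> K) (x : X)
    : Prop := {
  hw_raise : forall i j : 'I_5, (i < j)%N -> e i j x = 0;
  hw_weight : forall i, e i i x = mu i *: x }.

Inductive low_span (X : lmodType K) (e : 'I_5 -> 'I_5 -> X -> X) (x0 : X) : X -> Prop :=
| LSbase : low_span e x0 x0
| LScomb c x y of low_span e x0 x & low_span e x0 y : low_span e x0 (c *: x + y)
| LSlow (i j : 'I_5) x of (j < i)%N & low_span e x0 x : low_span e x0 (e i j x).

Section OneModule.
Variables (X : lmodType K) (e : 'I_5 -> 'I_5 -> X -> X) (glX : is_gl e).

Let eM i j := mkhom (gl_lin glX i j).

Lemma gl0 i j : e i j 0 = 0. Proof. exact: (linear0 (eM i j)). Qed.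
Lemma glD i j x y : e i j (x + y) = e i j x + e i j y.
Proof. exact: (linearD (eM i j)). Qed.
Lemma glN i j x : e i j (- x) = - e i j x.
Proof. exact: (linearN (eM i j)). Qed.
Lemma glB i j x y : e i j (x - y) = e i j x - e i j y.
Proof. exact: (linearB (eM i j)). Qed.
Lemma glZ i j c x : e i j (c *: x) = c *: e i j x.
Proof. exact: (linearZ_LR (eM i j)). Qed.
Lemma gl_sum i j (I : Type) (s : seq I) (P : pred I) (F : I -> X) :
  e i j (\sum_(a <- s | P a) F a) = \sum_(a <- s | P a) e i j (F a).
Proof. exact: (linear_sum (eM i j)). Qed.

Lemma gl_swap i j k l x : e i j (e k l x) =
  e k l (e i j x) + ((j == k)%:R *: e i l x - (i == l)%:R *: e k j x).
Proof. by rewrite -(gl_comm glX) addrC subrK. Qed.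

Variables (mu : 'I_5 -> K) (x0 : X) (hw0 : is_hw e mu x0).

Lemma low_span0 : low_span e x0 0.
Proof.
have := LScomb (-1) (LSbase e x0) (LSbase e x0).
by rewrite scaleN1r addNr.
Qed.

Lemma low_spanZ c x : low_span e x0 x -> low_span e x0 (c *: x).
Proof. by move=> hx; have := LScomb c hx low_span0; rewrite addr0. Qed.

Lemma low_spanD x y : low_span e x0 x -> low_span e x0 y -> low_span e x0 (x + y).
Proof. by move=> hx hy; have := LScomb 1 hx hy; rewrite scale1r. Qed.

(** An operator is commuted past the lowering ones until it meets [x0], where it raises to 0,
    lowers, or acts by a scalar. *)
Lemma low_span_stable x : low_span e x0 x -> forall k l, low_span e x0 (e k l x).
Proof.
elim=> [k l|c y z hy IHy hz IHz k l|i j y ij hy IH k l].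
- case: (ltngtP k l) => [kl|lk|/val_inj <-].
  + by rewrite (hw_raise hw0) //; exact: low_span0.
  + exact: LSlow lk (LSbase _ _).
  + by rewrite (hw_weight hw0); apply/low_spanZ/LSbase.
- by rewrite glD glZ; exact: LScomb.
rewrite gl_swap; apply: low_spanD; first exact: LSlow.
by apply: low_spanD; [|rewrite -scaleNr]; apply: low_spanZ.
Qed.

(* The operator h acts by the scalar [h0 - n] on products of lowering operators
   of total height n applied to x0. *)
Let h x := \sum_(i < 5) (4 - i)%:R *: e i i x.
Let h0 := \sum_(i < 5) (4 - i)%:R * mu i.

(** The product of the h - (a - k) for k < n. Started at h0 - 1 and long enough, it kills every
    proper lowering of [x0] but not [x0], which replaces a decomposition into weight spaces. *)
Fixpoint shifts (a : K) (n : nat) (x : X) : X :=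
  if n is n'.+1 then shifts (a - 1) n' (h x - a *: x) else x.

Let hL : linear h.
Proof.
move=> c x y; rewrite /h scaler_sumr -big_split; apply: eq_bigr => i _ /=.
by rewrite glD glZ; lincomb.
Qed.

Let h_at0 : h 0 = 0. Proof. exact: (linear0 (mkhom hL)). Qed.

Let hBZ x c y : h (x - c *: y) = h x - c *: h y.
Proof. by rewrite (_ : x - c *: y = - c *: y + x) ?hL; lincomb. Qed.

Let h_x0 : h x0 = h0 *: x0.
Proof.
rewrite /h /h0 scaler_suml; apply: eq_bigr => i _.
by rewrite (hw_weight hw0) scalerA.
Qed.

Let h_low (i j : 'I_5) x : (j < i)%N -> h (e i j x) = e i j (h x) - (i - j)%:R *: e i j x.
Proof.
move=> ji; rewrite /h gl_sum.
under eq_bigr => k _ do rewrite gl_swap scalerDr.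
rewrite big_split /=; congr (_ + _).
  by apply: eq_bigr => k _; rewrite glZ.
under eq_bigr => k _ do rewrite scalerBr !scalerA.
have ij : i != j by rewrite -val_eqE /= neq_ltn ji orbT.
rewrite (bigD1 i) //= (bigD1 j) ?[j == i]eq_sym //= big1; last first.
  move=> k /andP[ki kj]; rewrite (negPf ki) (negPf kj) !mulr0 !scale0r.
  exact: subrr.
rewrite !eqxx !(negPf ij) !mulr0 !mulr1 !scale0r addr0 sub0r subr0.
rewrite -scalerBl -scaleNr; congr (_ *: _).
rewrite !natrB ?(ltnW ji) //; [ring|by rewrite -ltnS ltn_ord..].
Qed.

Lemma shifts_linear a n : linear (shifts a n).
Proof.
elim: n a => [|n IH] a c x y //=; rewrite -IH hL; congr shifts; lincomb.
Qed.

Let shiftsM a n := mkhom (shifts_linear a n).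

Lemma shifts0 a n : shifts a n 0 = 0. Proof. exact: (linear0 (shiftsM a n)). Qed.

Lemma shiftsS a n x : shifts a n.+1 x = shifts (a - 1) n (h x - a *: x).
Proof. by []. Qed.

Lemma shifts_h a n b x : shifts a n (h x - b *: x) = h (shifts a n x) - b *: shifts a n x.
Proof.
elim: n a x => [|n IH] a x //=; rewrite -IH; congr shifts.
by rewrite !hBZ; lincomb.
Qed.

Lemma shiftsD a m n x : shifts a (m + n) x = shifts (a - m%:R) n (shifts a m x).
Proof.
elim: m a x => [|m IH] a x; first by rewrite subr0.
by rewrite addSn !shiftsS IH -addrA -opprD nat1r.
Qed.

Lemma shifts_leq a m n x : (m <= n)%N -> shifts a m x = 0 -> shifts a n x = 0.
Proof. by move=> /subnKC <- E; rewrite shiftsD E shifts0. Qed.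

Lemma shiftsC a m b n x : shifts a m (shifts b n x) = shifts b n (shifts a m x).
Proof. by elim: m a x => [|m IH] a x //=; rewrite -shifts_h IH. Qed.

Lemma shifts_low (i j : 'I_5) a n x : (j < i)%N ->
  shifts a n (e i j x) = e i j (shifts (a + (i - j)%:R) n x).
Proof.
move=> ji; elim: n a x => [|n IH] a x //=.
rewrite h_low // (_ : _ - _ - _ = e i j (h x - (a + (i - j)%:R) *: x)).
  by rewrite IH addrAC.
by rewrite glB glZ; lincomb.
Qed.

(** The scalar is the product of the integers m + 1, ..., m + n. *)
Lemma shifts_x0 n m : exists2 d, d != 0 & shifts (h0 - m.+1%:R) n x0 = d *: x0.
Proof.
elim: n m => [|n IH] m; first by exists 1; rewrite ?oner_eq0 ?scale1r.
have [d d0 E] := IH m.+1; exists (m.+1%:R * d); first by rewrite mulf_neq0 ?pnatr_eq0.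
rewrite shiftsS h_x0 -scalerBl subKr -[_ *: x0]addr0.
by rewrite shifts_linear shifts0 addr0 -addrA -opprD natr1 E scalerA.
Qed.

(* Up to lower terms, an element of the span is a multiple of x0. *)
Definition top_coef (c : K) (x : X) := exists n, shifts (h0 - 1) n (x - c *: x0) = 0.

Lemma top_coef_x0 : top_coef 1 x0.
Proof. by exists 0; rewrite /= scale1r subrr. Qed.

Lemma top_coef_comb k c d x y : top_coef c x -> top_coef d y ->
  top_coef (k * c + d) (k *: x + y).
Proof.
move=> [m hm] [n hn]; exists (m + n)%N.
rewrite (_ : _ - _ = k *: (x - c *: x0) + (y - d *: x0)); last by lincomb.
rewrite shifts_linear (shifts_leq (leq_addr n m) hm).
by rewrite (shifts_leq (leq_addl m n) hn) scaler0 addr0.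
Qed.

Lemma top_coef_low (i j : 'I_5) c x : (j < i)%N -> top_coef c x -> top_coef 0 (e i j x).
Proof.
move=> ji [n hn].
have hn' : shifts h0 n.+1 x = 0.
  rewrite shiftsS; have -> : h x - h0 *: x = h (x - c *: x0) - h0 *: (x - c *: x0).
    by rewrite hBZ h_x0; lincomb.
  by rewrite shifts_h hn h_at0 scaler0 subr0.
rewrite /top_coef scale0r subr0; have [k ijE] : exists k, (i - j)%N = k.+1.
  by exists (i - j).-1; rewrite prednK ?subn_gt0.
(* Passing E_ij moves the start h0 - 1 to h0 + k; the first k factors bridge the gap down to h0. *)
exists (k + n.+1)%N; rewrite shifts_low // ijE.
have -> : h0 - 1 + k.+1%:R = h0 + k%:R by rewrite -addn1 natrD; ring.
by rewrite shiftsD addrK shiftsC hn' shifts0 gl0.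
Qed.

Lemma top_coef0 c : x0 != 0 -> top_coef c 0 -> c = 0.
Proof.
move=> x0n [n]; rewrite sub0r -scaleNr -[_ *: x0]addr0 shifts_linear shifts0 addr0.
have [d d0 ->] := shifts_x0 n 0; move/eqP.
by rewrite scalerA scaler_eq0 (negPf x0n) orbF mulf_eq0 (negPf d0) orbF oppr_eq0 => /eqP.
Qed.

End OneModule.
End GlModules.

Section Traceless.
Variables (K : numFieldType) (X : lmodType K) (e : 'I_5 -> 'I_5 -> X -> X).
Hypothesis glX : is_gl e.

(** The projection of gl_5 to sl_5. L_0 is only sl_5, while the identity matrix acts on tensors by
    their order; making it act by 0 allows a comparison with V. *)
Definition tl (i j : 'I_5) (x : X) : X :=
  e i j x - ((i == j)%:R / 5) *: \sum_k e k k x.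

Lemma gl_trace_comm i j x : e i j (\sum_k e k k x) = \sum_k e k k (e i j x).
Proof.
rewrite (gl_sum glX); apply/eqP; rewrite -subr_eq0 -sumrB; apply/eqP.
under eq_bigr => k _ do rewrite (gl_comm glX).
rewrite sumrB (bigD1 j) //= eqxx scale1r big1 ?addr0 => [|k kj]; last first.
  by rewrite eq_sym (negPf kj) scale0r.
rewrite (bigD1 i) //= eqxx scale1r big1 ?addr0 ?subrr => [//|k ki].
by rewrite eq_sym (negPf ki) scale0r.
Qed.

Lemma tl_gl : is_gl tl.
Proof.
split=> [i j c x y|i j k l x].
  rewrite /tl (glD glX) (glZ glX).
  under eq_bigr => k _ do rewrite (glD glX) (glZ glX).
  by rewrite big_split /= -scaler_sumr; lincomb.
rewrite /tl; set tr := fun y => \sum_k e k k y.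
have trZ c y : tr (c *: y) = c *: tr y.
  by rewrite /tr scaler_sumr; apply: eq_bigr => a _; rewrite (glZ glX).
have trB y z : tr (y - z) = tr y - tr z.
  by rewrite /tr -sumrB; apply: eq_bigr => a _; rewrite (glB glX).
rewrite -!/(tr _) !(glB glX) !(glZ glX) !trB !trZ !gl_trace_comm -!/(tr _).
rewrite (gl_swap glX i j k l).
case: (eqVneq j k) => [<-|jk]; case: (eqVneq i l) => [<-|il] /=; lincomb_coefs; by field.
Qed.

Lemma tl_hw mu x : is_hw e mu x -> is_hw tl (fun i => mu i - (\sum_k mu k) / 5) x.
Proof.
move=> [r w]; split=> [i j ij|i]; rewrite /tl.
  have /negPf -> : i != j by rewrite -val_eqE /= neq_ltn ij.
  by rewrite r // mul0r scale0r subr0.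
under eq_bigr => k _ do rewrite w.
by rewrite -scaler_suml w eqxx /=; lincomb_coefs; field.
Qed.

End Traceless.

(** * Contravariant forms and uniqueness of highest weight modules *)

Section ContravariantForms.
Variable C : numClosedFieldType.

Record is_cform (Y : lmodType C) (e : 'I_5 -> 'I_5 -> Y -> Y) (dot : Y -> Y -> C)
    : Prop := {
  dot_linear : forall c x y z, dot (c *: x + y) z = c * dot x z + dot y z;
  dot_sym : forall x y, dot x y = (dot y x)^*;
  dot_contra : forall i j x y, dot (e i j x) y = dot x (e j i y);
  dot_def : forall x, dot x x = 0 -> x = 0 }.

Section OneForm.
Variables (Y : lmodType C) (e : 'I_5 -> 'I_5 -> Y -> Y) (dot : Y -> Y -> C).
Hypothesis dotP : is_cform e dot.

Let dotM z : LinMap Y C^o :=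
  @mkhom C Y C^o (dot^~ z) (fun c x y => dot_linear dotP c x y z).

Lemma dot0l z : dot 0 z = 0. Proof. exact: (linear0 (dotM z)). Qed.
Lemma dotDl x y z : dot (x + y) z = dot x z + dot y z.
Proof. exact: (linearD (dotM z)). Qed.
Lemma dotZl c x z : dot (c *: x) z = c * dot x z.
Proof. exact: (linearZ_LR (dotM z)). Qed.
Lemma dotBl x y z : dot (x - y) z = dot x z - dot y z.
Proof. exact: (linearB (dotM z)). Qed.
Lemma dot_suml (I : Type) (s : seq I) (P : pred I) (F : I -> Y) z :
  dot (\sum_(i <- s | P i) F i) z = \sum_(i <- s | P i) dot (F i) z.
Proof. exact: (linear_sum (dotM z)). Qed.
Lemma dot0r x : dot x 0 = 0. Proof. by rewrite (dot_sym dotP) dot0l conjC0. Qed.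
Lemma dotDr x y z : dot x (y + z) = dot x y + dot x z.
Proof. by rewrite (dot_sym dotP) dotDl rmorphD /= -!(dot_sym dotP). Qed.
Lemma dotZr c x z : dot x (c *: z) = c^* * dot x z.
Proof. by rewrite (dot_sym dotP) dotZl rmorphM /= -(dot_sym dotP). Qed.

End OneForm.

Definition irr_gl (V : vectType C) (e : 'I_5 -> 'I_5 -> V -> V) :=
  forall W : {vspace V}, (forall i j u, u \in W -> e i j u \in W) -> W = 0%VS \/ W = fullv.

Lemma irr_low_span (V : vectType C) (e : 'I_5 -> 'I_5 -> V -> V) mu v :
  is_gl e -> irr_gl e -> is_hw e mu v -> v != 0 -> forall x, low_span e v x.
Proof.
move=> glV irr hw v0 x.
have [W WP] := pred_vspace (low_span0 e v) (@LScomb _ _ e v).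
have : W = 0%VS \/ W = fullv.
  by apply: irr => i j u /WP hu; apply/WP; exact: (low_span_stable glV hw).
case=> WE; last by apply/WP; rewrite WE memvf.
have /WP : low_span e v v by exact: LSbase.
by rewrite WE memv0 (negPf v0).
Qed.

(** The submodule of V x Y generated by (v, y) is the graph of [Phi]. It is single valued: if (0, x)
    belongs to it, then x is orthogonal to y, by contravariance to all second components, and thus
    to itself. The kernel of [Phi] is a submodule of V that misses v. *)
Lemma hw_embedding (V : vectType C) (eV : 'I_5 -> 'I_5 -> V -> V) (Y : lmodType C)
    (eY : 'I_5 -> 'I_5 -> Y -> Y) (dot : Y -> Y -> C) mu v y :
  is_gl eV -> irr_gl eV -> is_gl eY -> is_cform eY dot ->
  is_hw eV mu v -> is_hw eY mu y -> v != 0 -> y != 0 ->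
  exists Phi : V -> Y, [/\ linear Phi, forall i j x, Phi (eV i j x) = eY i j (Phi x)
    & injective Phi].
Proof.
move=> glV irr glY dotP hwV hwY v0 y0.
pose eZ i j (z : V * Y) : V * Y := (eV i j z.1, eY i j z.2).
have glZ : is_gl eZ.
  split=> [i j c z z'|i j k l z]; congr pair; rewrite /= ?(gl_lin glV) ?(gl_lin glY) //.
    exact: (gl_comm glV).
  exact: (gl_comm glY).
have hwZ : is_hw eZ mu (v, y).
  split=> [i j ij|i]; congr pair.
  - exact: (hw_raise hwV).
  - exact: (hw_raise hwY).
  - exact: (hw_weight hwV).
  exact: (hw_weight hwY).
pose S := low_span eZ (v, y).
(* Both conditions read off the coefficient of (v, y): in V as a top coefficient, in Y as a pairing
   with y, to which lowered vectors are orthogonal. *)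
have Stop z : S z -> exists2 c, top_coef eV mu v c z.1 & dot z.2 y = c * dot y y.
  elim=> [|k z1 z2 _ [c hc cE] _ [d hd dE]|i j z1 ji _ [c hc cE]].
  - by exists 1; [exact: top_coef_x0 | rewrite mul1r].
  - exists (k * c + d); first exact: top_coef_comb.
    by rewrite /= (dot_linear dotP) cE dE; ring.
  exists 0; first exact: (top_coef_low glV hwV ji hc).
  by rewrite /= (dot_contra dotP) (hw_raise hwY) // (dot0r dotP) mul0r.
have S0 x : S (0, x) -> x = 0.
  move=> hx; apply: (dot_def dotP).
  suff H z : S z -> forall u, S (0, u) -> dot u z.2 = 0 by exact: (H _ hx _ hx).
  elim=> [u /Stop[c hc ->]|k z1 z2 _ IH1 _ IH2 u hu|i j z1 ji _ IH u hu] /=.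
  - by rewrite (top_coef0 glV hwV v0 hc) mul0r.
  - by rewrite (dotDr dotP) (dotZr dotP) IH1 // IH2 // mulr0 addr0.
  rewrite -(dot_contra dotP); apply: IH.
  by have := low_span_stable glZ hwZ hu j i; rewrite /eZ /= (gl0 glV).
have Sfun x a b : S (x, a) -> S (x, b) -> a = b.
  move=> ha hb; apply/eqP; rewrite -subr_eq0; apply/eqP/S0.
  have := LScomb (-1) hb ha; rewrite (_ : _ + _ = (0, a - b)) //.
  by congr pair; rewrite /= scaleN1r ?addNr // addrC.
have Sex x : exists a, S (x, a).
  elim: (irr_low_span glV irr hwV v0 x) => [|c x1 x2 _ [a ha] _ [b hb]|i j x1 ji _ [a ha]].
  - by exists y; exact: LSbase.
  - by exists (c *: a + b); exact: (LScomb c ha hb).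
  by exists (eY i j a); exact: (LSlow ji ha).
have [Phi PhiP] := boolp.choice Sex; exists Phi.
have PhiL : linear Phi by move=> c x x'; exact: (Sfun _ _ _ (PhiP _) (LScomb c (PhiP x) (PhiP x'))).
have PhiE i j x : Phi (eV i j x) = eY i j (Phi x).
  exact: (Sfun _ _ _ (PhiP _) (low_span_stable glZ hwZ (PhiP x) i j)).
split=> //; pose PhiM : LinMap V Y := mkhom PhiL.
have [W WP] := @pred_vspace _ _ (fun x => Phi x = 0) (linear0 PhiM)
  (fun c x x' hx hx' => etrans (PhiL c x x') (etrans (congr2 _ (congr1 _ hx) hx')
     (etrans (addr0 _) (scaler0 _ c)))).
have : W = 0%VS \/ W = fullv.
  by apply: irr => i j u /WP hu; apply/WP; rewrite PhiE hu (gl0 glY).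
case=> WE.
  move=> x x' xx'; apply/eqP; rewrite -subr_eq0 -memv0 -WE; apply/WP.
  by rewrite -[Phi]/(PhiM : _ -> _) linearB /= xx' subrr.
have /WP Pv : v \in W by rewrite WE memvf.
by have := Sfun _ _ _ (PhiP v) (LSbase _ _); rewrite Pv => /esym/eqP; rewrite (negPf y0).
Qed.

Section HighestWeight.
Variables (V : vectType C) (e : 'I_5 -> 'I_5 -> V -> V) (dot : V -> V -> C).
Variables (mu : 'I_5 -> C) (v : V).
Hypotheses (glV : is_gl e) (irrV : irr_gl e) (dotP : is_cform e dot).
Hypotheses (hwV : is_hw e mu v) (v0 : v != 0).

(** Once its projection to [v] is subtracted, [z] is orthogonal to [v] and, by contravariance, to
    all lowered vectors; these span V. *)
Lemma raise_ker z : (forall i j : 'I_5, (i < j)%N -> e i j z = 0) ->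
  exists c, z = c *: v.
Proof.
move=> zr; have vv0 : dot v v != 0 by apply: contra_neq v0; exact: (dot_def dotP).
exists (dot z v / dot v v); apply/eqP; rewrite -subr_eq0; apply/eqP.
set z' := z - _; have z'r (i j : 'I_5) : (i < j)%N -> e i j z' = 0.
  by move=> ij; rewrite (glB glV) (glZ glV) zr // (hw_raise hwV) // scaler0 subr0.
apply: (dot_def dotP).
suff H x : low_span e v x -> dot z' x = 0 by exact/H/(irr_low_span glV irrV hwV v0).
elim=> [|c {}x y _ hx _ hy|i j {}x ji _ hx].
- by rewrite /z' (dotBl dotP) (dotZl dotP) divfK // subrr.
- by rewrite (dotDr dotP) (dotZr dotP) hx hy mulr0 addr0.
by rewrite -(dot_contra dotP) z'r // (dot0l dotP).
Qed.

(** E_ij E_ji v = (mu_i - mu_j) v, so by contravariance E_ji v has norm 0. *)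
Lemma lower_hw0 (i j : 'I_5) : (i < j)%N -> mu i = mu j -> e j i v = 0.
Proof.
move=> ij mm; apply: (dot_def dotP); rewrite (dot_contra dotP) (gl_swap glV).
rewrite (hw_raise hwV) // (gl0 glV) !eqxx !scale1r !(hw_weight hwV) mm subrr addr0.
exact: (dot0r dotP).
Qed.

(* If E_ji killed v, then v would be orthogonal to the image of E_ij. *)
Lemma raise_to_hw (i j : 'I_5) x : (i < j)%N -> e i j x = v -> mu i != mu j.
Proof.
move=> ij xv; apply/negP => /eqP mm; have := dot_def dotP; move/(_ v).
rewrite -{1}xv (dot_contra dotP) (lower_hw0 ij mm) (dot0r dotP).
by move=> /(_ erefl)/eqP; rewrite (negPf v0).
Qed.

End HighestWeight.

End ContravariantForms.

Section TensorForm.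
Variable C : numClosedFieldType.

Lemma gl_tens n : is_gl (@gl C n).
Proof.
split=> [i j|i j k l t]; first exact: gl_linear.
elim: n t => [|n IH] t /=; first by rewrite !scaler0 subrr.
apply/ffunP => p; rewrite !ffunE !linearD !linearZ /=.
have {}IH (s : tens C n) : gl i j (gl k l s) = gl k l (gl i j s) +
    ((j == k)%:R *: gl i l s - (i == l)%:R *: gl k j s).
  by rewrite -IH addrC subrK.
by rewrite (IH (t p)) [l == i]eq_sym; lincomb.
Qed.

Fixpoint dotT n : tens C n -> tens C n -> C :=
  if n is n'.+1 return tens C n -> tens C n -> C then
    fun s t => \sum_i dotT (s i) (t i)
  else fun s t => (s : C) * (t : C)^*.

Lemma dotT_ge0 n (t : tens C n) : 0 <= dotT t t.
Proof.
elim: n t => [|n IH] t /=; first exact: mul_conjC_ge0.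
by apply: sumr_ge0 => i _.
Qed.

Lemma dotT_linear n c (x y z : tens C n) : dotT (c *: x + y) z = c * dotT x z + dotT y z.
Proof.
elim: n x y z => [|n IH] x y z /=; first by rewrite mulrA -mulrDl.
rewrite mulr_sumr -big_split; apply: eq_bigr => i _ /=.
by rewrite -IH !ffunE.
Qed.

Lemma dotT_sym n (x y : tens C n) : dotT x y = (dotT y x)^*.
Proof.
elim: n x y => [|n IH] x y /=; first by rewrite rmorphM /= conjCK mulrC.
by rewrite rmorph_sum; apply: eq_bigr => i _; exact: IH.
Qed.

Lemma dotT_natr n (x y z : tens C n) (b : bool) :
  dotT z (x + b%:R *: y) = dotT z x + b%:R * dotT z y.
Proof.
rewrite dotT_sym addrC dotT_linear rmorphD rmorphM /= rmorph_nat -!dotT_sym.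
exact: addrC.
Qed.

Lemma dotT_cform n : is_cform (@gl C n) (@dotT n).
Proof.
split; [exact: dotT_linear|exact: dotT_sym| |].
  elim: n => [|n IH] i j x y /=; first by rewrite mul0r conjC0 mulr0.
  under eq_bigr => a _ do rewrite ffunE addrC dotT_linear.
  under [RHS]eq_bigr => a _ do rewrite ffunE dotT_natr.
  rewrite !big_split /= addrC; congr (_ + _); first by apply: eq_bigr => a _.
  rewrite (bigD1 i) //= [RHS](bigD1 j) //= !eqxx; congr (_ + _).
  rewrite !big1 // => a /negPf ->; exact: mul0r.
elim: n => [|n IH] x /=.
  by move/eqP; rewrite mul_conjC_eq0 => /eqP.
move/eqP; rewrite psumr_eq0 => [/allP x0|i _]; last exact: dotT_ge0.
apply/ffunP => i; rewrite ffunE; apply: IH.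
by have /(_ (mem_index_enum i))/eqP := x0 i.
Qed.

Lemma tl_cform (Y : lmodType C) (e : 'I_5 -> 'I_5 -> Y -> Y) dot :
  is_cform e dot -> is_cform (tl e) dot.
Proof.
move=> dP; split; [exact: (dot_linear dP)|exact: (dot_sym dP)| |exact: (dot_def dP)].
move=> i j x y; rewrite /tl (dotBl dP) (dotZl dP) (dot_suml dP) (dot_contra dP).
have dotNr u z : dot u (- z) = - dot u z.
  by rewrite -scaleN1r (dotZr dP) rmorphN rmorph1 mulN1r.
rewrite (dotDr dP) dotNr (dotZr dP) fmorph_div !rmorph_nat [j == i]eq_sym.
congr (_ - _ * _); have [dot0 dotD] := (dot0r dP x, dotDr dP x).
rewrite (big_morph (dot x) dotD dot0); apply: eq_bigr => k _; exact: (dot_contra dP).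
Qed.

End TensorForm.

(** * Highest weight vectors in tensor powers *)

Section Wedge.
Variable K : numFieldType.
Implicit Types (c : seq 'I_5 -> K) (s : seq 'I_5).

(** The tensor product of [t] with the tensor of order [k] whose coefficients are the values of [c]
    on index sequences; it is used with the alternating [c] = [dets k]. *)
Fixpoint wdg k c n (t : tens K n) : tens K (k + n) :=
  if k is k'.+1 return tens K (k + n)
  then [ffun i => wdg k' (fun s => c (i :: s)) t] else c [::] *: t.

Fixpoint dseq (a b : 'I_5) c s : K :=
  if s is i :: s' then (i == a)%:R * c (b :: s') + dseq a b (fun u => c (i :: u)) s'
  else 0.

Lemma wdgD k c c' n (t : tens K n) x :
  wdg k (fun s => x * c s + c' s) t = x *: wdg k c t + wdg k c' t.
Proof.
elim: k c c' => [|k IH] c c' /=; first by lincomb.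
by apply/ffunP => i; rewrite !ffunE IH.
Qed.

Lemma wdg_linear k c n : linear (@wdg k c n).
Proof.
elim: k c => [|k IH] c x t t' /=; first by lincomb.
by apply/ffunP => i; rewrite !ffunE IH.
Qed.

Lemma eq_wdg k c c' n (t : tens K n) :
  (forall s, size s = k -> c s = c' s) -> wdg k c t = wdg k c' t.
Proof.
elim: k c c' => [|k IH] c c' cc' /=; first by rewrite cc'.
by apply/ffunP => i; rewrite !ffunE; apply: IH => s sk; rewrite cc' //= sk.
Qed.

Lemma gl_wdg k c n (t : tens K n) a b :
  gl a b (wdg k c t) = wdg k (dseq a b c) t + wdg k c (gl a b t).
Proof.
elim: k c => [|k IH] c /=; first by rewrite linearZ /=; lincomb.
by apply/ffunP => i; rewrite !ffunE IH wdgD; lincomb.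
Qed.

Lemma wdg_coef k c n (t : tens K n) s :
  size s = k -> wdg k c t = 0 -> c s *: t = 0.
Proof.
elim: k c s => [|k IH] c [|i s] //= [sk] E.
by apply: (IH (fun s => c (i :: s))) => //; move/ffunP/(_ i): E; rewrite !ffunE.
Qed.

Lemma dseqE a b c s : dseq a b c s =
  \sum_(p < size s) (nth ord0 s p == a)%:R * c (set_nth ord0 s p b).
Proof.
elim: s c => [|i s IH] c /=; first by rewrite big_ord0.
by rewrite big_ord_recl IH.
Qed.

Definition mxseq k s : 'M[K]_k := \matrix_(p, q) (nth ord0 s p == q :> nat)%:R.
(** The coefficients of e_0 /\ ... /\ e_(k-1), a highest weight vector of the k-th exterior
    power. *)
Definition dets k s : K := \det (mxseq k s).

Lemma mxseq_set k s (p : 'I_k) (b : 'I_5) : size s = k ->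
  dets k (set_nth ord0 s p b) = \sum_(q < k) (b == q :> nat)%:R * cofactor (mxseq k s) p q.
Proof.
move=> sk; rewrite /dets (expand_det_row _ p); apply: eq_bigr => q _.
rewrite mxE nth_set_nth /= eqxx; congr (_ * _); rewrite /cofactor; congr (_ * \det _).
apply/matrixP => i j; rewrite !mxE nth_set_nth /=.
by rewrite [bump _ _ == _]eq_sym (negPf (neq_bump _ _)).
Qed.

Lemma dseq_dets k s (a b : 'I_5) : size s = k -> (a <= b)%N || (k == 5) ->
  dseq a b (dets k) s = (a == b)%:R * (a < k)%:R * dets k s.
Proof.
move=> sk ab; rewrite dseqE sk.
have E (p : 'I_k) : (nth ord0 s p == a)%:R * dets k (set_nth ord0 s p b) =
    \sum_(q < k) (b == q :> nat)%:R *
        ((nth ord0 s p == a)%:R * cofactor (mxseq k s) p q).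
  by rewrite mxseq_set // mulr_sumr; apply: eq_bigr => q _; rewrite mulrCA.
rewrite (eq_bigr _ (fun p _ => E p)) exchange_big /=.
have [bk|kb] := ltnP b k; last first.
  rewrite big1 => [|q _]; last first.
    rewrite big1 // => p _; rewrite (_ : (b == q :> nat) = false) ?mul0r //.
    by apply/negP => /eqP bq; move: kb; rewrite bq leqNgt ltn_ord.
  have [k5|k5] := eqVneq k 5; first by move: kb; rewrite k5 leqNgt ltn_ord.
  have [->|_] := eqVneq a b; last by rewrite !mul0r.
  by rewrite ltnNge kb mulr0 mul0r.
have ak : (a < k)%N.
  by move: ab => /orP[|/eqP ->]; [move/leq_ltn_trans; exact | exact: ltn_ord].
rewrite (bigD1 (Ordinal bk)) //= [X in _ + X]big1 ?addr0; last first.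
  move=> q qb; rewrite big1 // => p _; rewrite (_ : (b == q :> nat) = false) ?mul0r //.
  by apply/negP => /eqP bq; case/eqP: qb; exact: val_inj.
rewrite ak mulr1; have := mul_adj_mx (mxseq k s).
move=> /matrixP/(_ (Ordinal bk) (Ordinal ak)); rewrite !mxE -val_eqE /= [b == a :> nat]eq_sym.
rewrite -/(dets k s) mulr_natl -(val_eqE a b) /= => <-; apply: eq_bigr => p _; rewrite eqxx mul1r.
by rewrite !mxE mulrC.
Qed.

Lemma dets_iota k (s : seq 'I_5) : size s = k ->
  (forall p, (p < k)%N -> nth ord0 s p = p :> nat) -> dets k s = 1.
Proof.
move=> sk sE; rewrite /dets (_ : mxseq k s = 1%:M) ?det1 //.
by apply/matrixP => p q; rewrite !mxE sE.
Qed.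

Definition has_hw (l : 'I_5 -> nat) := exists n (t : tens K n),
  t != 0 /\ is_hw (@gl K n) (fun i => (l i)%:R) t.

Lemma has_hw_wdg k l : (k <= 5)%N -> has_hw l -> has_hw (fun i => (l i + (i < k))%N).
Proof.
move=> k5 [n [t [t0 [tr tw]]]]; exists (k + n)%N, (wdg k (dets k) t); split.
  apply: contra_neq t0; pose s := take k (enum 'I_5).
  have sk : size s = k by rewrite size_take size_enum_ord; case: ltngtP k5 => // ->.
  move/(wdg_coef sk); rewrite dets_iota ?scale1r // => p pk.
  by rewrite nth_take // nth_enum_ord // (leq_trans pk).
have W0 m (u : tens K m) : wdg k (fun=> 0) u = 0.
  have := @wdgD k (fun=> 0) (fun=> 0) m u 0; rewrite scale0r add0r.
  rewrite (@eq_wdg k _ (fun=> 0)) => [_|s _]; last by ring.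
  have := @wdgD k (fun=> 0) (fun=> 0) m u (-1); rewrite scaleN1r addNr => <-.
  by apply: eq_wdg => s _; ring.
split=> [i j ij|i]; rewrite gl_wdg.
  have -> : wdg k (dets k) (gl i j t) = 0.
    by rewrite tr //; exact: (linear0 (mkhom (@wdg_linear k (dets k) n))).
  rewrite addr0.
  rewrite -(W0 n t); apply: eq_wdg => s sk; rewrite dseq_dets ?(ltnW ij) //.
  by rewrite -val_eqE /= ltn_eqF // !mul0r.
rewrite tw natrD scalerDl addrC; congr (_ + _).
  exact: (linearZ_LR (mkhom (@wdg_linear k (dets k) n))).
rewrite -[RHS]addr0 -(W0 n t) -wdgD; apply: eq_wdg => s sk.
by rewrite dseq_dets ?leqnn // eqxx mul1r addr0.
Qed.

(** The vector is a tensor product containing, for each k = 1, ..., 4, as many factors e_0 /\ ... /\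
    e_(k-1) as the k-th entry of [lam]. *)
Lemma exists_hw (lam : 4.-tuple nat) : exists2 l, has_hw l &
  forall i, (l (lo i) = l (hi i) + tnth lam i)%N.
Proof.
have hw0 : has_hw (fun=> 0%N).
  exists 0%N, (1 : K); split; first exact: oner_neq0.
  by split=> // i; rewrite scale0r.
have iter k m l : (k <= 5)%N -> has_hw l -> has_hw (fun i => (l i + m * (i < k))%N).
  move=> k5 hl; elim: m => [|m IH].
    by rewrite (_ : (fun i => _) = l) //; apply/funext => i; rewrite mul0n addn0.
  rewrite (_ : (fun i => _) = fun i => (l i + m * (i < k) + (i < k))%N).
    exact: has_hw_wdg.
  by apply/funext => i; rewrite mulSnr addnA.
pose la i : nat := nth 0%N lam i.
eexists; first exact: (iter 4 (la 3%N) _ isT (iter 3 (la 2%N) _ isT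
  (iter 2 (la 1%N) _ isT (iter 1%N (la 0%N) _ isT hw0)))).
move=> i; rewrite (tnth_nth 0%N) -/(la i).
case: i => -[|[|[|[|i]]]] // lt; rewrite /= ?/bump /= ?(muln0, muln1, addn0, add0n) //.
all: by rewrite [RHS]addnC ?addnA.
Qed.

End Wedge.

(** * The action of L_0 *)

Section LinearFields.
Variable K : numFieldType.
Implicit Types (M N : 'M[K]_5) (X : S5 K) (x : E510 K).

Definition lvf M : vfield K := [ffun m => \sum_a M a m *: fvar K a].

Lemma fder_lvf M n m : fder n (lvf M m) = (M n m)%:A.
Proof.
rewrite ffunE linear_sum (bigD1 n) //= linearZ /= fder_var eqxx big1 ?addr0 // => a an.
by rewrite linearZ /= fder_var eq_sym (negPf an) scaler0.
Qed.

Lemma vbracket_lvf M N : vbracket (lvf M) (lvf N) = lvf (M *m N - N *m M).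
Proof.
apply/ffunP => m; rewrite ffunE sumrB.
have E (P Q : 'M[K]_5) : \sum_j lvf P j * fder j (lvf Q m) =
    \sum_a (P *m Q) a m *: fvar K a.
  under eq_bigr => j _ do rewrite fder_lvf mulrC mulr_algl ffunE scaler_sumr.
  rewrite exchange_big; apply: eq_bigr => a _; rewrite mxE scaler_suml.
  by apply: eq_bigr => j _; rewrite scalerA mulrC.
rewrite !E ffunE -sumrB; apply: eq_bigr => a _.
by rewrite -scalerBl !mxE.
Qed.

Definition mt M : 'M[K]_5 := M - (\tr M / 5)%:M.

Lemma mt_linear : linear mt.
Proof.
move=> c M N; apply/matrixP => i j; rewrite /mt linearP !mxE /=; case: (i == j) => /=;
  by rewrite ?mulr1n ?mulr0n; field.
Qed.

Lemma tr_mt M : \tr (mt M) = 0.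
Proof. by rewrite /mt linearB /= mxtrace_scalar; field. Qed.

Lemma mt_id M : \tr M = 0 -> mt M = M.
Proof. by move=> t0; rewrite /mt t0 mul0r raddf0 subr0. Qed.

Lemma mt_scalar c : mt c%:M = 0.
Proof.
apply/matrixP => i j; rewrite /mt mxtrace_scalar !mxE; case: (i == j);
  by rewrite ?mulr1n ?mulr0n; field.
Qed.

Lemma lvf_divfree M : lvf (mt M) \in @divfree K.
Proof.
apply/divfreeP; under eq_bigr => i _ do rewrite fder_lvf.
by rewrite -scaler_suml -[\sum_i _]/(\tr (mt M)) tr_mt scale0r.
Qed.

(** Taking the traceless part makes this total and linear on gl_5, so that diagonal matrix units may
    be used as well. *)
Definition lE M : E510 K := (MkS5 (lvf_divfree M), 0).

Lemma lE_ext M x : x.2 = 0 -> (forall m, vfield_of x.1 m = lvf (mt M) m) -> x = lE M.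
Proof. by case: x => X w /= -> XE; congr pair; apply: S5_ext. Qed.

Lemma lE_linear : linear lE.
Proof.
move=> c M N; congr pair; last by rewrite /= scaler0 addr0.
apply: S5_ext => m; rewrite S5E /= !ffunE scaler_sumr -big_split /=.
apply: eq_bigr => a _; rewrite mt_linear.
have -> : (c *: mt M + mt N) a m = c * mt M a m + mt N a m by rewrite !mxE.
by rewrite scalerDl scalerA.
Qed.

Lemma lE_bracket M N : bracket (lE M) (lE N) = lE (M *m N - N *m M).
Proof.
congr pair; last by rewrite /= !linear0 ?subrr ?oppr0 ?addr0.
apply: S5_ext => m; rewrite Om2_bracket0 addr0 /= vbracket_lvf; congr (lvf _ m).
rewrite [RHS]mt_id; last by rewrite linearB /= mxtrace_mulC subrr.
rewrite /mt !(mulmxBl, mulmxBr) !(mul_scalar_mx, mul_mx_scalar).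
move: (M *m N) (N *m M) => P Q; apply/matrixP => i j; rewrite !mxE; case: (i == j);
  by rewrite ?mulr1n ?mulr0n; ring.
Qed.

Lemma lE_scalar c : lE c%:M = 0.
Proof.
apply/esym/lE_ext => //= m; rewrite mt_scalar !ffunE big1 // => a _.
by rewrite mxE scale0r.
Qed.

Lemma lE_xd i j : i != j -> xd K i j = lE (delta_mx i j).
Proof.
move=> ij; apply: lE_ext => // m; rewrite xdE // mt_id; last first.
  rewrite /mxtrace big1 // => k _; rewrite mxE; case: eqP => // ->.
  by rewrite (negPf ij).
rewrite !ffunE (bigD1 i) //= mxE eqxx /= mulr_natl big1 ?addr0 => [|a ai]; last first.
  by rewrite mxE (negPf ai) scale0r.
by rewrite scaler_nat.
Qed.

Lemma lE_hh i : hh K i = lE (delta_mx (lo i) (lo i) - delta_mx (hi i) (hi i)).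
Proof.
apply: lE_ext => // m; rewrite mt_id; last first.
  rewrite linearB /= /mxtrace (bigD1 (lo i)) //= [X in _ - X](bigD1 (hi i)) //=.
  rewrite !mxE !eqxx !big1 ?subrr // => k ki; by rewrite mxE (negPf ki).
rewrite /= !ffunE -[_ - _]/(_ + - _)%R.
under eq_bigr => a _ do rewrite !mxE scalerDl scaleNr.
have E k (b : bool) :
    \sum_a ((a == k) && b)%:R *: fvar K a = b%:R * fvar K k.
  rewrite (bigD1 k) //= eqxx mulr_natl scaler_nat big1 ?addr0 // => a /negPf ->.
  by rewrite scale0r.
by rewrite sumrB !E.
Qed.

Lemma lvf_coef M i m : lvf M i m != 0 -> mdeg5 m = 1%N.
Proof.
rewrite ffunE; have -> : (\sum_a M a i *: fvar K a) m = \sum_a M a i * (m == mvar a)%:R.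
  by apply: (big_morph (fun f : fps K => f m)).
have [E _|ne /eqP[]] := eqVneq (mdeg5 m) 1%N; first exact: E.
rewrite big1 // => a _; case: eqP => [e|_]; last by rewrite mulr0.
case/eqP: ne; rewrite e /mdeg5 (bigD1 a) //= ffunE eqxx big1 // => j ja.
by rewrite ffunE (negPf ja).
Qed.

Lemma lE_L0 M : L0 (lE M).
Proof.
split=> [i m /lvf_coef -> //|q m]; by rewrite /= ffunE eqxx.
Qed.

Lemma L0_Lge0 x : L0 x -> Lge0 x.
Proof. by move=> [h1 h2]; split=> [i m /h1 /eqP ->|q m /h2 /eqP ->]. Qed.

Lemma lE_Lge0 M : Lge0 (lE M). Proof. exact/L0_Lge0/lE_L0. Qed.

Definition jac X : 'M[K]_5 := \matrix_(a, m) fder a (vfield_of X m) 0.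

Lemma tr_jac X : \tr (jac X) = 0.
Proof.
have /divfreeP := valP X => /(congr1 (fun f : fps K => f 0)); rewrite fsum_at0 => E.
by rewrite -[RHS]E; apply: eq_bigr => i _; rewrite mxE.
Qed.

Lemma mdeg5_eq0 m : (mdeg5 m == 0)%N = (m == 0).
Proof.
apply/idP/eqP => [|->]; last by rewrite /mdeg5 big1 // => i _; rewrite ffunE.
rewrite /mdeg5 sum_nat_eq0 => /forallP m0; apply/ffunP => i; rewrite [RHS]ffunE.
exact/eqP/m0.
Qed.

Lemma mdeg5_eq1 m : mdeg5 m = 1%N -> exists a, m = mvar a.
Proof.
move=> m1; have [a ma] : exists a, (0 < m a)%N.
  apply/existsP; apply: contra_eqT m1 => /existsPn m0.
  rewrite /mdeg5 big1 // => i _; have := m0 i; by rewrite lt0n negbK => /eqP.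
exists a; apply/ffunP => i; rewrite ffunE; move: m1; rewrite /mdeg5 (bigD1 a) //=.
case mak: (m a) ma => [|k] // _; rewrite addSn => -[] /eqP.
rewrite addn_eq0 => /andP[/eqP k0]; rewrite sum_nat_eq0 => /forallP m0.
have [->|ia] := eqVneq i a; first by rewrite mak k0.
by have /implyP/(_ ia)/eqP := m0 i.
Qed.

Lemma lvf_mvar M i a : lvf M i (mvar a) = M a i.
Proof.
rewrite ffunE; have -> : (\sum_b M b i *: fvar K b) (mvar a) =
    \sum_b M b i * (mvar a == mvar b)%:R.
  by apply: (big_morph (fun f : fps K => f (mvar a))).
rewrite (bigD1 a) //= eqxx mulr1 big1 ?addr0 // => b ba.
rewrite (_ : mvar a == mvar b = false) ?mulr0 //; apply/negP => /eqP/ffunP/(_ a).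
by rewrite !ffunE eqxx eq_sym (negPf ba).
Qed.

Lemma jac_coef X i a : jac X a i = vfield_of X i (mvar a).
Proof. by rewrite mxE /fder add0r ffunE mul1r. Qed.

(** Odd elements have odd degree, so the part of degree 0 is the linear part of the vector field. *)
Lemma lE_jac x : Lge0 x -> Lplus (x - lE (jac x.1)).
Proof.
move=> [h1 h2]; split=> [i m|q m].
  have -> : vfield_of (x - lE (jac x.1)).1 i m = vfield_of x.1 i m - lvf (jac x.1) i m.
    by rewrite /= !ffunE mt_id ?tr_jac.
  move=> ne; have [m0|m0] := posnP (mdeg5 m).
    have /eqP m0' : m == 0 by rewrite -mdeg5_eq0 m0.
    case/eqP: ne; have [->|/h1] := eqVneq (vfield_of x.1 i m) 0; last by rewrite m0.
    rewrite sub0r; apply/eqP; rewrite oppr_eq0; apply/eqP.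
    by have [//|/lvf_coef] := eqVneq (lvf (jac x.1) i m) 0; rewrite m0.
  have [m1|m1] := eqVneq (mdeg5 m) 1%N.
    have [a ma] := mdeg5_eq1 m1; case/eqP: ne.
    by rewrite ma lvf_mvar jac_coef subrr.
  case: (mdeg5 m) m0 m1 => [|[|k]] // _ _.
  by rewrite subr_gt0 ltz_nat !mulnS.
have -> : form_of (x - lE (jac x.1)).2 q m = form_of x.2 q m.
  by rewrite /= !ffunE subr0.
move=> /h2; case: (mdeg5 m) => // k _.
by rewrite subr_gt0 ltz_nat mulnS.
Qed.

Lemma is_rep_sum (V : vectType K) (a : E510 K -> V -> V) M u :
  is_rep (@Lge0 K) a -> a (lE M) u = \sum_i \sum_j M i j *: a (lE (delta_mx i j)) u.
Proof.
move=> [_ aL _].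
have a0 : a (lE 0) u = 0.
  have := aL 1 (lE 0) (lE 0) u (lE_Lge0 _) (lE_Lge0 _).
  by rewrite -lE_linear scaler0 addr0 scale1r -{1}[a _ _]addr0 => /addrI/esym.
have aD N P c : a (lE (c *: N + P)) u = c *: a (lE N) u + a (lE P) u.
  by rewrite lE_linear aL //; exact: lE_Lge0.
have aS (I : Type) (s : seq I) (F : I -> 'M[K]_5) :
    a (lE (\sum_(i <- s) F i)) u = \sum_(i <- s) a (lE (F i)) u.
  elim: s => [|i s IH]; first by rewrite !big_nil.
  by rewrite !big_cons; have := aD (F i) (\sum_(j <- s) F j) 1; rewrite !scale1r IH.
rewrite [in LHS](matrix_sum_delta M) aS; apply: eq_bigr => i _; rewrite aS.
by apply: eq_bigr => j _; rewrite -[_ *: _]addr0 aD a0 addr0.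
Qed.

End LinearFields.

Section Representation.
Variables (C : numClosedFieldType) (lam : 4.-tuple nat) (V : vectType C).
Variables (a : E510 C -> V -> V) (v : V).
Hypothesis hV : is_irrep lam a v.

Definition eV (i j : 'I_5) (u : V) : V := a (lE (delta_mx i j)) u.

Lemma a_lE M u : a (lE M) u = \sum_i \sum_j M i j *: eV i j u.
Proof. exact: is_rep_sum (irrep_rep hV). Qed.

Lemma eV_gl : is_gl eV.
Proof.
have [aL _ aB] := irrep_rep hV; split=> [i j|i j k l u].
  by move=> c x y; rewrite /eV; exact: (aL _ (lE_Lge0 _)).
have := aB false false (lE (delta_mx i j)) (lE (delta_mx k l)) u (lE_Lge0 _) (lE_Lge0 _)
   erefl erefl.
rewrite /= expr0 scale1r -!/(eV _ _ _) => <-.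
rewrite lE_bracket !mul_delta_mx_cond.
have [_ aL' _] := irrep_rep hV.
have -> : delta_mx i l *+ (j == k) - delta_mx k j *+ (l == i) =
  (- (i == l)%:R) *: delta_mx k j + ((j == k)%:R *: delta_mx i l + 0) :> 'M[C]_5.
  by rewrite !scaler_nat scaleNr scaler_nat addr0 addrC eq_sym.
rewrite !lE_linear !aL' //; try exact: lE_Lge0; last first.
  by rewrite -lE_linear; exact: lE_Lge0.
have -> : a (lE 0) u = 0.
  rewrite a_lE big1 // => p _; rewrite big1 // => q _; by rewrite mxE scale0r.
by rewrite addr0 scaleNr addrC.
Qed.

Lemma a_Lge0 x u : Lge0 x ->
  a x u = \sum_i \sum_j fder i (vfield_of x.1 j) 0 *: eV i j u.
Proof.
move=> hx; have [_ aL _] := irrep_rep hV; have hp := lE_jac hx.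
have hp' : Lge0 (x - lE (jac x.1)).
  by case: hp => h1 h2; split=> [i m /h1 /ltW|q m /h2 /ltW].
have {1}-> : x = 1 *: (x - lE (jac x.1)) + lE (jac x.1) by rewrite scale1r subrK.
rewrite aL //; last exact: lE_Lge0.
rewrite (irrep_Lplus hV) // scaler0 add0r a_lE.
by apply: eq_bigr => i _; apply: eq_bigr => j _; rewrite mxE.
Qed.

Lemma eV_irr : irr_gl eV.
Proof.
move=> W hW; apply: (irrep_irr hV) => x u hx uW.
rewrite a_Lge0; last exact: L0_Lge0.
by apply: memv_suml => i _; apply: memv_suml => j _; apply/memvZ/hW.
Qed.

Lemma eV_trace u : \sum_i eV i i u = 0.
Proof.
have E : \sum_i delta_mx i i = 1%:M :> 'M[C]_5.
  apply/matrixP => p q; rewrite summxE (bigD1 p) //= !mxE eqxx big1 ?addr0 /= => [|k kp].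
    by rewrite eq_sym.
  by rewrite mxE eq_sym (negPf kp).
transitivity (a (lE 1%:M) u); last first.
  rewrite lE_scalar; have [_ aL _] := irrep_rep hV.
  have h0 : Lge0 (0 : E510 C) by rewrite -(@lE_scalar C 0); exact: lE_Lge0.
  have := aL 1 0 0 u h0 h0.
  by rewrite scaler0 addr0 scale1r -{1}[a _ _]addr0 => /addrI/esym.
rewrite a_lE; apply: eq_bigr => i _; rewrite (bigD1 i) //= mxE eqxx scale1r big1 ?addr0 //.
by move=> j ji; rewrite mxE eq_sym (negPf ji) scale0r.
Qed.

Lemma a_xd i j u : i != j -> a (xd C i j) u = eV i j u.
Proof. by move=> ij; rewrite lE_xd. Qed.

Lemma a_hh i u : a (hh C i) u = eV (lo i) (lo i) u - eV (hi i) (hi i) u.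
Proof.
rewrite lE_hh; have [_ aL _] := irrep_rep hV.
rewrite addrC -scaleN1r lE_linear aL; try exact: lE_Lge0.
by rewrite scaleN1r addrC.
Qed.

(** A weight of gl_5 shifted to have sum 0, in agreement with [eV_trace]. *)
Definition mu_of (l : 'I_5 -> nat) (i : 'I_5) : C :=
  (l i)%:R - (\sum_k (l k)%:R) / 5.

Lemma eV_hw l : (forall i, (l (lo i) = l (hi i) + tnth lam i)%N) ->
  is_hw eV (mu_of l) v.
Proof.
move=> lE'; split=> [i j ij|].
  by rewrite -a_xd ?(irrep_borel hV) // -val_eqE /= neq_ltn ij.
(* The weights under the h_i show that these five defects are equal, and the vanishing trace that
   their sum is 0. *)
pose d i := eV i i v - mu_of l i *: v.
have dS i : d (lo i) = d (hi i).
  apply/eqP; rewrite -subr_eq0 /d; apply/eqP.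
  have := irrep_weight hV i; rewrite a_hh /mu_of lE' natrD => /eqP.
  by rewrite -subr_eq0 => /eqP E; rewrite -[RHS]E; lincomb.
have d01 : d (o5 0) = d (o5 1).
  by have := dS (@Ordinal 4 0 isT); congr (d _ = d _); exact: val_inj.
have d12 : d (o5 1) = d (o5 2).
  by have := dS (@Ordinal 4 1 isT); congr (d _ = d _); exact: val_inj.
have d23 : d (o5 2) = d (o5 3).
  by have := dS (@Ordinal 4 2 isT); congr (d _ = d _); exact: val_inj.
have d34 : d (o5 3) = d (o5 4).
  by have := dS (@Ordinal 4 3 isT); congr (d _ = d _); exact: val_inj.
have dsum : \sum_i d i = 0.
  rewrite sumrB eV_trace sub0r -scaler_suml sumrB.
  rewrite sumr_const card_ord -[_ *+ 5]mulr_natr divfK ?pnatr_eq0 //.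
  by rewrite subrr scale0r oppr0.
have d0 : d (o5 4) = 0.
  have : (5 : C) *: d (o5 4) = 0.
    rewrite -[RHS]dsum sum_o5 d01 d12 d23 d34; move: (d _) => w; lincomb.
  by move/eqP; rewrite scaler_eq0 pnatr_eq0 => /eqP.
move=> i; apply/eqP; rewrite -subr_eq0; apply/eqP; rewrite -/(d i).
by elim/ord5_ind: i; rewrite ?d01 ?d12 ?d23 ?d34.
Qed.

End Representation.

(** * Injectivity in degree one *)

Local Notation pr5 i j := (exist _ (o5 i, o5 j) isT : pair5).

Lemma pair5_ind (P : pair5 -> Prop) :
  P (pr5 0 1) -> P (pr5 0 2) -> P (pr5 0 3) -> P (pr5 0 4) -> P (pr5 1 2) ->
  P (pr5 1 3) -> P (pr5 1 4) -> P (pr5 2 3) -> P (pr5 2 4) -> P (pr5 3 4) ->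
  forall p, P p.
Proof.
move=> P01 P02 P03 P04 P12 P13 P14 P23 P24 P34 [[a b] ab].
elim/ord5_ind: a ab; elim/ord5_ind: b => // ab; by rewrite (bool_irrelevance ab isT).
Qed.

Section TopWedge.
Variable K : numFieldType.

Lemma gl_wdg5 n (t : tens K n) i j :
  gl i j (wdg 5 (dets K 5) t) =
  (i == j)%:R *: wdg 5 (dets K 5) t + wdg 5 (dets K 5) (gl i j t).
Proof.
rewrite gl_wdg; congr (_ + _).
have E : wdg 5 (dseq i j (dets K 5)) t =
    wdg 5 (fun s => ((i == j)%:R - 1) * dets K 5 s + dets K 5 s) t.
  apply: eq_wdg => s s5; rewrite dseq_dets ?eqxx ?orbT //.
  by rewrite ltn_ord mulr1; ring.
by rewrite E wdgD; lincomb.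
Qed.

(** Multiples of delta_ji cancel against a traceless [A]. This hides from sl_5 both the correction
    in [tl] and the action on the volume form. *)
Lemma traceless_sum (Y : lmodType K) (A g : 'I_5 -> 'I_5 -> _) (w w' : Y) :
  \sum_j A j j = 0 :> K ->
  \sum_i \sum_j A i j *: (g j i - (j == i)%:R *: w) =
  \sum_i \sum_j A i j *: ((j == i)%:R *: w' + g j i).
Proof.
move=> trA; have diag z : \sum_i \sum_j A i j *: ((j == i)%:R *: z) = 0 :> Y.
  transitivity (\sum_i A i i *: z); last by rewrite -scaler_suml trA scale0r.
  apply: eq_bigr => i _; rewrite (bigD1 i) //= eqxx scale1r big1 ?addr0 // => j ji.
  by rewrite (negPf ji) scale0r scaler0.
rewrite -[LHS]addr0 -[X in _ + X = _](diag (w + w')) -big_split; apply: eq_bigr => i _ /=.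
by rewrite -big_split; apply: eq_bigr => j _ /=; lincomb.
Qed.

Fixpoint text k n (s : seq 'I_5) : tens K (k + n) -> tens K n :=
  if k is k'.+1 return tens K (k + n) -> tens K n
  then fun t => text (behead s) (t (head ord0 s)) else id.

Lemma text_linear k n s : linear (@text k n s).
Proof. by elim: k s => [|k IH] s c t t' //=; rewrite !ffunE IH. Qed.

Lemma text_wdg k n s (c : seq 'I_5 -> K) (t : tens K n) : size s = k ->
  text s (wdg k c t) = c s *: t.
Proof.
elim: k s c => [|k IH] [|i s] c //= [sk].
by rewrite ffunE IH.
Qed.

Lemma dets_eps i j k l m : dets K 5 [:: i; j; k; l; m] = eps5 K i j k l m.
Proof.
rewrite /dets /determinant /eps5 /eps [RHS]big_mkcond /=; apply: eq_bigr => s _.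
case: ifP => [/forallP h|/negbT/forallPn[p hp]].
  rewrite big1 ?mulr1 // => p _; rewrite mxE (eqP (h p)) (tnth_nth ord0).
  by rewrite (_ : (_ == _) = true) //; exact/eqP.
rewrite (bigD1 p) //= mxE (_ : (_ == _) = false) ?mul0r ?mulr0 //.
by apply/negP => /eqP e; case/negP: hp; rewrite (tnth_nth ord0) -val_eqE /= e.
Qed.

(* Evaluating at q and s isolates the contribution of p. *)
Definition isolates (p q : 'I_5 * 'I_5) (s : 4.-tuple 'I_5) :=
  let c (a b i : nat) := sg5 i a b q.1 q.2 *
    sg5 i (nth ord0 s 0) (nth ord0 s 1%N) (nth ord0 s 2%N) (nth ord0 s 3%N) in
  (all (fun a => all (fun b => (a < b)%N ==> ~~ ((a == p.1) && (b == p.2)) ==>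
    all (fun i => c a b i == 0) (iota 0 5)) (iota 0 5)) (iota 0 5)) &&
  (foldr (fun i z => c p.1 p.2 i + z) 0 (iota 0 5) != 0).

(** [q] is disjoint from [p], so [d_p, d_q] is up to sign the field d/dx_i for the remaining index
    i, and [s] lists the four indices other than i. No other d_r gives the same i. *)
Lemma exists_isolating (p : pair5) : exists (q : pair5) s, isolates (val p) (val q) s.
Proof.
elim/pair5_ind: p.
- by exists (pr5 2 3), [tuple o5 0; o5 1; o5 2; o5 3]; vm_compute.
- by exists (pr5 1 3), [tuple o5 0; o5 1; o5 2; o5 3]; vm_compute.
- by exists (pr5 1 2), [tuple o5 0; o5 1; o5 2; o5 3]; vm_compute.
- by exists (pr5 1 2), [tuple o5 0; o5 1; o5 2; o5 4]; vm_compute.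
- by exists (pr5 0 3), [tuple o5 0; o5 1; o5 2; o5 3]; vm_compute.
- by exists (pr5 0 2), [tuple o5 0; o5 1; o5 2; o5 3]; vm_compute.
- by exists (pr5 0 2), [tuple o5 0; o5 1; o5 2; o5 4]; vm_compute.
- by exists (pr5 0 1), [tuple o5 0; o5 1; o5 2; o5 3]; vm_compute.
- by exists (pr5 0 1), [tuple o5 0; o5 1; o5 2; o5 4]; vm_compute.
by exists (pr5 0 1), [tuple o5 0; o5 1; o5 3; o5 4]; vm_compute.
Qed.

Lemma isolate_sum (p : pair5) (V : lmodType K) (F : pair5 -> V) (q : pair5) s :
  isolates (val p) (val q) s ->
  \sum_(r : pair5) \sum_i
     (eps5 K i (val r).1 (val r).2 (val q).1 (val q).2 * dets K 5 (i :: s)) *: F r = 0 ->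
  F p = 0.
Proof.
move=> /andP[/allP h0 h1] E.
have tup : tval s = [:: nth ord0 s 0; nth ord0 s 1%N; nth ord0 s 2%N; nth ord0 s 3%N].
  by case: s {h0 h1 E} => -[|? [|? [|? [|? [|? ?]]]]].
have cE (r : pair5) i :
    eps5 K i (val r).1 (val r).2 (val q).1 (val q).2 * dets K 5 (i :: s) =
    (sg5 i (val r).1 (val r).2 (val q).1 (val q).2 *
     sg5 i (nth ord0 s 0) (nth ord0 s 1%N) (nth ord0 s 2%N) (nth ord0 s 3%N))%:~R.
  by rewrite [X in _ :: X]tup dets_eps !eps5E intrM.
have mem_r (a : 'I_5) : (a : nat) \in iota 0 5 by rewrite mem_iota /=.
move: E; rewrite (bigD1 p) //= [X in _ + X]big1 ?addr0; last first.
  move=> r rp; rewrite big1 // => i _; rewrite cE.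
  have /allP/(_ _ (mem_r (val r).2))/implyP/(_ (valP r)) := h0 _ (mem_r (val r).1).
  have rp' : ~~ (((val r).1 == (val p).1 :> nat) && ((val r).2 == (val p).2 :> nat)).
    apply: contra rp => /andP[/eqP e1 /eqP e2]; apply/eqP/val_inj.
    by case: (val r) (val p) e1 e2 => [a b] [c d] /= /val_inj -> /val_inj ->.
  move=> /implyP/(_ rp')/allP/(_ _ (mem_r i))/eqP ->; exact: scale0r.
rewrite -scaler_suml => /eqP; rewrite scaler_eq0 => /orP[|/eqP //].
under eq_bigr => i _ do rewrite cE.
have foldE (c : nat -> int) : foldr (fun i z => c i + z) 0 (iota 0 5) =
    c 0%N + c 1%N + c 2%N + c 3%N + c 4%N by rewrite /= addr0 !addrA.
pose c (i : nat) := sg5 i (val p).1 (val p).2 (val q).1 (val q).2 *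
  sg5 i (nth ord0 s 0) (nth ord0 s 1%N) (nth ord0 s 2%N) (nth ord0 s 3%N).
have {}h1 : foldr (fun i z => c i + z) 0 (iota 0 5) != 0 by exact: h1.
by rewrite sum_o5 -!intrD intr_eq0; move: h1; rewrite foldE => /negPf ->.
Qed.

Lemma dd_emb_sum0 m (T : pair5 -> tens K m.+1) (q : pair5) :
  \sum_r lact (repn K m.+1) (dd K r) (emb (T r)) = 0 ->
  \sum_r \sum_i eps5 K i (val r).1 (val r).2 (val q).1 (val q).2 *: T r i = 0 :> tens K m.
Proof.
move=> E; pose ev (T : En K m.+1) : En K m := (T : LinMap _ _) (0, MkOm2 (d_closed2 K q)).
have evS (F : pair5 -> En K m.+1) : ev (\sum_r F r) = \sum_r ev (F r).
  by apply: (big_morph ev).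
have := congr1 ev E; rewrite evS.
have evE r : ev (lact (repn K m.+1) (dd K r) (emb (T r))) =
   emb (- \sum_i eps5 K i (val r).1 (val r).2 (val q).1 (val q).2 *: T r i).
  rewrite /lact actX0 add0r /ev actW_dd_emb [RHS]linearN [in RHS]linear_sum.
  by congr (- _); apply: eq_bigr => i _; rewrite linearZ.
under eq_bigr => r _ do rewrite evE.
rewrite -linear_sum => E2; have {E2} : emb (\sum_r - \sum_i
    eps5 K i (val r).1 (val r).2 (val q).1 (val q).2 *: T r i) = emb (0 : tens K m).
  by rewrite linear0 -[RHS]E2.
by move/emb_inj; rewrite sumrN => /eqP; rewrite oppr_eq0 => /eqP.
Qed.

End TopWedge.

Section Injectivity.
Variables (C : numClosedFieldType) (lam : 4.-tuple nat) (V : vectType C).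
Variables (a : E510 C -> V -> V) (v : V).
Hypothesis hV : is_irrep lam a v.

Lemma exists_tensor_embedding : exists n (Phi : V -> tens C n),
  [/\ linear Phi, forall i j x, Phi (eV a i j x) = tl (@gl C n) i j (Phi x)
    & injective Phi].
Proof.
have [l [n [t [t0 hwt]]] lE'] := exists_hw C lam; exists n.
have hwt' := tl_hw hwt.
apply: (hw_embedding (eV_gl hV) (eV_irr hV) (tl_gl (gl_tens C n))
  (tl_cform (dotT_cform C n)) (eV_hw hV lE') hwt') => //.
exact/eqP/(irrep_neq0 hV).
Qed.

Lemma exists_form : exists dot : V -> V -> C, is_cform (eV a) dot.
Proof.
have [n [Phi [PL PE PI]]] := exists_tensor_embedding.
have dP := tl_cform (dotT_cform C n).
exists (fun x y => dotT (Phi x) (Phi y)); split=> [c x y z|x y|i j x y|x].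
- by rewrite PL (dot_linear dP).
- exact: (dot_sym dP).
- by rewrite !PE (dot_contra dP).
move=> /(dot_def dP) e; apply: PI; rewrite e.
exact/esym/(linear0 (mkhom PL)).
Qed.

Variables (U : algType C) (iota : E510 C -> U).
Variables (M : lmodType C) (aM : U -> M -> M) (ten : U -> V -> M).
Hypotheses (hU : is_enveloping iota) (hM : is_induced iota a aM ten).

(** If deg1 u = 0, its image under [G] is evaluated at d_q. This contracts the volume form with the
    fields [d_r, d_q], and reading the four indices left at [s] isolates the component at one
    pair. *)
Lemma ten1_deg1_inj :
  (forall z, ten 1 z = 0 -> z = 0) /\ (forall u, deg1 iota ten u = 0 -> u = 0).
Proof.
have [n [Phi [PL PE PI]]] := exists_tensor_embedding.
have Phi0 : Phi 0 = 0 by exact: (linear0 (mkhom PL)).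
pose W := wdg 5 (dets C 5); pose Psi u : En C (5 + n) := emb (W n (Phi u)).
have WL : linear (W n) by exact: wdg_linear.
have PsiL : linear Psi by move=> c x y; rewrite /Psi PL WL emb_linear.
have PsiE x u : Lge0 x -> Psi (a x u) = lact (repn C (5 + n)) x (Psi u).
  move=> hx; rewrite /lact actW_emb ?addr0; last first.
    by move=> q; apply/eqP/negPn/negP => /(proj2 hx); rewrite /mdeg5 big1 // => i _; rewrite ffunE.
  rewrite actX_emb; last first.
    by move=> q; apply/eqP/negPn/negP => /(proj1 hx); rewrite /mdeg5 big1 // => i _; rewrite ffunE.
  rewrite (a_Lge0 hV) // /Psi; congr emb.
  have PS (F : 'I_5 -> V) : Phi (\sum_i F i) = \sum_i Phi (F i).
    exact: (linear_sum (mkhom PL)).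
  have PZ k w : Phi (k *: w) = k *: Phi w by exact: (linearZ_LR (mkhom PL)).
  have WS (F : 'I_5 -> tens C n) : W n (\sum_i F i) = \sum_i W n (F i).
    exact: (linear_sum (mkhom WL)).
  have WZ k w : W n (k *: w) = k *: W n w by exact: (linearZ_LR (mkhom WL)).
  have WB w w' : W n (w - w') = W n w - W n w' by exact: (linearB (mkhom WL)).
  rewrite exchange_big /= PS WS.
  set A := fun i j => fder j (vfield_of x.1 i) 0.
  have trA : \sum_j A j j = 0.
    by rewrite -[RHS](tr_jac x.1); apply: eq_bigr => j _; rewrite mxE.
  (* The traceless action on the left and the action including the volume form on the right differ
     by multiples of delta_ji. *)
  transitivity (\sum_i \sum_j A i j *: (W n (gl j i (Phi u)) -
     (j == i)%:R *: W n (5^-1 *: \sum_k gl k k (Phi u)))).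
    apply: eq_bigr => i _; rewrite PS WS; apply: eq_bigr => j _.
    by rewrite PZ PE WZ /tl WB -WZ scalerA.
  apply: etrans (@traceless_sum C (tens C (5 + n)) A
     (fun j i => W n (gl j i (Phi u))) _ (W n (Phi u)) trA) _.
  by apply: eq_bigr => i _; apply: eq_bigr => j _; rewrite -gl_wdg5.
have [G [GL G1 Gi]] := induced_map hU hM PsiL PsiE.
pose GM : LinMap M (En C (5 + n)) := mkhom GL.
have G0 : G 0 = 0 by exact: (linear0 GM).
have W0 w : W n w = 0 -> w = 0.
  pose s := [:: o5 0; o5 1; o5 2; o5 3; o5 4].
  move=> /(@wdg_coef _ 5 _ n w s erefl); rewrite dets_iota ?scale1r //.
  by move=> [|[|[|[|[|p]]]]].
split=> [z z0|u u0].
  apply: PI; rewrite Phi0; apply: W0; apply: emb_inj.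
  by rewrite -[LHS]/(Psi z) -G1 z0 G0 linear0.
apply/ffunP => p; rewrite [RHS]ffunE; apply: PI; rewrite Phi0.
have [q [s iso]] := exists_isolating p.
apply: (isolate_sum (F := fun r => Phi (u r)) iso).
have E : \sum_r lact (repn C (5 + n)) (dd C r) (Psi (u r)) = 0.
  transitivity (G (deg1 iota ten u)); last by rewrite u0 G0.
  rewrite /deg1 -[G _]/(GM _) linear_sum.
  by apply: eq_bigr => r _; rewrite /= Gi.
have E2 := @dd_emb_sum0 C (4 + n) (fun r => W n (Phi (u r))) q E.
have := congr1 (@text C 4 n s) E2.
have textS (I : finType) (F : I -> tens C (4 + n)) :
    text s (\sum_i F i) = \sum_i text s (F i) :> tens C n.
  exact: (linear_sum (mkhom (@text_linear C 4 n s))).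
have textZ k w : text s (k *: w : tens C (4 + n)) = k *: text s w :> tens C n.
  exact: (linearZ_LR (mkhom (@text_linear C 4 n s))).
have -> : text s (0 : tens C (4 + n)) = 0 :> tens C n.
  exact: (linear0 (mkhom (@text_linear C 4 n s))).
rewrite textS => E3; rewrite -[RHS]E3; apply: eq_bigr => r _; rewrite textS.
apply: eq_bigr => i _; rewrite textZ -scalerA; congr (_ *: _).
have -> : W n (Phi (u r)) i = wdg 4 (fun s => dets C 5 (i :: s)) (Phi (u r)).
  by rewrite ffunE.
by rewrite text_wdg ?size_tuple.
Qed.

End Injectivity.

(** * The tensor product of W and V *)

Section Coordinates.
Variables (K : numFieldType) (V : vectType K).
Implicit Types (u : {ffun pair5 -> V}) (i j k l : 'I_5).

(** The antisymmetric extension to all index pairs, which spares the formulas a case distinction on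
    the order of the indices. *)
Definition ext u i j : V :=
  if insub (i, j) is Some p then u p
  else if insub (j, i) is Some p then - u p else 0.

Lemma ext_val u (p : pair5) : ext u (val p).1 (val p).2 = u p.
Proof. by rewrite /ext -surjective_pairing valK. Qed.

Lemma extC u i j : ext u j i = - ext u i j.
Proof.
rewrite /ext; case: insubP => [p /= ji _|_].
  by rewrite insubF ?opprK //= ltnNge ltnW.
by case: insubP => [p _ _|_]; rewrite ?opprK ?oppr0.
Qed.

Lemma ext_diag u i : ext u i i = 0.
Proof. by rewrite /ext !insubF //= ltnn. Qed.

Lemma ext_ind u (F : 'I_5 -> 'I_5 -> V) :
  (forall i j, F j i = - F i j) -> (forall p : pair5, u p = F (val p).1 (val p).2) ->
  forall i j, ext u i j = F i j.
Proof.
move=> FC uF i j; have lt_case (a b : 'I_5) : (a < b)%N -> ext u a b = F a b.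
  move=> ab; have := ext_val u (exist _ (a, b) ab); rewrite uF; exact.
have [ij|ji|/val_inj ->] := ltngtP i j; first exact: lt_case.
  by rewrite extC lt_case // -FC.
have := FC j j; rewrite ext_diag => /eqP; rewrite -addr_eq0 -mulr2n -scaler_nat scaler_eq0.
by rewrite pnatr_eq0 => /eqP.
Qed.

Lemma ext_inj u u' : (forall i j, ext u i j = ext u' i j) -> u = u'.
Proof. by move=> E; apply/ffunP => p; rewrite -!ext_val E. Qed.

Lemma extD u u' i j : ext (u + u') i j = ext u i j + ext u' i j.
Proof.
apply: (ext_ind (F := fun i j => ext u i j + ext u' i j)) => [a b|p].
  by rewrite !(extC _ a b) opprD.
by rewrite !ext_val ffunE.
Qed.

Lemma extZ c u i j : ext (c *: u) i j = c *: ext u i j.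
Proof.
apply: (ext_ind (F := fun i j => c *: ext u i j)) => [a b|p].
  by rewrite !(extC _ a b) scalerN.
by rewrite !ext_val ffunE.
Qed.

Lemma extN u i j : ext (- u) i j = - ext u i j.
Proof. by rewrite -scaleN1r extZ scaleN1r. Qed.

Lemma ext_pure p x i j : ext (pure p x) i j =
  (((i, j) == val p)%:R - ((j, i) == val p)%:R : K) *: x.
Proof.
apply: (ext_ind (F := fun i j => (((i, j) == val p)%:R - ((j, i) == val p)%:R : K) *: x))
  => [a b|q].
  by rewrite -scaleNr opprB.
rewrite ffunE -surjective_pairing val_eqE.
have -> : ((val q).2, (val q).1) == val p = false.
  apply/negP => /eqP e; have := valP p; rewrite -e /= => lt; have := valP q.
  by rewrite /= ltnNge ltnW.
by case: (q == p); rewrite ?subr0 ?scale1r ?scale0r.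
Qed.

Variable e : 'I_5 -> 'I_5 -> V -> V.
Hypothesis glV : is_gl e.

(* The action of sl_5 on W \otimes V, the diagonal elements being made traceless;
   e is assumed traceless on V. *)
Definition Dl i j u : {ffun pair5 -> V} := [ffun q =>
  ((val q).1 == i)%:R *: ext u j (val q).2 + ((val q).2 == i)%:R *: ext u (val q).1 j
  - (2 / 5 * (i == j)%:R) *: u q + e i j (u q)].

Lemma ext_Dl i j u a b : ext (Dl i j u) a b =
  (a == i)%:R *: ext u j b + (b == i)%:R *: ext u a j
  - (2 / 5 * (i == j)%:R) *: ext u a b + e i j (ext u a b).
Proof.
apply: (ext_ind (F := fun a b => (a == i)%:R *: ext u j b + (b == i)%:R *: ext u a j
  - (2 / 5 * (i == j)%:R) *: ext u a b + e i j (ext u a b))) => [{}a {}b|q]; last first.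
  by rewrite ffunE ext_val.
rewrite (extC _ a b) (extC _ b j) (extC _ j a) (glN glV); lincomb.
Qed.

Lemma Dl_gl : is_gl Dl.
Proof.
split=> [i j c u u'|i j k l u].
  apply: ext_inj => a b; rewrite extD extZ !ext_Dl !extD !extZ (glD glV) (glZ glV).
  by lincomb.
apply: ext_inj => a b; rewrite !(extD, extN, extZ).
rewrite !ext_Dl !(glD glV, glB glV, glZ glV, glN glV) (gl_swap glV i j k l).
rewrite (eq_sym l i) (eq_sym k j); lincomb.
Qed.

End Coordinates.

Section ConstantForms.
Variable K : numFieldType.

Definition fpair (p : pair5) i j : K :=
  ((i, j) == val p)%:R - ((j, i) == val p)%:R.

Lemma form_dd (p : pair5) q : form_of (dd K p).2 q = (fpair p q.1 q.2)%:A.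
Proof.
case: q => i j; rewrite /= ffunE mulr1 /fpair /= scalerBl !scaler_nat.
congr (_ - _); last by congr (_%:R); rewrite -!pair_eqE /pair_eq /= andbC.
Qed.

Lemma sum_fpair (V : vectType K) (u : {ffun pair5 -> V}) i j :
  \sum_p fpair p i j *: u p = ext u i j.
Proof.
apply/esym; apply: (ext_ind (F := fun i j => \sum_p fpair p i j *: u p)) => [a b|q].
  by rewrite -sumrN; apply: eq_bigr => p _; rewrite /fpair -scaleNr opprB.
rewrite (bigD1 q) //= big1 ?addr0 => [|p pq].
  by have := ext_pure q (u q) (val q).1 (val q).2; rewrite ext_val ffunE eqxx.
have := ext_pure p (u p) (val q).1 (val q).2; rewrite ext_val ffunE.
by rewrite (eq_sym q p) (negPf pq).
Qed.

Lemma sum_pair5 (V : nmodType) (F : 'I_5 * 'I_5 -> V) :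
  \sum_(p : pair5) F (val p) = \sum_(p : 'I_5 * 'I_5 | (p.1 < p.2)%N) F p.
Proof.
rewrite [RHS](reindex_onto val (insubd p12)) /= => [|p p_lt]; last by rewrite insubdK.
by apply: eq_bigl => p; rewrite (valP p) valKd eqxx.
Qed.

Lemma fder_alg i c : fder i (c%:A : fps K) = 0.
Proof.
have f1 : fder i (1 : fps K) = 0 by exact: (@fder_nat K i 1).
by rewrite linearZ /= f1 scaler0.
Qed.

Lemma falg_at0 c : (c%:A : fps K) 0 = c.
Proof. by rewrite fscale_at0 fone_at0 mulr1. Qed.

Lemma form_lE_dd M p q : form_of (bracket (lE M) (dd K p)).2 q =
  (\sum_l (mt M q.1 l * fpair p l q.2 + mt M q.2 l * fpair p q.1 l))%:A.
Proof.
have -> : (bracket (lE M) (dd K p)).2 = S5_act (lE M).1 (dd K p).2.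
  by rewrite /= S5_act0 subr0.
rewrite -[form_of _]/(lie_der (lvf (mt M)) (form_of (dd K p).2)).
rewrite [LHS]ffunE scaler_suml; apply: eq_bigr => l _; rewrite !form_dd.
rewrite fder_alg mulr0 add0r !fder_lvf !mulr_algl !scalerA -scalerDl.
by [].
Qed.

Lemma const_formE (w : Om2 K) (f : 'I_5 -> 'I_5 -> K) :
  (forall i j, form_of w (i, j) = (f i j)%:A) ->
  (0, w) = \sum_q f (val q).1 (val q).2 *: dd K q :> E510 K.
Proof.
move=> wE; have S1 (I : finType) (F : I -> E510 K) : (\sum_i F i).1 = \sum_i (F i).1.
  by apply: (big_morph (fun y : E510 K => y.1)).
have S2 (I : finType) (F : I -> E510 K) : (\sum_i F i).2 = \sum_i (F i).2.
  by apply: (big_morph (fun y : E510 K => y.2)).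
rewrite [RHS]surjective_pairing S1 S2; congr pair.
  by rewrite big1 // => q _; rewrite /= scaler0.
have SF (I : finType) (F : I -> Om2 K) q : form_of (\sum_i F i) q = \sum_i form_of (F i) q.
  by apply: (big_morph (fun y : Om2 K => form_of y q)) => [x y|]; rewrite /= ffunE.
have fC i j : f j i = - f i j.
  have /closed2P[wa _] := valP w; have := wa i j; rewrite !wE -scaleNr.
  by move/(congr1 (fun g : fps K => g 0)); rewrite !falg_at0.
apply: Om2_ext => -[i j]; rewrite wE SF.
pose u : {ffun pair5 -> K^o} := [ffun q => f (val q).1 (val q).2].
have uE : ext u i j = f i j by apply: ext_ind => // q; rewrite ffunE.
rewrite -[f i j]uE -sum_fpair scaler_suml; apply: eq_bigr => q _.
have -> : form_of (f (val q).1 (val q).2 *: dd K q).2 (i, j) =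
  f (val q).1 (val q).2 *: form_of (dd K q).2 (i, j) by rewrite /= ffunE.
by rewrite form_dd /= scalerA ffunE mulrC.
Qed.

Lemma bracket_lE_dd M p : bracket (lE M) (dd K p) =
  \sum_q Defs.coord q (bracket (lE M) (dd K p)) *: dd K q.
Proof.
pose f i j := \sum_l (mt M i l * fpair p l j + mt M j l * fpair p i l).
have E : bracket (lE M) (dd K p) = (0, (bracket (lE M) (dd K p)).2).
  by congr pair; rewrite /= !linear0 Om2_bracket0 addr0.
rewrite [LHS]E [LHS](@const_formE _ f) => [|i j]; last exact: form_lE_dd.
apply: eq_bigr => q _; congr (_ *: _); rewrite /Defs.coord.
by rewrite -[form_of _]/(form_of (bracket (lE M) (dd K p)).2) form_lE_dd falg_at0.
Qed.

Lemma wv_lE (V : vectType K) M (u : {ffun pair5 -> V}) q :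
  \sum_p Defs.coord q (bracket (lE M) (dd K p)) *: u p =
  \sum_l (mt M (val q).1 l *: ext u l (val q).2 + mt M (val q).2 l *: ext u (val q).1 l).
Proof.
under eq_bigr => p _ do rewrite /Defs.coord form_lE_dd falg_at0 scaler_suml.
rewrite exchange_big; apply: eq_bigr => l _ /=.
under eq_bigr => p _ do rewrite scalerDl -!scalerA.
by rewrite big_split /= -!scaler_sumr !sum_fpair.
Qed.

Lemma tr_delta i j : \tr (delta_mx i j : 'M[K]_5) = (i == j)%:R.
Proof.
rewrite /mxtrace (bigD1 i) //= mxE eqxx big1 ?addr0 // => k ki.
by rewrite mxE (negPf ki).
Qed.

Lemma Dl_lE (V : vectType K) (e : 'I_5 -> 'I_5 -> V -> V) i j (u : {ffun pair5 -> V}) q :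
  Dl e i j u q =
  \sum_p Defs.coord q (bracket (lE (delta_mx i j)) (dd K p)) *: u p + e i j (u q).
Proof.
rewrite wv_lE ffunE; congr (_ + _).
have mtE k l : mt (delta_mx i j) k l =
      (k == i)%:R * (l == j)%:R - (i == j)%:R / 5 * (k == l)%:R :> K.
  by rewrite /mt tr_delta !mxE -mulnb natrM -[_ *+ (k == l)]mulr_natr.
under eq_bigr => l _ do rewrite !mtE !scalerBl -!scalerA.
rewrite big_split /= !sumrB -!scaler_sumr.
have S k (F : 'I_5 -> V) : \sum_l (l == k)%:R *: F l = F k.
  rewrite (bigD1 k) //= eqxx scale1r big1 ?addr0 // => l lk.
  by rewrite (negPf lk) scale0r.
have S' k (F : 'I_5 -> V) : \sum_l (k == l)%:R *: F l = F k.
  by under eq_bigr => l _ do rewrite eq_sym; exact: S.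
by rewrite !S !S' ext_val; lincomb_coefs; field.
Qed.

End ConstantForms.

(** * The singularity conditions in coordinates *)

Section SingularConditions.
Variables (C : numClosedFieldType) (lam : 4.-tuple nat) (V : vectType C).
Variables (a : E510 C -> V -> V) (v : V).
Hypothesis hV : is_irrep lam a v.
Variables (U : algType C) (iota : E510 C -> U).
Variables (M : lmodType C) (aM : U -> M -> M) (ten : U -> V -> M).
Hypotheses (hU : is_enveloping iota) (hM : is_induced iota a aM ten).
Implicit Types u : {ffun pair5 -> V}.

(* On u, the condition x_5 d_45 . xi = 0 reads D5 u 4 0 1 2 = 0 (see act_x5d45).
   Raising operators transform D5 as a tensor, which produces the remaining linear
   conditions on u. *)
Definition D5 u (b x y z : 'I_5) : V :=
  eV a b x (ext u y z) + eV a b y (ext u z x) + eV a b z (ext u x y).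

Lemma act_deg1 i j u :
  aM (iota (lE (delta_mx i j))) (deg1 iota ten u) = deg1 iota ten (Dl (eV a) i j u).
Proof.
have [iL iB] := env_morph hU; have [tL tR tM] := ind_bal hM.
set x := lE _.
have aS (F : pair5 -> M) : aM (iota x) (\sum_p F p) = \sum_p aM (iota x) (F p).
  exact: (linear_sum (mkhom (ind_lin hM (iota x)))).
have tS m (F : pair5 -> V) : ten m (\sum_p F p) = \sum_p ten m (F p).
  exact: (linear_sum (mkhom (tR m))).
have tZ m c z : ten m (c *: z) = c *: ten m z by exact: (linearZ_LR (mkhom (tR m))).
have tD m z z' : ten m (z + z') = ten m z + ten m z' by exact: (linearD (mkhom (tR m))).
have tDl m m' z : ten (m + m') z = ten m z + ten m' z by exact: (linearD (mkhom (tL z))).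
have iS (F : pair5 -> E510 C) : iota (\sum_p F p) = \sum_p iota (F p).
  exact: (linear_sum (mkhom iL)).
have iZ c y : iota (c *: y) = c *: iota y by exact: (linearZ_LR (mkhom iL)).
have tSl (F : pair5 -> U) z : ten (\sum_p F p) z = \sum_p ten (F p) z.
  exact: (linear_sum (mkhom (tL z))).
have tZl c m z : ten (c *: m) z = c *: ten m z by exact: (linearZ_LR (mkhom (tL z))).
rewrite /deg1 aS.
under [RHS]eq_bigr => q _ do rewrite Dl_lE tD tS.
rewrite big_split /= exchange_big -big_split /=; apply: eq_bigr => p _.
rewrite (ind_act hM).
have := iB false true x (dd C p) erefl erefl; rewrite expr0 mul1r => /eqP.
rewrite eq_sym subr_eq => /eqP ->; rewrite tDl tM; last exact: lE_Lge0.
congr (_ + _); rewrite [in LHS]bracket_lE_dd.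
have -> : iota (\sum_q Defs.coord q (bracket x (dd C p)) *: dd C q) =
    \sum_q Defs.coord q (bracket x (dd C p)) *: iota (dd C q).
  by rewrite iS; apply: eq_bigr => q _; rewrite iZ.
by rewrite tSl; apply: eq_bigr => q _; rewrite tZl tZ.
Qed.

(** Moving x_5 d_45 past d_p leaves the bracket, because L_+ kills V. With 1-based indices, the
    bracket is a combination of the fields x_5 d/dx_i with i < 4, which act on V as E_5i. *)
Lemma act_x5d45 u : aM (iota (x5d45 C)) (deg1 iota ten u) =
  ten 1 (D5 u (o5 4) (o5 0) (o5 1) (o5 2)).
Proof.
have [iL iB] := env_morph hU; have [tL tR tM] := ind_bal hM.
set x := x5d45 C.
have aS (F : pair5 -> M) : aM (iota x) (\sum_p F p) = \sum_p aM (iota x) (F p).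
  exact: (linear_sum (mkhom (ind_lin hM (iota x)))).
have t0 m : ten m 0 = 0 by exact: (linear0 (mkhom (tR m))).
have tS m (F : pair5 -> V) : ten m (\sum_p F p) = \sum_p ten m (F p).
  exact: (linear_sum (mkhom (tR m))).
have tDl m m' z : ten (m + m') z = ten m z + ten m' z by exact: (linearD (mkhom (tL z))).
have tNl m z : ten (- m) z = - ten m z by exact: (linearN (mkhom (tL z))).
have xplus : Lplus x.
  split=> [i m|q m]; first by rewrite /= ffunE eqxx.
  rewrite /= ffunE /=; have [->|m0 _] := eqVneq m 0.
    rewrite -[X in X != 0]/((_ * fvar C (o5 4)) 0) fmul_at0 /fvar.
    rewrite (_ : 0 == mvar (o5 4) = false) ?mulr0 ?eqxx //.
    by apply/negP => /eqP/ffunP/(_ (o5 4)); rewrite !ffunE.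
  have : mdeg5 m != 0%N by rewrite mdeg5_eq0.
  by case: (mdeg5 m) => // k _; rewrite subr_gt0 ltz_nat mulnS.
have xge0 : Lge0 x by case: xplus => h1 h2; split=> [i m /h1 /ltW|q m /h2 /ltW].
pose Mx (p : pair5) : 'M[C]_5 :=
  \sum_i eps5 C i (o5 3) (o5 4) (val p).1 (val p).2 *: delta_mx (o5 4) i.
have brE p : bracket x (dd C p) = lE (Mx p).
  apply: lE_ext => [|m]; first by rewrite /= !S5_act0 subr0.
  have tr0 : \tr (Mx p) = 0.
    rewrite linear_sum big1 // => i _; rewrite linearZ /= tr_delta.
    case: eqP => [<-|_]; last exact: mulr0.
    rewrite eps5E (_ : sg5 _ _ _ _ _ = 0) ?mulr0z ?mul0r //.
    by rewrite /sg5 /sg2 /= !mulr0 !mul0r.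
  rewrite mt_id // (_ : (bracket x (dd C p)).1 = Om2_bracket x.2 (dd C p).2); last first.
    by rewrite /= S5_bracket0 add0r.
  rewrite [RHS]ffunE (bigD1 (o5 4)) //= [X in _ + X]big1 ?addr0; last first.
    move=> k k4; rewrite summxE big1 ?scale0r // => i _.
    by rewrite !mxE (negPf k4) mulr0.
  rewrite summxE (bigD1 m) //= !mxE !eqxx mulr1 big1 ?addr0; last first.
    by move=> i im; rewrite !mxE eqxx eq_sym (negPf im) mulr0.
  rewrite /= ffunE (bigD1 (o5 3, o5 4)) //= [X in _ + X]big1 ?addr0; last first.
    move=> p' /andP[lt ne]; rewrite big1 // => q' _; rewrite ffunE (negPf ne).
    rewrite (_ : p' == _ = false) ?subr0 ?mul0r ?scaler0 //.
    by apply: contraTF lt => /eqP ->.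
  rewrite (bigD1 (val p)) ?(valP p) //= [X in _ + X]big1 ?addr0; last first.
    move=> q' /andP[lt ne]; rewrite [X in _ * X]fd_form1 // (negPf ne).
    by rewrite mulr0 scaler0.
  rewrite fd_form1 ?(valP p) // eqxx mulr1 ffunE eqxx.
  by rewrite (_ : (_ == _) = false) // subr0 mul1r.
rewrite /deg1 aS.
transitivity (\sum_p ten 1 (a (lE (Mx p)) (u p))).
  apply: eq_bigr => p _; rewrite (ind_act hM).
  have := iB true true x (dd C p) erefl erefl; rewrite expr1 mulN1r opprK => /eqP.
  rewrite -subr_eq => /eqP <-; rewrite tDl tNl tM // (irrep_Lplus hV) // t0 subr0.
  by rewrite brE -[iota _]mul1r tM //; exact: lE_Lge0.
rewrite -tS; congr (ten 1 _).
transitivity (\sum_(p : pair5) \sum_i eps5 C i (o5 3) (o5 4) (val p).1 (val p).2 *: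
    eV a (o5 4) i (ext u (val p).1 (val p).2)).
  apply: eq_bigr => p _; rewrite (a_lE hV) ext_val (bigD1 (o5 4)) //=.
  rewrite [X in _ + X]big1 ?addr0 => [|k k4]; last first.
    rewrite big1 // => j _; rewrite summxE big1 ?scale0r // => i _.
    by rewrite !mxE (negPf k4) mulr0.
  apply: eq_bigr => j _; congr (_ *: _); rewrite summxE (bigD1 j) //= !mxE !eqxx mulr1.
  by rewrite big1 ?addr0 // => i ij; rewrite !mxE eqxx eq_sym (negPf ij) mulr0.
rewrite (sum_pair5 (fun p => \sum_i eps5 C i (o5 3) (o5 4) p.1 p.2 *:
    eV a (o5 4) i (ext u p.1 p.2))) sum_pairs !sum_o5 !eps5E.
do ![match goal with |- context [sg5 ?a ?b ?c ?d ?e] =>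
  let v := eval vm_compute in (sg5 a b c d e) in change (sg5 a b c d e) with v end].
rewrite ?mulr0z ?mulr1z ?mulrN1z ?scale0r ?scale1r ?scaleN1r ?(addr0, add0r) /=.
rewrite /D5 (extC _ (o5 0) (o5 2)) (glN (eV_gl hV)); lincomb.
Qed.

End SingularConditions.

(** * Leading terms of singular vectors *)

Lemma hw_steps (lam : 4.-tuple nat) (L : 'I_5 -> nat) :
  (forall i : 'I_4, L (lo i) = (L (hi i) + tnth lam i)%N) ->
  [/\ L (o5 0) = (L (o5 1) + nth 0%N lam 0)%N, L (o5 1) = (L (o5 2) + nth 0%N lam 1)%N,
      L (o5 2) = (L (o5 3) + nth 0%N lam 2)%N & L (o5 3) = (L (o5 4) + nth 0%N lam 3)%N].
Proof.
move=> LE; have E (k : 'I_4) (i j : 'I_5) : i = lo k -> j = hi k ->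
    L i = (L j + nth 0%N lam k)%N by move=> -> ->; rewrite LE (tnth_nth 0%N).
by split; [apply: (E (@Ordinal 4 0 isT))|apply: (E (@Ordinal 4 1 isT))|
           apply: (E (@Ordinal 4 2 isT))|apply: (E (@Ordinal 4 3 isT))]; exact: val_inj.
Qed.

Section Leading.
Variables (C : numClosedFieldType) (lam : 4.-tuple nat) (V : vectType C).
Variables (a : E510 C -> V -> V) (v : V).
Hypothesis hV : is_irrep lam a v.
Implicit Types (u : {ffun pair5 -> V}) (b i j k l x y z : 'I_5).

Local Notation e := (eV a).
Local Notation glV := (eV_gl hV).

Definition raised u := forall i j, (i < j)%N -> Dl e i j u = 0.

Lemma ext0 i j : ext (0 : {ffun pair5 -> V}) i j = 0.
Proof. by rewrite -[0](scale0r 0) extZ scale0r. Qed.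

(** The total action of E_kl vanishes, so its effect on a component is minus its effect on the
    indices. *)
Lemma raise_ext u k l i j : raised u -> (k < l)%N ->
  e k l (ext u i j) = - ((i == k)%:R *: ext u l j + (j == k)%:R *: ext u i l).
Proof.
move=> hu kl; have := ext_Dl glV k l u i j; rewrite hu // ext0.
have /negPf -> : k != l by rewrite -val_eqE /= neq_ltn kl.
by rewrite mulr0 scale0r subr0 => /esym/eqP; rewrite addrC addr_eq0 => /eqP.
Qed.

Lemma D5_raise u k l b x y z : raised u -> (k < l)%N ->
  e k l (D5 a u b x y z) = (l == b)%:R *: D5 a u k x y z
  - (x == k)%:R *: D5 a u b l y z - (y == k)%:R *: D5 a u b x l z
  - (z == k)%:R *: D5 a u b x y l.
Proof.
move=> hu kl; rewrite /D5 !(glD glV).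
rewrite (gl_swap glV k l b x) (gl_swap glV k l b y) (gl_swap glV k l b z).
rewrite !(raise_ext _ _ hu kl) !(glN glV, glD glV, glZ glV).
by rewrite (eq_sym k x) (eq_sym k y) (eq_sym k z); lincomb.
Qed.

Lemma D5C12 u b x y z : D5 a u b y x z = - D5 a u b x y z.
Proof.
rewrite /D5 (extC u x z) (extC u y z) (extC u x y) !(glN glV); lincomb.
Qed.

Lemma D5C23 u b x y z : D5 a u b x z y = - D5 a u b x y z.
Proof.
rewrite /D5 (extC u z y) (extC u z x) (extC u x y) !(glN glV); lincomb.
Qed.

Lemma D5_xx u b x z : D5 a u b x x z = 0.
Proof. by rewrite /D5 ext_diag (gl0 glV) (extC u x z) (glN glV); lincomb. Qed.

Section Singular.
Variable u : {ffun pair5 -> V}.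
Hypotheses (hu : raised u) (hD : D5 a u (o5 4) (o5 0) (o5 1) (o5 2) = 0).

Let DE b x y z k l : (k < l)%N -> D5 a u b x y z = 0 ->
  (l == b)%:R *: D5 a u k x y z - (x == k)%:R *: D5 a u b l y z
  - (y == k)%:R *: D5 a u b x l z - (z == k)%:R *: D5 a u b x y l = 0.
Proof. by move=> kl E; rewrite -D5_raise // E (gl0 glV). Qed.

(** E_23, E_12 and E_01 turn the triple (0, 1, 2) successively into the other triples below 4 and
    leave the first index 4 alone; antisymmetry does the rest. *)
Let D4 x y z : (x < 4)%N -> (y < 4)%N -> (z < 4)%N -> D5 a u (o5 4) x y z = 0.
Proof.
have D013 : D5 a u (o5 4) (o5 0) (o5 1) (o5 3) = 0.
  have := DE (k := o5 2) (l := o5 3) isT hD.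
  by rewrite /= !scale0r scale1r !subr0 sub0r => /eqP; rewrite oppr_eq0 => /eqP.
have D023 : D5 a u (o5 4) (o5 0) (o5 2) (o5 3) = 0.
  have := DE (k := o5 1) (l := o5 2) isT D013.
  by rewrite /= !scale0r scale1r !subr0 sub0r => /eqP; rewrite oppr_eq0 => /eqP.
have D123 : D5 a u (o5 4) (o5 1) (o5 2) (o5 3) = 0.
  have := DE (k := o5 0) (l := o5 1) isT D023.
  by rewrite /= !scale0r scale1r !subr0 sub0r => /eqP; rewrite oppr_eq0 => /eqP.
have S12 p q r : D5 a u (o5 4) p q r = 0 -> D5 a u (o5 4) q p r = 0.
  by move=> h; rewrite D5C12 h oppr0.
have S23 p q r : D5 a u (o5 4) p q r = 0 -> D5 a u (o5 4) p r q = 0.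
  by move=> h; rewrite D5C23 h oppr0.
have all6 p q r : D5 a u (o5 4) p q r = 0 -> [/\
    D5 a u (o5 4) p r q = 0, D5 a u (o5 4) q p r = 0,
    D5 a u (o5 4) q r p = 0, D5 a u (o5 4) r p q = 0 & D5 a u (o5 4) r q p = 0].
  by move=> h; split; [apply/S23|apply/S12|apply/S23/S12|apply/S12/S23|apply/S12/S23/S12].
have [? ? ? ? ?] := all6 _ _ _ hD.
have [? ? ? ? ?] := all6 _ _ _ D013.
have [? ? ? ? ?] := all6 _ _ _ D023.
have [? ? ? ? ?] := all6 _ _ _ D123.
elim/ord5_ind: x => //; elim/ord5_ind: y => //; elim/ord5_ind: z => // _ _ _;
  first [assumption | exact: D5_xx | apply: S23; exact: D5_xx | apply/S12/S23; exact: D5_xx].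
Qed.

Let o4F x : (x < 4)%N -> (o5 4 == x) = false.
Proof. by move=> x4; apply/negP => /eqP e4; move: x4; rewrite -e4. Qed.

(** E_b4, applied to the equation with indices (4; b, i, j), changes the first index 4 to b or the
    other index b to 4, with opposite signs. *)
Lemma D5_diag_low b i j : (b < 4)%N -> (i < 4)%N -> (j < 4)%N -> i != b -> j != b ->
  D5 a u b b i j = D5 a u (o5 4) (o5 4) i j.
Proof.
move=> b4 i4 j4 /negPf ib /negPf jb; have := DE (l := o5 4) b4 (D4 b4 i4 j4).
by rewrite !eqxx ib jb !scale1r !scale0r !subr0 => /eqP; rewrite subr_eq0 => /eqP.
Qed.

(** With z the remaining index below 4, start from (4; k, y, z): E_b4 gives (b; k, y, z), E_z4 gives
    (b; k, y, 4), and E_kb yields the difference of the two diagonal components. *)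
Lemma D5_diag_high k b y : (k < b)%N -> (b < 4)%N -> (y < 4)%N -> y != k -> y != b ->
  D5 a u k k y (o5 4) = D5 a u b b y (o5 4).
Proof.
move=> kb b4 y4 yk yb; have k4 := ltn_trans kb b4.
have kb' : k != b by rewrite -val_eqE /= neq_ltn kb.
have [z [z4 zk zy zb]] : exists z, [/\ (z < 4)%N, z != k, z != y & z != b].
  move: k4 b4 y4 yk yb kb' {kb}.
  elim/ord5_ind: k => //; elim/ord5_ind: y => //; elim/ord5_ind: b => // _ _ _ _ _ _;
    first [by exists (o5 0) | by exists (o5 1) | by exists (o5 2) | by exists (o5 3)].
have Dz : D5 a u b k y z = 0.
  have := DE (l := o5 4) b4 (D4 k4 y4 z4).
  by rewrite eqxx (negPf kb') (negPf yb) (negPf zb) !scale0r !subr0 scale1r.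
have Dk : D5 a u b k y (o5 4) = 0.
  have := DE (l := o5 4) z4 Dz.
  rewrite eqxx (o4F b4) (eq_sym k) (negPf zk) (eq_sym y) (negPf zy) !scale0r !subr0 sub0r.
  by rewrite scale1r => /eqP; rewrite oppr_eq0 => /eqP.
have := DE kb Dk.
rewrite !eqxx (negPf yk) (o4F k4) !scale0r !subr0 !scale1r => /eqP.
by rewrite subr_eq0 => /eqP.
Qed.

End Singular.

Definition lex_lt (p q : pair5) : bool :=
  ((val p).1 < (val q).1)%N || ((val p).1 == (val q).1) && ((val p).2 < (val q).2)%N.

Lemma exists_leading u : u != 0 ->
  exists2 p, u p != 0 & forall q, lex_lt p q -> u q = 0.
Proof.
move=> u0; have [p0 up0] : exists p, u p != 0.
  apply/existsP; apply: contraNT u0 => /existsPn h; apply/eqP/ffunP => p.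
  by rewrite [RHS]ffunE; apply/eqP; have := h p; rewrite negbK.
pose r (p : pair5) := ((val p).1 * 5 + (val p).2)%N.
case: (arg_maxnP (P := fun p => u p != 0) r up0) => p up pmax.
exists p => // q pq; apply/eqP; apply: contraTT pq => uq; rewrite /lex_lt.
have le : (r q <= r p)%N by exact: (pmax q uq).
move: le; rewrite /r => le; rewrite negb_or negb_and -!leqNgt.
have [p1 p2 q1 q2] : [/\ (val p).1 < 5, (val p).2 < 5, (val q).1 < 5 & (val q).2 < 5]%N.
  by split; exact: ltn_ord.
have le1 : ((val q).1 <= (val p).1)%N.
  rewrite leqNgt; apply/negP => lt; move: le; rewrite leqNgt => /negP; apply.
  apply: (@leq_trans ((val p).1 * 5 + 5)); first by rewrite ltn_add2l.
  by rewrite -mulSnr (leq_trans _ (leq_addr _ _)) // leq_mul2r lt.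
rewrite le1 /=; case: eqP => //= e1; move: le; rewrite e1.
by rewrite leq_add2l.
Qed.

Section LeadingTerm.
Variables (u : {ffun pair5 -> V}) (p : pair5).
Hypotheses (hu : raised u) (up : forall q, lex_lt p q -> u q = 0).
Local Notation i0 := (val p).1.
Local Notation j0 := (val p).2.

Lemma ext_lead0 i j : (i0 < i)%N -> (i0 < j)%N -> ext u i j = 0.
Proof.
have H (k l : 'I_5) : (k < l)%N -> (i0 < k)%N -> ext u k l = 0.
  move=> kl ik; have := ext_val u (exist _ (k, l) kl) => ->.
  by apply: up; rewrite /lex_lt ik.
move=> i0i i0j; case: (ltngtP i j) => [ij|ji|/val_inj ->]; last exact: ext_diag.
  exact: H.
by rewrite extC H // oppr0.
Qed.

Lemma ext_lead1 j : (j0 < j)%N -> ext u i0 j = 0.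
Proof.
move=> jj; have ij : (i0 < j)%N by exact: ltn_trans (valP p) jj.
have := ext_val u (exist _ (i0, j) ij) => ->.
by apply: up; rewrite /lex_lt /= eqxx jj orbT.
Qed.

(** By [raise_ext], a raising operator sends the leading component to components at later pairs,
    which vanish; [raise_ker] applies. *)
Lemma leading_hw : u p != 0 -> exists2 c, c != 0 & u p = c *: v.
Proof.
move=> up0; have [dot dotP] := exists_form hV; have [l _ lE'] := exists_hw C lam.
have v0 : v != 0 by exact/eqP/(irrep_neq0 hV).
have [c uc] : exists c, u p = c *: v.
  apply: (raise_ker glV (eV_irr hV) dotP (eV_hw hV lE') v0) => k m km.
  rewrite -ext_val raise_ext //.
  have -> : (i0 == k)%:R *: ext u m j0 = 0.
    case: eqP => [ik|_]; last by rewrite scale0r.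
    by rewrite ext_lead0 ?scaler0 ?ik // -ik; exact: (valP p).
  case: eqP => [jk|_]; last by rewrite scale0r addr0 oppr0.
  by rewrite ext_lead1 ?jk // scaler0 addr0 oppr0.
by exists c => //; apply: contra_neq up0 => c0; rewrite uc c0 scale0r.
Qed.

(** E_kk contributes the weight. If k < i0, then E_k,i0 is a raising operator and returns the
    leading component by [raise_ext]; if k > i0, it acts on a component beyond [p], which is 0. The
    same holds for j0. *)
Lemma D5_leading (L : 'I_5 -> nat) k c :
  (forall i : 'I_4, (L (lo i) = L (hi i) + tnth lam i)%N) ->
  u p = c *: v -> k != i0 -> k != j0 ->
  D5 a u k k i0 j0 = ((L k + (k < i0) + (k < j0))%N%:R - (\sum_i (L i)%:R) / 5) *: u p.
Proof.
move=> lE' uc ki kj; rewrite /D5 ext_val.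
have -> : e k k (u p) = mu_of C L k *: u p.
  by rewrite uc (glZ glV) (hw_weight (eV_hw hV lE')) !scalerA mulrC.
have -> : e k i0 (ext u j0 k) = (k < i0)%N%:R *: u p.
  have [lt|gt|/val_inj eq] := ltngtP k i0; last by rewrite eq eqxx in ki.
    by rewrite raise_ext // (eq_sym j0) (negPf kj) eqxx scale0r add0r !scale1r extC opprK ext_val.
  by rewrite ext_lead0 ?(gl0 glV) ?scale0r //; exact: (valP p).
have -> : e k j0 (ext u k i0) = (k < j0)%N%:R *: u p.
  have [lt|gt|/val_inj eq] := ltngtP k j0; last by rewrite eq eqxx in kj.
    by rewrite raise_ext // (eq_sym i0) (negPf ki) eqxx scale0r addr0 !scale1r extC opprK ext_val.
  by rewrite extC ext_lead1 ?oppr0 ?(gl0 glV) ?scale0r.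
by rewrite /mu_of !natrD; lincomb.
Qed.

Lemma D5_leading_eq (L : 'I_5 -> nat) k l :
  (forall i : 'I_4, (L (lo i) = L (hi i) + tnth lam i)%N) ->
  u p != 0 -> [/\ k != i0, k != j0, l != i0 & l != j0] ->
  D5 a u k k i0 j0 = D5 a u l l i0 j0 ->
  (L k + (k < i0) + (k < j0) = L l + (l < i0) + (l < j0))%N.
Proof.
move=> lE' up0 [ki kj li lj] E; have [c _ uc] := leading_hw up0.
move: E; rewrite !(D5_leading lE' uc) // => /eqP.
rewrite -subr_eq0 -scalerBl scaler_eq0 (negPf up0) orbF opprB addrA subrK.
by rewrite subr_eq0 eqr_nat => /eqP.
Qed.

(** The leading component is a nonzero multiple of [v], so [raise_to_hw] applies. This is the source
    of the bounds n >= 1 and m >= 1. *)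
Lemma leading_raise (L : 'I_5 -> nat) (k l : 'I_5) (z : V) :
  (forall i : 'I_4, (L (lo i) = L (hi i) + tnth lam i)%N) ->
  u p != 0 -> (k < l)%N -> e k l z = - u p -> L k != L l.
Proof.
move=> lE' up0 kl ez; have [dot dotP] := exists_form hV; have [c c0 uc] := leading_hw up0.
have v0 : v != 0 by exact/eqP/(irrep_neq0 hV).
have : e k l (- c^-1 *: z) = v.
  by rewrite (glZ glV) ez uc scaleNr scalerN opprK scalerA mulVf // scale1r.
move=> /(raise_to_hw glV dotP (eV_hw hV lE') v0 kl).
by apply: contra => /eqP; rewrite /mu_of => ->.
Qed.

End LeadingTerm.

Local Notation la i := (nth 0%N lam i).

Lemma singular_leading u :
  raised u -> D5 a u (o5 4) (o5 0) (o5 1) (o5 2) = 0 -> u != 0 ->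
  exists p, [/\ u p != 0, exists c, u p = c *: v, forall q, lex_lt p q -> u q = 0 &
    [\/ [/\ p = p12, la 2%N = 0%N & la 3%N = 0%N],
        [/\ p = p15, la 1%N = 0%N, la 2%N = 0%N & (0 < la 3%N)%N]
      | [/\ p = p45, la 0 = 0%N, la 1%N = 0%N & (0 < la 2%N)%N]]].
Proof.
move=> hu hD u0; have [p up0 up] := exists_leading u0; exists p.
have [c c0 uc] := leading_hw hu up up0; split=> //; first by exists c.
have [L _ LE] := exists_hw C lam.
have [LE0 LE1 LE2 LE3] := hw_steps LE.
have Q := D5_leading_eq hu up LE up0.
have A := D5_diag_low hu hD.
have B k b y := @D5_diag_high u hu hD k b y.
have R := leading_raise hu up LE up0.
have rz k l i j := @raise_ext u k l i j hu.
have uE := ext_val u p.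
(* [QA] and [QA4] give the equations for pairs p that avoid the index 4, [QB] those for p = (i, 4),
   where only indices below 4 can be compared. *)
have QA k l i j : (val p).1 = i -> (val p).2 = j ->
    (k < 4)%N -> (l < 4)%N -> (i < 4)%N -> (j < 4)%N ->
    [/\ k != i, k != j, l != i & l != j] ->
    (L k + (k < i) + (k < j) = L l + (l < i) + (l < j))%N.
  move=> pi pj k4 l4 i4 j4 [ki kj li lj]; subst i j; apply: Q => //.
  by rewrite !A // eq_sym.
have QA4 k i j : (val p).1 = i -> (val p).2 = j ->
    (k < 4)%N -> (i < 4)%N -> (j < 4)%N -> k != i -> k != j ->
    (L k + (k < i) + (k < j) = L (o5 4) + (4 < i) + (4 < j))%N.
  move=> pi pj k4 i4 j4 ki kj; subst i j; apply: Q => //; last by rewrite A // eq_sym.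
  by split=> //; rewrite -val_eqE /= neq_ltn ?i4 ?j4 orbT.
have QB k l i : (val p).1 = i -> (val p).2 = o5 4 ->
    (k < l)%N -> (l < 4)%N -> (i < 4)%N -> [/\ k != i & l != i] ->
    (L k + (k < i) + (k < 4) = L l + (l < i) + (l < 4))%N.
  move=> pi pj kl l4 i4 [ki li]; subst i; have := Q k l; rewrite pj; apply.
    split=> //; rewrite -val_eqE /= neq_ltn; first by rewrite (ltn_trans kl l4).
    by rewrite l4.
  by apply: B => //; rewrite eq_sym.
have T := And4 isT isT isT isT.
(* For seven of the ten pairs, one equation forces [L] to grow strictly along the indices, although
   it is weakly decreasing. *)
move: QA QA4 QB R uE {Q uc up0 up}; elim/pair5_ind: p => /= QA QA4 QB R uE.
- have := QA (o5 2) (o5 3) _ _ erefl erefl isT isT isT isT T.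
  have /= := QA4 (o5 2) _ _ erefl erefl isT isT isT isT isT => H1 H2.
  by constructor 1; split; [reflexivity|lia|lia].
- by have /= := QA (o5 1) (o5 3) _ _ erefl erefl isT isT isT isT T; lia.
- by have /= := QA4 (o5 2) _ _ erefl erefl isT isT isT isT isT; lia.
- have /= := QB (o5 1) (o5 2) _ erefl erefl isT isT isT (conj isT isT).
  have /= := QB (o5 2) (o5 3) _ erefl erefl isT isT isT (conj isT isT) => H1 H2.
  constructor 2; split; [reflexivity|lia|lia|].
  have := R (o5 3) (o5 4) _ isT (etrans (rz (o5 3) (o5 4) (o5 0) (o5 3) isT) _).
  by rewrite /= scale0r add0r scale1r uE => /(_ erefl); rewrite LE3; lia.
- by have /= := QA (o5 0) (o5 3) _ _ erefl erefl isT isT isT isT T; lia.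
- by have /= := QA (o5 0) (o5 2) _ _ erefl erefl isT isT isT isT T; lia.
- by have /= := QB (o5 0) (o5 2) _ erefl erefl isT isT isT (conj isT isT); lia.
- by have /= := QA4 (o5 1) _ _ erefl erefl isT isT isT isT isT; lia.
- by have /= := QB (o5 1) (o5 3) _ erefl erefl isT isT isT (conj isT isT); lia.
have /= := QB (o5 0) (o5 1) _ erefl erefl isT isT isT (conj isT isT).
have /= := QB (o5 1) (o5 2) _ erefl erefl isT isT isT (conj isT isT) => H1 H2.
constructor 3; split; [reflexivity|lia|lia|].
have := R (o5 2) (o5 3) _ isT (etrans (rz (o5 2) (o5 3) (o5 2) (o5 4) isT) _).
by rewrite /= scale0r addr0 scale1r uE => /(_ erefl); rewrite LE2; lia.
Qed.
End Leading.

(** * The operator c~ *)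

Section Ctilde.
Variables (C : numClosedFieldType) (lam : 4.-tuple nat) (V : vectType C).
Variables (a : E510 C -> V -> V) (v : V).
Hypothesis hV : is_irrep lam a v.
Implicit Types u : {ffun pair5 -> V}.

Local Notation e := (eV a).
Local Notation glV := (eV_gl hV).

Definition mapV (f : V -> V) u : {ffun pair5 -> V} := [ffun q => f (u q)].

Lemma ext_mapV k l u i j : ext (mapV (e k l) u) i j = e k l (ext u i j).
Proof.
apply: (ext_ind (F := fun i j => e k l (ext u i j))) => [x y|q].
  by rewrite (extC u x y) (glN glV).
by rewrite ffunE ext_val.
Qed.

Lemma sum_deltal (X : lmodType C) (k : 'I_5) (F : 'I_5 -> X) :
  \sum_l (l == k)%:R *: F l = F k.
Proof.
rewrite (bigD1 k) //= eqxx scale1r big1 ?addr0 // => l lk.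
by rewrite (negPf lk) scale0r.
Qed.

Lemma sum_deltar (X : lmodType C) (k : 'I_5) (F : 'I_5 -> X) :
  \sum_l (k == l)%:R *: F l = F k.
Proof. by under eq_bigr => l _ do rewrite eq_sym; exact: sum_deltal. Qed.

Lemma tensor_op_xd i j u q : i != j -> tensor_op a (xd C i j) (xd C j i) u q =
  ((val q).1 == i)%:R *: e j i (ext u j (val q).2) +
  ((val q).2 == i)%:R *: e j i (ext u (val q).1 j).
Proof.
move=> ij; rewrite ffunE lE_xd //.
under eq_bigr => p _ do rewrite a_xd 1?eq_sym //.
have /= := wv_lE (delta_mx i j) (mapV (e j i) u) q.
under eq_bigr => p _ do rewrite ffunE.
move=> ->; under eq_bigr => l _ do rewrite !ext_mapV mt_id ?tr_delta ?(negPf ij) // !mxE -!mulnb !natrM -!scalerA.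
rewrite big_split /= -!scaler_sumr !sum_deltal //.
Qed.

Lemma tensor_op_hh i y u q : tensor_op a (hh C i) y u q =
  (((val q).1 == lo i)%:R + ((val q).2 == lo i)%:R
   - (((val q).1 == hi i)%:R + ((val q).2 == hi i)%:R)) *: a y (u q).
Proof.
rewrite ffunE lE_hh; set M := _ - _.
have M0 : \tr M = 0 by rewrite /M linearB /= !tr_delta !eqxx subrr.
have /= := wv_lE M (mapV (a y) u) q.
under eq_bigr => p _ do rewrite ffunE.
move=> ->; set y' := a y (u q).
have E k l : M k l = (k == lo i)%:R * (l == k)%:R - (k == hi i)%:R * (l == k)%:R.
  rewrite /M !mxE -!natrM !mulnb.
  by congr (_%:R - _%:R); case: eqP => // ->.
under eq_bigr => l _ do rewrite mt_id // !E -!mulrBl -!scalerA.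
rewrite big_split /= -!scaler_sumr !sum_deltal.
have -> : ext (mapV (a y) u) (val q).1 (val q).2 = y' by rewrite ext_val ffunE.
by rewrite -scalerDl; congr (_ *: _); ring.
Qed.

Lemma ord4_sum (X : nmodType) (F : 'I_4 -> X) :
  \sum_i F i = F (@Ordinal 4 0 isT) + F (@Ordinal 4 1 isT) + F (@Ordinal 4 2 isT)
             + F (@Ordinal 4 3 isT).
Proof.
rewrite !big_ord_recl big_ord0 addr0 !addrA.
by congr (F _ + F _ + F _ + F _); exact: val_inj.
Qed.

(** The h_i and their h_i^* are dual bases of the traceless diagonal matrices for the trace form, so
    their canonical tensor can be computed with the E_ii when the trace acts by 0. *)
Lemma cartan_tensor (w : 'I_5 -> C) (x : 'I_5 -> V) : \sum_i x i = 0 ->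
  \sum_i (w (lo i) - w (hi i)) *: (\sum_j hstar_coef C i j *: (x (lo j) - x (hi j))) =
  \sum_i w i *: x i.
Proof.
rewrite !sum_o5 => x0; have x4 : x (o5 4) = - (x (o5 0) + x (o5 1) + x (o5 2) + x (o5 3)).
  by apply/eqP; rewrite -addr_eq0 addrC x0.
rewrite !ord4_sum /hstar_coef.
have l0 : lo (@Ordinal 4 0 isT) = o5 0 by exact: val_inj.
have l1 : lo (@Ordinal 4 1 isT) = o5 1 by exact: val_inj.
have l2 : lo (@Ordinal 4 2 isT) = o5 2 by exact: val_inj.
have l3 : lo (@Ordinal 4 3 isT) = o5 3 by exact: val_inj.
have h0 : hi (@Ordinal 4 0 isT) = o5 1 by exact: val_inj.
have h1 : hi (@Ordinal 4 1 isT) = o5 2 by exact: val_inj.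
have h2 : hi (@Ordinal 4 2 isT) = o5 3 by exact: val_inj.
have h3 : hi (@Ordinal 4 3 isT) = o5 4 by exact: val_inj.
rewrite !(l0, l1, l2, l3, h0, h1, h2, h3) /= x4; lincomb_coefs; by field.
Qed.

Lemma a_hstar i (x : V) :
  a (hstar C i) x = \sum_j hstar_coef C i j *: (e (lo j) (lo j) x - e (hi j) (hi j) x).
Proof.
have [_ aL _] := irrep_rep hV.
have a0 : a (lE 0) x = 0.
  have := aL 1 (lE 0) (lE 0) x (lE_Lge0 _) (lE_Lge0 _).
  by rewrite -lE_linear scaler0 addr0 scale1r -{1}[a _ _]addr0 => /addrI/esym.
have l0 : lE (0 : 'M[C]_5) = 0 by exact: (linear0 (mkhom (@lE_linear C))).
suff [N [-> ->]] : exists N, hstar C i = lE N /\ a (lE N) x =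
    \sum_j hstar_coef C i j *: (e (lo j) (lo j) x - e (hi j) (hi j) x) by [].
rewrite /hstar; elim: (index_enum _) => [|j s [N [E1 E2]]].
  by exists 0; rewrite !big_nil a0 l0.
pose H : 'M[C]_5 := delta_mx (lo j) (lo j) - delta_mx (hi j) (hi j).
exists (hstar_coef C i j *: H + N); rewrite !big_cons E1; split.
  by rewrite lE_linear lE_hh.
by rewrite lE_linear aL ?E2; [rewrite -lE_hh (a_hh hV)| exact: lE_Lge0 ..].
Qed.

(** Ten times c~ in antisymmetric coordinates: the sum of E_ij (x) E_ji over all matrix units,
    diagonal ones included. *)
Definition cas u i j : V := \sum_k (e k i (ext u k j) + e k j (ext u i k)).

Lemma ctildeE u q : ctilde a u q = 10^-1 *: cas u (val q).1 (val q).2.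
Proof.
rewrite /ctilde ffunE ffunE; congr (_ *: _).
rewrite !sum_ffunE.
under eq_bigr => i _ do rewrite tensor_op_hh a_hstar.
pose w i : C := ((val q).1 == i)%:R + ((val q).2 == i)%:R.
have /= -> := @cartan_tensor w (fun i => e i i (u q)) (eV_trace hV _).
under [X in _ + X]eq_bigr => p pp do rewrite tensor_op_xd //.
pose G (i j : 'I_5) := ((val q).1 == i)%:R *: e j i (ext u j (val q).2) +
  ((val q).2 == i)%:R *: e j i (ext u (val q).1 j).
transitivity (\sum_i \sum_j G i j); last first.
  rewrite exchange_big; apply: eq_bigr => k _; rewrite /G big_split /=.
  by rewrite (sum_deltar _ (fun i => e k i (ext u k (val q).2)))
             (sum_deltar _ (fun i => e k i (ext u (val q).1 k))).
rewrite pair_big /= [RHS](bigID (fun p : 'I_5 * 'I_5 => p.1 != p.2)) /= [RHS]addrC; congr (_ + _).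
rewrite [RHS](eq_bigl (fun p : 'I_5 * 'I_5 => p.1 == p.2)) => [|p]; last by rewrite negbK.
rewrite -[RHS](pair_big_dep xpredT (fun i j => i == j) G) /=; apply: eq_bigr => i _.
rewrite (big_pred1 i) => [|j]; last exact: eq_sym.
rewrite /G /w scalerDl; congr (_ + _); case: eqP => [<-|]; rewrite ?scale0r // !scale1r.
  by rewrite ext_val.
by rewrite ext_val.
Qed.

(** One half of [cas]. Although not antisymmetric, it is equivariant on its own ([T_Dl]), so
    commutation with [Dl] is checked here. *)
Let T u i j : V := \sum_k e k i (ext u k j).

Let casT u i j : cas u i j = T u i j - T u j i.
Proof.
rewrite /cas big_split /=; congr (_ + _); rewrite -sumrN; apply: eq_bigr => k _.
by rewrite -(glN glV) -extC.
Qed.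

Lemma ext_ctilde u i j : ext (ctilde a u) i j = 10^-1 *: cas u i j.
Proof.
apply: (ext_ind (F := fun i j => 10^-1 *: cas u i j)) => [x y|q]; last exact: ctildeE.
by rewrite !casT -scalerN opprB.
Qed.

Let T_Dl k l u i j : T (Dl e k l u) i j =
  (i == k)%:R *: T u l j + (j == k)%:R *: T u i l - (2 / 5 * (k == l)%:R) *: T u i j
  + e k l (T u i j).
Proof.
have E m : e m i (ext (Dl e k l u) m j) =
    (m == k)%:R *: e m i (ext u l j) + (j == k)%:R *: e m i (ext u m l)
    - (2 / 5 * (k == l)%:R) *: e m i (ext u m j) + e k l (e m i (ext u m j))
    + (i == k)%:R *: e m l (ext u m j) - (m == l)%:R *: e k i (ext u m j).
  rewrite (ext_Dl glV) !(glD glV, glN glV, glZ glV) (gl_swap glV m i k l).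
  by lincomb.
rewrite /T; under eq_bigr => m _ do rewrite E.
rewrite !big_split /= !sumrN -!scaler_sumr (gl_sum glV).
rewrite (sum_deltal _ (fun m => e m i (ext u l j))) (sum_deltal _ (fun m => e k i (ext u m j))).
by rewrite -addrA addrC; lincomb.
Qed.

Lemma ctilde_Dl k l u : ctilde a (Dl e k l u) = Dl e k l (ctilde a u).
Proof.
apply: ext_inj => i j; rewrite (ext_Dl glV) !ext_ctilde !casT !T_Dl.
by rewrite (glZ glV) (glB glV); lincomb.
Qed.

Lemma ctilde_linear : linear (ctilde a).
Proof.
move=> c u u'; apply: ext_inj => i j; rewrite extD extZ !ext_ctilde !casT /T.
have E k x y : e k x (ext (c *: u + u') k y) = c *: e k x (ext u k y) + e k x (ext u' k y).
  by rewrite extD extZ (glD glV) (glZ glV).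
under eq_bigr => k _ do rewrite E; under [X in _ - X]eq_bigr => k _ do rewrite E.
by rewrite !big_split /= -!scaler_sumr; lincomb.
Qed.

Section Form.
Variable dot : V -> V -> C.
Hypothesis dotP : is_cform e dot.

Definition dotW u u' : C := \sum_i \sum_j dot (ext u i j) (ext u' i j).

Lemma dotW_linear c u u' w : dotW (c *: u + u') w = c * dotW u w + dotW u' w.
Proof.
rewrite /dotW mulr_sumr -big_split; apply: eq_bigr => i _ /=.
rewrite mulr_sumr -big_split; apply: eq_bigr => j _ /=.
by rewrite extD extZ (dot_linear dotP).
Qed.

Lemma dotWZr c u u' : dotW u (c *: u') = c^* * dotW u u'.
Proof.
rewrite /dotW mulr_sumr; apply: eq_bigr => i _ /=.
rewrite mulr_sumr; apply: eq_bigr => j _ /=.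
by rewrite extZ (dotZr dotP).
Qed.

Lemma dot_sumr (I : finType) (F : I -> V) x : dot x (\sum_i F i) = \sum_i dot x (F i).
Proof. exact: (big_morph (dot x) (dotDr dotP x) (dot0r dotP x)). Qed.

(** E_ki and E_ik are adjoint on V, and renaming the indices turns each triple sum into its
    counterpart. *)
Lemma ctilde_adj u u' : dotW (ctilde a u) u' = dotW u (ctilde a u').
Proof.
transitivity (10^-1 * \sum_i \sum_j dot (cas u i j) (ext u' i j)).
  rewrite /dotW mulr_sumr; apply: eq_bigr => i _; rewrite mulr_sumr.
  by apply: eq_bigr => j _; rewrite ext_ctilde (dotZl dotP).
transitivity (10^-1 * \sum_i \sum_j dot (ext u i j) (cas u' i j)); last first.
  rewrite /dotW mulr_sumr; apply: eq_bigr => i _; rewrite mulr_sumr.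
  apply: eq_bigr => j _; rewrite ext_ctilde (dotZr dotP).
  by rewrite fmorphV rmorph_nat.
congr (_ * _).
have L (w w' : {ffun pair5 -> V}) : \sum_i \sum_j dot (cas w i j) (ext w' i j) =
    \sum_i \sum_j \sum_k dot (ext w k j) (e i k (ext w' i j)) +
    \sum_i \sum_j \sum_k dot (ext w i k) (e j k (ext w' i j)).
  rewrite -big_split; apply: eq_bigr => i _; rewrite -big_split; apply: eq_bigr => j _ /=.
  rewrite /cas (dot_suml dotP) -big_split; apply: eq_bigr => k _ /=.
  by rewrite (dotDl dotP) !(dot_contra dotP).
rewrite L.
have R : \sum_i \sum_j dot (ext u i j) (cas u' i j) =
    \sum_i \sum_j \sum_k dot (ext u i j) (e k i (ext u' k j)) +
    \sum_i \sum_j \sum_k dot (ext u i j) (e k j (ext u' i k)).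
  rewrite -big_split; apply: eq_bigr => i _; rewrite -big_split; apply: eq_bigr => j _ /=.
  rewrite /cas dot_sumr -big_split; apply: eq_bigr => k _ /=.
  by rewrite (dotDr dotP).
rewrite R; congr (_ + _).
  rewrite exchange_big [RHS]exchange_big; apply: eq_bigr => j _ /=.
  by rewrite exchange_big.
by apply: eq_bigr => i _; rewrite exchange_big.
Qed.

Lemma dotW_pure p (x : V) u : dotW (pure p x) u = 2 * dot x (u p).
Proof.
rewrite /dotW; case E: (val p) (ext_val u p) => [k l] /= up.
have kl : (k, l) != (l, k).
  by apply/eqP => -[kl _]; have := valP p; rewrite E /= kl ltnn.
rewrite pair_big /= (bigD1 (k, l)) //= (bigD1 (l, k)) 1?eq_sym //= big1 ?addr0 => [|[i j]].
  rewrite !ext_pure E !eqxx (eq_sym (l, k)) (negPf kl) subr0 sub0r scale1r scaleN1r.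
  rewrite (extC u k l) up -scaleN1r -[- u p]scaleN1r (dotZl dotP) (dotZr dotP).
  by rewrite rmorphN rmorph1; ring.
move=> /andP[/= /negPf n1 /negPf n2]; rewrite ext_pure E n1.
have -> : ((j, i) == (k, l)) = false.
  by apply/negP => /eqP[jk il]; move: n2; rewrite jk il eqxx.
by rewrite subr0 scale0r (dot0l dotP).
Qed.

End Form.
End Ctilde.

Section Eigenvectors.
Variables (C : numClosedFieldType) (lam : 4.-tuple nat) (V : vectType C).
Variables (a : E510 C -> V -> V) (v : V).
Hypothesis hV : is_irrep lam a v.
Variable L : 'I_5 -> nat.
Hypothesis LE : forall i : 'I_4, L (lo i) = (L (hi i) + tnth lam i)%N.
Implicit Types (u : {ffun pair5 -> V}).

Local Notation e := (eV a).
Local Notation glV := (eV_gl hV).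
Local Notation glW := (Dl_gl glV).
Local Notation mu := (mu_of C L).

Lemma ctilde0 : ctilde a 0 = 0.
Proof. exact: (linear0 (mkhom (ctilde_linear hV))). Qed.

Lemma ctildeZ c u : ctilde a (c *: u) = c *: ctilde a u.
Proof. exact: (linearZ_LR (mkhom (ctilde_linear hV))). Qed.

Lemma ctildeB u u' : ctilde a (u - u') = ctilde a u - ctilde a u'.
Proof. exact: (linearB (mkhom (ctilde_linear hV))). Qed.

Lemma ffunBZ (f g : {ffun pair5 -> V}) (c : C) q : (f - c *: g) q = f q - c *: g q.
Proof. by rewrite !ffunE. Qed.

Lemma pair5_eq (p q : pair5) :
  (val p).1 = (val q).1 -> (val p).2 = (val q).2 -> p = q.
Proof.
by move=> e1 e2; apply/val_inj; rewrite [LHS]surjective_pairing e1 e2 -surjective_pairing.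
Qed.

(* d_ij \otimes x *)
Definition dvec (i j : 'I_5) (x : V) : {ffun pair5 -> V} :=
  [ffun q => (((i, j) == val q)%:R - ((j, i) == val q)%:R : C) *: x].

Lemma ext_dvec i j x k l :
  ext (dvec i j x) k l = (((i, j) == (k, l))%:R - ((j, i) == (k, l))%:R : C) *: x.
Proof.
apply: (ext_ind (F := fun k l => (((i, j) == (k, l))%:R - ((j, i) == (k, l))%:R : C) *: x)).
  by move=> {}k {}l; rewrite !xpair_eqE ![_ && (_ == k)]andbC -scaleNr opprB.
by move=> q; rewrite ffunE -surjective_pairing.
Qed.

Lemma pure_dvec p x : pure p x = dvec (val p).1 (val p).2 x.
Proof.
apply: ext_inj => i j; rewrite ext_pure ext_dvec; case: (val p) => k l /=;
  by rewrite !xpair_eqE !(eq_sym k) !(eq_sym l) [(i == l) && _]andbC.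
Qed.

(* The eigenvalue of c~ on raised vectors of weight lambda + wt(d_xy). *)
Definition kappa (x y : 'I_5) : C := (mu x + mu y + 1 - x%:R - y%:R) / 10.

Definition has_weight (x y : 'I_5) u :=
  forall i, Dl e i i u = (mu i + (x == i)%:R + (y == i)%:R - 2 / 5) *: u.

(** A multiple of [v] placed at [p] has weight mu plus that of d_p, and the weights of the d_p are
    pairwise distinct. *)
Lemma weight_leading x y u p : x != y -> has_weight x y u ->
  u p != 0 -> (exists c, u p = c *: v) ->
  ((val p).1 == x) && ((val p).2 == y) || ((val p).1 == y) && ((val p).2 == x).
Proof.
move=> xy wu up [c uc].
have E i : (((val p).1 == i) + ((val p).2 == i) = (x == i) + (y == i))%N.
  apply/eqP; rewrite -(eqr_nat C) !natrD -subr_eq0.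
  have /ffunP/(_ p) := wu i; rewrite !ffunE.
  have -> : e i i (u p) = mu i *: u p.
    by rewrite uc (glZ glV) (hw_weight (eV_hw hV LE)) !scalerA mulrC.
  rewrite eqxx mulr1 => /eqP; rewrite -subr_eq0.
  have -> : ((val p).1 == i)%:R *: ext u i (val p).2 = ((val p).1 == i)%:R *: u p.
    by case: eqP => [<-|_]; rewrite ?scale0r ?ext_val.
  have -> : ((val p).2 == i)%:R *: ext u (val p).1 i = ((val p).2 == i)%:R *: u p.
    by case: eqP => [<-|_]; rewrite ?scale0r ?ext_val.
  move=> E; suff : ((((val p).1 == i)%:R + ((val p).2 == i)%:R - ((x == i)%:R + (y == i)%:R) : C)
     *: u p == 0) by rewrite scaler_eq0 (negPf up) orbF.
  by rewrite -(eqP E); apply/eqP; lincomb.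
have np : ((val p).1 == (val p).2) = false by rewrite -val_eqE /= ltn_eqF ?(valP p).
have := E (val p).2; have := E (val p).1.
rewrite !eqxx (eq_sym (val p).2 (val p).1) np (eq_sym x (val p).1) (eq_sym y (val p).1).
rewrite (eq_sym x (val p).2) (eq_sym y (val p).2).
case: eqP => [<-|_] /=; first by case: eqP => // _ _; rewrite eq_sym np; case: eqP.
by case: eqP => [<-|_] //= _; rewrite (eq_sym (val p).2 (val p).1) np; case: eqP.
Qed.

(** A nonzero raised vector of this weight has its leading component at the pair of x and y. *)
Lemma raised_weight0 x y u : x != y -> raised a u -> has_weight x y u ->
  ext u x y = 0 -> u = 0.
Proof.
move=> xy ru wu u0; apply/eqP; apply/negPn/negP => /exists_leading[p up0 up].
have [c _ uc] := leading_hw hV ru up up0.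
have /orP[/andP[/eqP p1 /eqP p2]|/andP[/eqP p1 /eqP p2]] :=
  weight_leading xy wu up0 (ex_intro _ c uc).
  by move: up0; rewrite -ext_val p1 p2 u0 eqxx.
by move: up0; rewrite -ext_val p1 p2 extC u0 oppr0 eqxx.
Qed.

(** At the leading pair every term of [cas] is a multiple of u p. The indices k before x and before
    y contribute - x - y, and the index k = x in the second sum contributes 1. *)
Lemma cas_leading u p : raised a u -> (forall q, lex_lt p q -> u q = 0) -> u p != 0 ->
  ctilde a u p = kappa (val p).1 (val p).2 *: u p.
Proof.
have sumE (x y : 'I_5) : \sum_k ((k == x)%:R * mu x - (k < x)%N%:R +
    ((k == y)%:R * mu y - (k < y)%N%:R + (k == x)%:R)) = mu x + mu y + 1 - x%:R - y%:R.
  rewrite sum_o5; elim/ord5_ind: x; elim/ord5_ind: y => /=; ring.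
move=> ru up up0; rewrite (ctildeE hV) /kappa mulrC -scalerA; congr (_ *: _).
have [c _ uc] := leading_hw hV ru up up0.
have eu i : e i i (u p) = mu i *: u p.
  by rewrite uc (glZ glV) (hw_weight (eV_hw hV LE)) !scalerA mulrC.
set x := (val p).1; set y := (val p).2; have xy : (x < y)%N := valP p.
have A k : e k x (ext u k y) = ((k == x)%:R * mu x - (k < x)%N%:R) *: u p.
  have [lt|gt|/val_inj ->] := ltngtP k x.
  - have -> : (k == x) = false by rewrite -val_eqE /= ltn_eqF.
    rewrite (raise_ext hV _ _ ru lt) eqxx (_ : (y == k) = false) ?ext_val; first by rewrite /=; lincomb.
    by rewrite -val_eqE /= gtn_eqF // (ltn_trans lt xy).
  - have [->|ky] := eqVneq k y.
      by rewrite ext_diag (gl0 glV) -val_eqE /= gtn_eqF // mul0r subrr scale0r.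
    by rewrite (ext_lead0 up gt xy) (gl0 glV) -val_eqE /= gtn_eqF // mul0r subrr scale0r.
  by rewrite ext_val eu eqxx; rewrite /=; lincomb.
have B k : e k y (ext u x k) = ((k == y)%:R * mu y - (k < y)%N%:R + (k == x)%:R) *: u p.
  have [lt|gt|/val_inj ->] := ltngtP k y.
  - have -> : (k == y) = false by rewrite -val_eqE /= ltn_eqF.
    rewrite (raise_ext hV _ _ ru lt) eqxx (eq_sym x k) ext_val.
    case: eqVneq => [->|_]; last by rewrite /=; lincomb.
    by rewrite (extC u x) ext_val; rewrite /=; lincomb.
  - have -> : (k == y) = false by rewrite -val_eqE /= gtn_eqF.
    have -> : (k == x) = false by rewrite -val_eqE /= gtn_eqF // (ltn_trans xy gt).
    by rewrite (ext_lead1 up gt) (gl0 glV); rewrite /=; lincomb.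
  have -> : (y == x) = false by rewrite -val_eqE /= gtn_eqF.
  by rewrite ext_val eu eqxx; rewrite /=; lincomb.
rewrite /cas; under eq_bigr => k _ do rewrite A B -scalerDl.
rewrite -scaler_suml sumE; congr (_ *: _).
Qed.

(** The difference of the two sides is raised, has the same weight and vanishes at the leading
    pair. *)
Lemma raised_eigen x y u : x != y -> raised a u -> has_weight x y u ->
  ctilde a u = kappa x y *: u.
Proof.
move=> xy ru wu; have [->|u0] := eqVneq u 0.
  by rewrite scaler0; exact: ctilde0.
have [p up0 up] := exists_leading u0; have [c _ uc] := leading_hw hV ru up up0.
have cp := cas_leading ru up up0.
set w := ctilde a u - kappa (val p).1 (val p).2 *: u.
have pw := weight_leading xy wu up0 (ex_intro _ c uc).
have -> : kappa x y = kappa (val p).1 (val p).2.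
  by case/orP: pw => /andP[/eqP -> /eqP ->] //; rewrite /kappa; ring.
apply/eqP; rewrite -subr_eq0 -/w; apply/eqP; apply: (raised_weight0 xy).
- move=> i j ij; rewrite /w (glB glW) (glZ glW _ _ _ u) -(ctilde_Dl hV) ru //.
  by rewrite scaler0 subr0 ctilde0.
- move=> i; rewrite /w (glB glW) (glZ glW _ _ _ u) -(ctilde_Dl hV) wu.
  by rewrite ctildeZ; lincomb.
have wp : ext w (val p).1 (val p).2 = 0 by rewrite ext_val /w ffunBZ cp subrr.
case/orP: pw => /andP[/eqP <- /eqP <-] //.
by rewrite extC wp oppr0.
Qed.

Lemma Dl_dvec (i j x y : 'I_5) z : (i < j)%N -> Dl e i j (dvec x y z) =
  (j == x)%:R *: dvec i y z + (j == y)%:R *: dvec x i z + dvec x y (e i j z).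
Proof.
move=> ij; apply: ext_inj => k l.
have ijn : (i == j) = false by rewrite -val_eqE /= ltn_eqF.
rewrite (ext_Dl glV) !extD !extZ !ext_dvec ijn (glZ glV) mulr0 scale0r subr0.
rewrite !scalerA -!scalerDl; congr (_ *: _ + _).
rewrite !xpair_eqE (eq_sym k i) (eq_sym l i).
rewrite (eq_sym j x) (eq_sym j y).
do ![case: eqP => /= ?]; by subst; ring.
Qed.

Lemma Dl_dvec_diag i (x y : 'I_5) : Dl e i i (dvec x y v) =
  (mu i + (x == i)%:R + (y == i)%:R - 2 / 5) *: dvec x y v.
Proof.
apply: ext_inj => k l.
rewrite (ext_Dl glV) !extZ !ext_dvec eqxx (glZ glV) (hw_weight (eV_hw hV LE)).
rewrite !scalerA -!scalerDl -scalerBl -scalerDl; congr (_ *: _).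
rewrite !xpair_eqE (eq_sym k i) (eq_sym l i) (eq_sym x i) (eq_sym y i).
do ![case: eqP => /= ?]; subst => //=; by ring.
Qed.

End Eigenvectors.

(** * Products of factors of the form c~ - x *)

Section SpectralProducts.
Variables (C : numClosedFieldType) (lam : 4.-tuple nat) (V : vectType C).
Variables (a : E510 C -> V -> V) (v : V).
Hypothesis hV : is_irrep lam a v.
Variable L : 'I_5 -> nat.
Hypothesis LE : forall i : 'I_4, L (lo i) = (L (hi i) + tnth lam i)%N.
Implicit Types (u : {ffun pair5 -> V}) (i j k l : 'I_5).

Local Notation e := (eV a).
Local Notation glV := (eV_gl hV).
Local Notation glW := (Dl_gl glV).
Local Notation mu := (mu_of C L).
Local Notation kappa := (kappa C L).

Definition spec_prod (xs : seq C) u := foldr (fun (x : C) (y : {ffun pair5 -> V}) => ctilde a y - x *: y) u xs.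

Lemma spec_prod_linear xs : linear (spec_prod xs).
Proof.
move=> c u u'; elim: xs => //= x xs ->.
by rewrite (ctilde_linear hV); lincomb.
Qed.

Lemma spec_prod0 xs : spec_prod xs 0 = 0.
Proof. exact: (linear0 (mkhom (spec_prod_linear xs))). Qed.

Lemma spec_prodD xs u u' : spec_prod xs (u + u') = spec_prod xs u + spec_prod xs u'.
Proof. exact: (linearD (mkhom (spec_prod_linear xs))). Qed.

Lemma spec_prodZ xs c u : spec_prod xs (c *: u) = c *: spec_prod xs u.
Proof. exact: (linearZ_LR (mkhom (spec_prod_linear xs))). Qed.

Lemma spec_prod_Dl xs i j u : Dl e i j (spec_prod xs u) = spec_prod xs (Dl e i j u).
Proof.
elim: xs => //= x xs IH.
by rewrite (glB glW) (glZ glW _ _ _ (spec_prod xs u)) -(ctilde_Dl hV) IH.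
Qed.

(** The factors commute, so any of them can be made the outermost one. *)
Lemma spec_prod_rem (x : C) xs u : x \in xs -> spec_prod xs u =
  ctilde a (spec_prod (rem x xs) u) - x *: spec_prod (rem x xs) u.
Proof.
elim: xs => //= y xs IH; rewrite inE; case: eqVneq => [->//|xy] /= xs_x.
rewrite (IH xs_x); set w := spec_prod _ u.
rewrite (ctildeB hV (ctilde a w) (x *: w)) (ctildeB hV (ctilde a w) (y *: w)).
by rewrite (ctildeZ hV x w) (ctildeZ hV y w); move: (ctilde a _) (ctilde a _) => s1 s2; lincomb.
Qed.

Lemma L_mono (i j : 'I_5) : (i <= j)%N -> (L j <= L i)%N.
Proof.
have [L0 L1 L2 L3] := hw_steps LE.
by elim/ord5_ind: i; elim/ord5_ind: j => //= _; lia.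
Qed.

(** [L] is weakly decreasing, so [kappa] grows strictly when an index is lowered. Only comparable
    pairs have provably distinct eigenvalues. *)
Lemma kappa_neq (x y x' y' : 'I_5) : (x' <= x)%N -> (y' <= y)%N ->
  (x' != x) || (y' != y) -> kappa x' y' != kappa x y.
Proof.
move=> lx ly ne; rewrite /kappa -subr_eq0 -mulrBl mulf_eq0 invr_eq0 pnatr_eq0 orbF.
have -> : mu x' + mu y' + 1 - x'%:R - y'%:R - (mu x + mu y + 1 - x%:R - y%:R) =
   (L x' + L y' + x + y)%N%:R - (L x + L y + x' + y')%N%:R :> C.
  by rewrite !natrD /mu_of; ring.
rewrite subr_eq0 eqr_nat; have := L_mono lx; have := L_mono ly.
have : (x' < x)%N || (y' < y)%N by rewrite !ltn_neqAle lx ly -!val_eqE !andbT in ne *.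
lia.
Qed.

(** Index pairs in either order are included, because a raising operator may carry one index of d_xy
    past the other. *)
Definition below (x y : 'I_5) (xs : seq C) := forall x' y' : 'I_5,
  (x' <= x)%N -> (y' <= y)%N -> x' != y' -> kappa x' y' \in xs.

Definition strictly_below (x y : 'I_5) (xs : seq C) := forall x' y' : 'I_5,
  (x' <= x)%N -> (y' <= y)%N -> (x' != x) || (y' != y) -> x' != y' -> kappa x' y' \in xs.

Lemma dvec0 (x y : 'I_5) : dvec x y (0 : V) = 0.
Proof. by apply: ext_inj => i j; rewrite ext_dvec scaler0 ext0. Qed.

Lemma dvec_diag (x : 'I_5) : dvec x x v = 0 :> {ffun pair5 -> V}.
Proof. by apply: ext_inj => i j; rewrite ext_dvec subrr scale0r ext0. Qed.

Lemma spec_prod_weight (x y : 'I_5) xs : has_weight a L x y (spec_prod xs (dvec x y v)).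
Proof.
by move=> i; rewrite spec_prod_Dl (Dl_dvec_diag hV LE) spec_prodZ.
Qed.

Lemma spec_prod_step (x y : 'I_5) xs :
  (forall i, (i < x)%N -> spec_prod xs (dvec i y v) = 0) ->
  (forall i, (i < y)%N -> spec_prod xs (dvec x i v) = 0) ->
  raised a (spec_prod xs (dvec x y v)).
Proof.
move=> hx hy i j ij; rewrite spec_prod_Dl (Dl_dvec hV) // (hw_raise (eV_hw hV LE)) //.
rewrite dvec0 addr0 spec_prodD !spec_prodZ.
have -> : (j == x)%:R *: spec_prod xs (dvec i y v) = 0.
  by case: eqP => [jx|_]; rewrite ?scale0r // hx ?scaler0 // -jx.
by rewrite add0r; case: eqP => [jy|_]; rewrite ?scale0r // hy ?scaler0 // -jy.
Qed.

Lemma strictly_belowl (x y i : 'I_5) xs : (i < x)%N -> strictly_below x y xs -> below i y xs.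
Proof.
move=> ix xsP x' y' lx ly ne; apply: xsP => //; first by rewrite (leq_trans lx) // ltnW.
by rewrite -val_eqE /= ltn_eqF // (leq_ltn_trans lx).
Qed.

Lemma strictly_belowr (x y i : 'I_5) xs : (i < y)%N -> strictly_below x y xs -> below x i xs.
Proof.
move=> iy xsP x' y' lx ly ne; apply: xsP => //; first by rewrite (leq_trans ly) // ltnW.
by rewrite -[y' == y]val_eqE /= (ltn_eqF (leq_ltn_trans ly iy)) orbT.
Qed.

Lemma spec_prod_below (x y : 'I_5) xs : below x y xs -> spec_prod xs (dvec x y v) = 0.
Proof.
have [n] := ubnP (x + y)%N; elim: n x y xs => // n IH x y xs; rewrite ltnS => xyn xsP.
have [->|xy] := eqVneq x y.
  by rewrite dvec_diag spec_prod0.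
rewrite (spec_prod_rem _ (xsP x y (leqnn _) (leqnn _) xy)).
(* Only the value kappa x y is removed, and by [kappa_neq] it is not among the values at strictly
   smaller pairs. *)
set xs' := rem _ _; have xs'P : strictly_below x y xs'.
  move=> x' y' lx ly ne ne'; have := xsP _ _ lx ly ne'.
  have := kappa_neq lx ly ne; rewrite /xs'.
  elim: (xs) => //= z zs IHz kk; rewrite inE; case: (eqVneq z (kappa x y)) => [->|zne].
    by rewrite (negPf kk).
  by rewrite inE => /orP[->//|/(IHz kk) ->]; rewrite orbT.
have ru : raised a (spec_prod xs' (dvec x y v)).
  apply: spec_prod_step => i ix; apply: IH.
  - by rewrite (leq_trans _ xyn) // ltn_add2r.
  - exact: strictly_belowl xs'P.
  - by rewrite (leq_trans _ xyn) // ltn_add2l.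
  exact: strictly_belowr xs'P.
rewrite (raised_eigen hV LE xy ru) ?subrr //; exact: spec_prod_weight.
Qed.

Lemma spec_prod_raised (x y : 'I_5) xs : strictly_below x y xs -> raised a (spec_prod xs (dvec x y v)).
Proof.
move=> xsP; apply: spec_prod_step => i ix; apply: spec_prod_below.
  exact: strictly_belowl xsP.
exact: strictly_belowr xsP.
Qed.

Lemma spec_prod_adj (dot : V -> V -> C) (x : C) xs u u' : is_cform e dot -> ctilde a u' = x *: u' ->
  dotW dot (spec_prod xs u) u' = (\prod_(y <- xs) (x^* - y)) * dotW dot u u'.
Proof.
move=> dotP cu'; elim: xs => [|y xs IH] /=; first by rewrite big_nil mul1r.
rewrite big_cons -mulrA -IH addrC -scaleNr (dotW_linear dotP) (ctilde_adj hV dotP) cu'.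
by rewrite (dotWZr dotP); ring.
Qed.

End SpectralProducts.

(** * Weights and the central character *)

Section Weights.
Variable K : numFieldType.
Implicit Types (s t : weight) (p q r : pair5).

Let Hst : 'M[K]_4 := \matrix_(i, j) hstar_coef K i j.

(** The h_i^* have as coordinates the rows of the inverse Cartan matrix. *)
Let cartan_hstar : map_mx intr cartan *m Hst = 1%:M.
Proof.
apply/matrixP => i j; rewrite mxE ord4_sum !mxE /hstar_coef.
case: i => [[|[|[|[|i]]]] //= ilt]; case: j => [[|[|[|[|j]]]] //= jlt];
  rewrite ?(rmorphN, rmorph1, rmorph0) /=; by field.
Qed.

Let cartan_unit : map_mx intr cartan \in (unitmx : {pred 'M[K]_4}).
Proof. by have [] := mulmx1_unit cartan_hstar. Qed.

Let invmx_cartan : invmx (map_mx intr cartan) = Hst.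
Proof. by rewrite -[RHS]mul1mx -(mulVmx cartan_unit) -mulmxA cartan_hstar mulmx1. Qed.

Lemma gram_cartan : gram K = 10^-1 *: map_mx intr cartan.
Proof.
apply/matrixP => i j; rewrite !mxE; case: eqP => _; last case: ifP => _.
- by rewrite rmorph_nat; field.
- by rewrite rmorphN rmorph1 mulrN mulr1.
by rewrite rmorph0 mulr0.
Qed.

Lemma hstar_coefC i j : hstar_coef K i j = hstar_coef K j i.
Proof. by case: i => [[|[|[|[|i]]]] //= ilt]; case: j => [[|[|[|[|j]]]] //= jlt]. Qed.

(* The coefficient of sroot k in s. *)
Definition ht (k : 'I_4) s : K := \sum_j hstar_coef K j k * (s 0 j)%:~R.

Lemma wformE s t : wform K s t = 10^-1 * \sum_j ht j s * (t 0 j)%:~R.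
Proof.
rewrite /wform /root_coord gram_cartan -scalemxAr -scalemxAl mxE; congr (_ * _).
set A := map_mx _ cartan.
rewrite (mulmxKV cartan_unit) trmx_mul invmx_cartan mulmxA mxE; apply: eq_bigr => j _.
rewrite !mxE; congr (_ * _); apply: eq_bigr => i _; rewrite !mxE hstar_coefC; ring.
Qed.

Lemma wformC s t : wform K s t = wform K t s.
Proof.
rewrite !wformE /ht; congr (_ * _).
under eq_bigr => j _ do rewrite mulr_suml; under [RHS]eq_bigr => j _ do rewrite mulr_suml.
rewrite exchange_big; apply: eq_bigr => i _; apply: eq_bigr => j _.
by rewrite hstar_coefC; ring.
Qed.

Lemma htD k s t : ht k (s + t) = ht k s + ht k t.
Proof.
rewrite /ht -big_split; apply: eq_bigr => j _ /=.
by rewrite mxE rmorphD mulrDr.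
Qed.

Lemma ht0 k : ht k 0 = 0.
Proof. by rewrite /ht big1 // => j _; rewrite mxE mulr0. Qed.

Lemma htMn k s n : ht k (s *+ n) = ht k s *+ n.
Proof. by elim: n => [|n IH]; rewrite ?mulr0n ?ht0 // !mulrS htD IH. Qed.

Lemma wformDl s s' t : wform K (s + s') t = wform K s t + wform K s' t.
Proof.
rewrite !wformE -mulrDr -big_split; congr (_ * _); apply: eq_bigr => j _ /=.
by rewrite htD mulrDl.
Qed.

Lemma wformDr s t t' : wform K s (t + t') = wform K s t + wform K s t'.
Proof. by rewrite wformC wformDl !(wformC s). Qed.

Lemma ht_sroot k i : ht k (sroot i) = (i == k)%:R.
Proof.
have /matrixP/(_ i k) := cartan_hstar; rewrite !mxE => <-.
by apply: eq_bigr => j _; rewrite !mxE mulrC.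
Qed.

Lemma ht_wt_dx k (i : 'I_5) : ht k (wt_dx i) = (i <= k)%N%:R - k.+1%:R / 5.
Proof.
rewrite /ht ord4_sum !mxE /hstar_coef.
elim/ord5_ind: i; case: k => [[|[|[|[|k]]]] //= klt];
  rewrite ?(subrr, sub0r, subr0, rmorphN, rmorph1, rmorph0) /=; by field.
Qed.

Lemma wt_dx_sum (x y : 'I_5) : (x <= y)%N ->
  wt_dx x - wt_dx y = \sum_i sroot i *+ (x <= i < y)%N.
Proof.
move=> xy; apply/matrixP => i j; rewrite ord1 ord4_sum {i} !mxE.
move: xy; elim/ord5_ind: x; elim/ord5_ind: y => //= _;
  case: j => [[|[|[|[|j]]]] //= jlt]; by rewrite !(mulr0n, mulr1n) !mxE.
Qed.

(** Up to a constant, the coefficient of the k-th simple root in wt p counts the indices of [p] that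
    are at most k. Comparing the counts at the two indices of [p] gives both inequalities. *)
Lemma wt_leP p r : reflect ((val r).1 <= (val p).1 /\ (val r).2 <= (val p).2)%N
  (wt_le (wt p) (wt r)).
Proof.
apply: (iffP idP) => [/asboolP[n E]|[h1 h2]]; last first.
  apply/asboolP; exists (fun i => ((val r).1 <= i < (val p).1) + ((val r).2 <= i < (val p).2))%N.
  rewrite /wt opprD addrACA !wt_dx_sum // -big_split.
  by apply: eq_bigr => i _; rewrite /= mulrnDr.
have H (k : 'I_4) : (((val r).1 <= k) + ((val r).2 <= k) = ((val p).1 <= k) + ((val p).2 <= k) + n k)%N.
  apply/eqP; rewrite -(eqr_nat K) !natrD.
  have : ht k (wt r) = ht k (wt p) + (n k)%:R.
    rewrite -[wt r](subrK (wt p)) E addrC htD; congr (_ + _).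
    rewrite (big_morph (ht k) (htD k) (ht0 k)) (bigD1 k) //= big1 ?addr0 => [|i ik].
      by rewrite htMn ht_sroot eqxx.
    by rewrite htMn ht_sroot (negPf ik) mul0rn.
  rewrite /wt !htD !ht_wt_dx => E'; apply/eqP.
  apply: (@addIr _ (- (k.+1%:R / 5) - k.+1%:R / 5)).
  rewrite addrACA E'; ring.
have p1 : ((val p).1 < 4)%N.
  by apply: leq_trans (valP p) _; rewrite -ltnS; exact: ltn_ord.
have pF : ((val p).2 <= (val p).1)%N = false by rewrite leqNgt (valP p).
have := H (Ordinal p1); rewrite /= leqnn pF /= => H1.
have := valP r; rewrite /= => r12; split; first by move: H1; case: leqP => //; lia.
case: (ltnP (val p).2 4) => [p2|p2]; last by rewrite (leq_trans _ p2) // -ltnS ltn_ord.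
have := H (Ordinal p2); have := valP p; rewrite /= leqnn.
by case: (leqP (val r).2 (val p).2) => //; case: leqP; case: leqP => /=; lia.
Qed.

Lemma wt_inj : injective wt.
Proof.
move=> p r E; have le t : wt_le t t.
  apply/asboolP; exists (fun=> 0%N); rewrite subrr big1 // => i _; exact: mulr0n.
have /wt_leP[h1 h2] : wt_le (wt p) (wt r) by rewrite E.
have /wt_leP[h3 h4] : wt_le (wt r) (wt p) by rewrite E.
by apply/val_inj/eqP; rewrite -pair_eqE /pair_eq -!val_eqE /= !eqn_leq h1 h2 h3 h4.
Qed.

Lemma omega2_wt : omega2 = wt p12.
Proof.
apply/matrixP => i j; rewrite ord1 !mxE {i}.
by case: j => [[|[|[|[|j]]]] //= jlt].
Qed.

End Weights.

Section CentralCharacter.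
Variables (C : numClosedFieldType) (lam : 4.-tuple nat) (L : 'I_5 -> nat).
Hypothesis LE : forall i : 'I_4, L (lo i) = (L (hi i) + tnth lam i)%N.

Lemma chi_wt q : chi C (to_weight lam) (wt q) = kappa C L (val q).1 (val q).2.
Proof.
have [LE0 LE1 LE2 LE3] := hw_steps LE.
have -> : chi C (to_weight lam) (wt q) = 2^-1 *
   (wform C (wt q) (wt q) + 2 * wform C (wt q) (to_weight lam) + 2 * wform C (wt q) delta
    - wform C (wt p12) (wt p12) - 2 * wform C (wt p12) delta).
  rewrite /chi omega2_wt mulr2n; move: (wt q) (wt p12) (to_weight lam) => s t l'.
  rewrite !(wformDl, wformDr) (wformC C l' s).
  by congr (_ * _); ring.
rewrite !wformE !ord4_sum /wt !htD !ht_wt_dx.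
have E i : ((to_weight lam) 0 i)%:~R = (nth 0%N lam i)%:R :> C.
  by rewrite mxE (tnth_nth 0%N).
have E' i : (delta 0 i)%:~R = 1 :> C by rewrite mxE.
rewrite !E !E' /kappa /mu_of sum_o5.
have F (i : 'I_5) j : ((wt_dx i) 0 j)%:~R = (i == lo j)%:R - (i == hi j)%:R :> C.
  by rewrite mxE rmorphB !rmorph_nat.
have FD (i i' : 'I_5) j : ((wt_dx i + wt_dx i') 0 j)%:~R =
    (i == lo j)%:R - (i == hi j)%:R + ((i' == lo j)%:R - (i' == hi j)%:R) :> C.
  by rewrite -!F -rmorphD /= mxE.
rewrite !FD; elim/pair5_ind: q => /=; rewrite LE0 LE1 LE2 LE3 !natrD; by field.
Qed.

End CentralCharacter.

(** * Explicit singular vectors *)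

Section SingularVectors.
Variables (C : numClosedFieldType) (lam : 4.-tuple nat) (V : vectType C).
Variables (a : E510 C -> V -> V) (v : V).
Hypothesis hV : is_irrep lam a v.
Variable L : 'I_5 -> nat.
Hypothesis LE : forall i : 'I_4, L (lo i) = (L (hi i) + tnth lam i)%N.
Implicit Types (u : {ffun pair5 -> V}) (b i j k l x y : 'I_5).

Local Notation e := (eV a).
Local Notation glV := (eV_gl hV).
Local Notation mu := (mu_of C L).
Local Notation hw := (eV_hw hV LE).

Lemma lower_eq0 i j : (i < j)%N -> mu i = mu j -> e j i v = 0.
Proof. have [dot dotP] := exists_form hV; exact: (lower_hw0 glV dotP hw). Qed.

Definition antisym (F : 'I_5 -> 'I_5 -> V) : {ffun pair5 -> V} :=
  [ffun q => F (val q).1 (val q).2 - F (val q).2 (val q).1].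

Lemma ext_antisym F i j : ext (antisym F) i j = F i j - F j i.
Proof.
apply: (ext_ind (F := fun i j => F i j - F j i)) => [x y|q]; first by rewrite opprB.
by rewrite ffunE.
Qed.

Lemma antisym_raised F :
  (forall k l i j, (k < l)%N -> i != j ->
     e k l (F i j) + (i == k)%:R *: F l j + (j == k)%:R *: F i l =
     e k l (F j i) + (j == k)%:R *: F l i + (i == k)%:R *: F j l) ->
  raised a (antisym F).
Proof.
move=> H k l kl; apply: ext_inj => i j; rewrite ext0.
have [->|ij] := eqVneq i j; first exact: ext_diag.
rewrite (ext_Dl glV) !ext_antisym (_ : k == l = false); last by rewrite -val_eqE /= ltn_eqF.
rewrite (glB glV) -[RHS](subrr (e k l (F i j) + (i == k)%:R *: F l j + (j == k)%:R *: F i l)).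
by rewrite [in X in _ = _ - X]H //= mulr0; lincomb.
Qed.

Lemma antisym_weight F x y :
  (forall i j k, e i i (F j k) =
     (mu i + (x == i)%:R + (y == i)%:R - (j == i)%:R - (k == i)%:R) *: F j k) ->
  has_weight a L x y (antisym F).
Proof.
move=> H i; apply: ext_inj => j k.
rewrite (ext_Dl glV) extZ !ext_antisym (glB glV) !H.
have E (z : 'I_5) (G : 'I_5 -> V) : (z == i)%:R *: G i = (z == i)%:R *: G z.
  by case: eqP => [->|]; rewrite ?scale0r.
rewrite (E j (fun j => F j k - F k j)) (E k (fun k => F j k - F k j)) eqxx /=.
by lincomb.
Qed.

(* With i, j in 1, ..., 5 as in the paper, the two singular vectors below are
     \sum_j d_1j (E_5j - c \delta_j5) v   and
     \sum_(i, j) d_ij (E_4i - (c + 1) \delta_i4) (E_5j - c \delta_j5) v.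
   The shifts by c cancel the diagonal terms produced by the raising operators. *)
Definition low4 (c : C) b : V := e (o5 4) b v - (b == o5 4)%:R *: (c *: v).

Lemma low4_raise c k l b : (k < l)%N -> e k l (low4 c b) + (b == k)%:R *: low4 c l =
  (l == o5 4)%:R *: (e k b v - (k == b)%:R *: (c *: v)).
Proof.
move=> kl; rewrite /low4 (glB glV) !(glZ glV) (gl_swap glV) (hw_raise hw) // (gl0 glV).
by rewrite (eq_sym b k); lincomb.
Qed.

Lemma low4_weight c i b :
  e i i (low4 c b) = (mu i + (o5 4 == i)%:R - (b == i)%:R) *: low4 c b.
Proof.
rewrite /low4 (glB glV) !(glZ glV) (gl_swap glV) (hw_weight hw) (glZ glV).
have -> : (i == o5 4)%:R *: e i b v = (i == o5 4)%:R *: e (o5 4) b v.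
  by case: eqP => [->|]; rewrite ?scale0r.
have -> : (i == b)%:R *: e (o5 4) i v = (i == b)%:R *: e (o5 4) b v.
  by case: eqP => [->|]; rewrite ?scale0r.
rewrite (eq_sym i b) (eq_sym (o5 4) i).
case: (eqVneq b (o5 4)) => [->|_]; last by rewrite /=; lincomb.
by rewrite (eq_sym i) /=; lincomb.
Qed.

Section Case15.
Hypotheses (mu1 : mu (o5 1) = mu (o5 3)) (mu2 : mu (o5 2) = mu (o5 3)).

Definition vec15 : {ffun pair5 -> V} :=
  antisym (fun i j => (i == o5 0)%:R *: low4 (mu (o5 3)) j).

(** The indices 1, 2, 3 have equal weights, so the gl_3 on them acts on [v] by multiples of the
    trace; the other E_kb in this range are raising operators. *)
Let low0 k b : (k < 4)%N -> b != o5 0 -> e k b v - (k == b)%:R *: (mu (o5 3) *: v) = 0.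
Proof.
move=> k4 b0; have mE i : i != o5 0 -> (i < 4)%N -> mu i = mu (o5 3).
  by elim/ord5_ind: i.
have b_gt0 : (0 < b)%N by rewrite lt0n.
have [kb|bk|/val_inj kb] := ltngtP k b.
- by rewrite (hw_raise hw) // -val_eqE /= ltn_eqF // scale0r subrr.
- rewrite lower_eq0 // -?val_eqE /= ?gtn_eqF // ?scale0r ?subrr //.
  rewrite mE // ?(ltn_trans bk) // mE // -val_eqE /=.
  by rewrite -lt0n (ltn_trans b_gt0).
by rewrite kb (hw_weight hw) eqxx scale1r mE ?subrr // -kb.
Qed.

Lemma vec15_raised : raised a vec15.
Proof.
apply: antisym_raised => k l i j kl ij.
have H x y : x != y -> e k l ((x == o5 0)%:R *: low4 (mu (o5 3)) y) +
    (x == k)%:R *: ((l == o5 0)%:R *: low4 (mu (o5 3)) y) +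
    (y == k)%:R *: ((x == o5 0)%:R *: low4 (mu (o5 3)) l) = 0.
  move=> xy; have -> : l == o5 0 = false by rewrite -val_eqE /= gtn_eqF // (leq_trans _ kl).
  rewrite scale0r scaler0 addr0 (glZ glV) scalerA mulrC -scalerA -scalerDr low4_raise //.
  case: (eqVneq x (o5 0)) => [x0|_]; last by rewrite scale0r.
  case: (eqVneq l (o5 4)) => [l4|_]; last by rewrite scale0r scaler0.
  by rewrite low0 ?scaler0 // ?l4 // -?x0 1?eq_sym //; move: kl; rewrite l4.
by rewrite !H // eq_sym.
Qed.

Lemma vec15_weight : has_weight a L (o5 0) (o5 4) vec15.
Proof.
apply: antisym_weight => i j k; rewrite (glZ glV) low4_weight.
case: (eqVneq j (o5 0)) => [->|_]; last by rewrite !scale0r scaler0.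
by rewrite /=; lincomb.
Qed.

Lemma vec15_D5 : D5 a vec15 (o5 4) (o5 0) (o5 1) (o5 2) = 0.
Proof.
rewrite /D5 !ext_antisym /low4 /= !(scale0r, scale1r, subr0, sub0r, oppr0) (gl0 glV) (glN glV).
by rewrite (gl_swap glV _ _ _ (o5 1)) /=; lincomb.
Qed.

Lemma vec15_lead : vec15 p15 = (mu (o5 4) - mu (o5 3)) *: v.
Proof.
rewrite -ext_val ext_antisym /low4 /= (hw_weight hw); lincomb.
Qed.

End Case15.

Section Case45.
Hypotheses (mu0 : mu (o5 0) = mu (o5 2)) (mu1 : mu (o5 1) = mu (o5 2)).
Local Notation c := (mu (o5 2)).
Local Notation w := (low4 c).

Definition vec45 : {ffun pair5 -> V} :=
  antisym (fun i j => e (o5 3) i (w j) - ((c + 1) * (i == o5 3)%:R) *: w j).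

Let low0 k b : (k < 3)%N -> e k b v = ((k == b)%:R * c) *: v.
Proof.
move=> k3; have mE i : (i < 3)%N -> mu i = c by elim/ord5_ind: i.
have [kb|bk|/val_inj kb] := ltngtP k b.
- by rewrite (hw_raise hw) // -val_eqE /= ltn_eqF // mul0r scale0r.
- rewrite lower_eq0 // -?val_eqE /= ?gtn_eqF // ?mul0r ?scale0r //.
  by rewrite !mE // (ltn_trans bk).
by rewrite -kb (hw_weight hw) eqxx mul1r mE.
Qed.

(** The failure of equivariance is concentrated at l = 3 and at (k, l) = (3, 4). The shifts c and c
    + 1 differ by one so that both defects are symmetric in i and j, and antisymmetrization removes
    them. *)
Lemma vec45_raised : raised a vec45.
Proof.
apply: antisym_raised => k l i j kl ij.
pose r b := (l == o5 4)%:R *: (e k b v - (k == b)%:R *: (c *: v)).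
have wr b : e k l (w b) = r b - (b == k)%:R *: w l.
  by rewrite /r -low4_raise //; lincomb.
have H x y : e k l (e (o5 3) x (w y) - ((c + 1) * (x == o5 3)%:R) *: w y) +
    (x == k)%:R *: (e (o5 3) l (w y) - ((c + 1) * (l == o5 3)%:R) *: w y) +
    (y == k)%:R *: (e (o5 3) x (w l) - ((c + 1) * (x == o5 3)%:R) *: w l) =
    e (o5 3) x (r y) - ((c + 1) * (x == o5 3)%:R) *: r y
    + (l == o5 3)%:R *: (e k x (w y) - ((k == x)%:R * (c + 1)) *: w y).
  rewrite (glB glV k l (e (o5 3) x (w y))) (glZ glV k l _ (w y)) (gl_swap glV k l) wr.
  rewrite (glB glV (o5 3) x (r y)) (glZ glV (o5 3) x _ (w l)) (eq_sym x k).
  by lincomb.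
rewrite !H {H}.
have k3 : l == o5 3 -> (k < 3)%N by move=> /eqP l3; move: kl; rewrite l3.
case: (eqVneq l (o5 3)) k3 => [l3 /(_ isT) k3|_ _].
  have r0 b : r b = 0 by rewrite /r l3 scale0r.
  rewrite !r0 !(gl0 glV) !scale1r /low4 !(glB glV) !(glZ glV) !(gl_swap glV k).
  have lk y : e k y v = ((k == y)%:R * c) *: v by exact: low0.
  by rewrite !lk !(glZ glV); lincomb.
rewrite !scale0r !addr0 /r; case: (eqVneq l (o5 4)) => [l4|_]; last first.
  by rewrite !scale0r !(gl0 glV) !scaler0.
rewrite !scale1r; have [k3|k3] := ltnP k 3.
  have z b : e k b v - (k == b)%:R *: (c *: v) = 0 by rewrite low0 // scalerA subrr.
  by rewrite !z !(gl0 glV) !scaler0.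
have -> : k = o5 3 by apply/val_inj/eqP; rewrite eqn_leq k3 andbT -ltnS; move: kl; rewrite l4.
rewrite !(glB glV) !(glZ glV) (gl_swap glV _ _ _ j) !(eq_sym (o5 3)); lincomb.
Qed.

Lemma vec45_weight : has_weight a L (o5 3) (o5 4) vec45.
Proof.
apply: antisym_weight => i j k.
rewrite (glB glV) (glZ glV) (gl_swap glV i i) low4_weight (glZ glV).
have -> : (i == o5 3)%:R *: e i j (w k) = (i == o5 3)%:R *: e (o5 3) j (w k).
  by case: eqP => [->|]; rewrite ?scale0r.
have -> : (i == j)%:R *: e (o5 3) i (w k) = (i == j)%:R *: e (o5 3) j (w k).
  by case: eqP => [->|]; rewrite ?scale0r.
rewrite (eq_sym i j) (eq_sym (o5 3) i).
case: (eqVneq j (o5 3)) => [->|_]; last by rewrite /=; lincomb.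
by rewrite (eq_sym i) /=; lincomb.
Qed.

Lemma vec45_D5 : D5 a vec45 (o5 4) (o5 0) (o5 1) (o5 2) = 0.
Proof.
have c43 x y z : x != o5 3 -> y != o5 4 -> e (o5 4) x (e (o5 3) y z) = e (o5 3) y (e (o5 4) x z).
  move=> /negPf x3 /negPf y4; rewrite (gl_swap glV) x3 (eq_sym (o5 4) y) y4.
  by rewrite !scale0r subrr addr0.
have c44 x y z : x != o5 4 -> y != o5 4 -> e (o5 4) x (e (o5 4) y z) = e (o5 4) y (e (o5 4) x z).
  move=> /negPf x4 /negPf y4; rewrite (gl_swap glV) x4 (eq_sym (o5 4) y) y4.
  by rewrite !scale0r subrr addr0.
have E x y : (x < 3)%N -> (y < 3)%N ->
    ext vec45 x y = e (o5 3) x (e (o5 4) y v) - e (o5 3) y (e (o5 4) x v).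
  move=> x3 y3; rewrite ext_antisym /low4 -!val_eqE /= !ltn_eqF ?(leqW x3, leqW y3) //=.
  by rewrite !(scale0r, mulr0, subr0).
rewrite /D5 !E // !(glB glV) (c43 (o5 0)) // (c43 (o5 0)) // !(c43 (o5 1)) // !(c43 (o5 2)) //.
rewrite (c44 (o5 1) (o5 0)) // (c44 (o5 2) (o5 0)) // (c44 (o5 2) (o5 1)) //.
by lincomb.
Qed.

Lemma vec45_lead : vec45 p45 =
  ((mu (o5 3) - c - 1) * (mu (o5 4) - c) - (mu (o5 3) - mu (o5 4))) *: v.
Proof.
rewrite -ext_val ext_antisym /low4 /=.
rewrite !(glB glV) !(glZ glV) (gl_swap glV (o5 3) (o5 4) (o5 4) (o5 3)).
rewrite (hw_raise hw (i := o5 3) (j := o5 4)) // !(hw_weight hw) !(glZ glV) !(hw_weight hw) (gl0 glV).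
by rewrite /=; lincomb.
Qed.

End Case45.
End SingularVectors.

(** * Singular vectors of degree one *)

Section DegreeOne.
Variables (C : numClosedFieldType) (lam : 4.-tuple nat) (V : vectType C).
Variables (a : E510 C -> V -> V) (v : V).
Hypothesis hV : is_irrep lam a v.
Implicit Types (u w : {ffun pair5 -> V}) (i j k l x y : 'I_5) (p q r : pair5).

Local Notation e := (eV a).
Local Notation glV := (eV_gl hV).
Local Notation glW := (Dl_gl glV).
Local Notation la i := (nth 0%N lam i).

Section Product.
Variable L : 'I_5 -> nat.
Hypothesis LE : forall i : 'I_4, L (lo i) = (L (hi i) + tnth lam i)%N.
Local Notation mu := (mu_of C L).
Local Notation chl s := (chi C (to_weight lam) s).

Definition above p : seq weight :=
  [seq s <- weights2 | wt_lt (wt p) s && wt_le s omega2].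

Lemma ctilde_prodE p u : ctilde_prod a lam (wt p) u =
  (\prod_(s <- above p) (chl (wt p) - chl s)^-1) *: spec_prod a [seq chl s | s <- above p] u.
Proof.
rewrite /ctilde_prod -/(above p); elim: (above p) => [|s S IH] /=.
  by rewrite big_nil scale1r.
rewrite IH big_cons; set z := spec_prod _ _ _; rewrite (ctildeZ hV _ z).
by move: (ctilde a z) => y; lincomb.
Qed.

Lemma mem_above p r : (wt r \in above p) =
  [&& p != r, ((val r).1 <= (val p).1)%N & ((val r).2 <= (val p).2)%N].
Proof.
have r_w : wt r \in weights2.
  by rewrite mem_undup map_f // mem_enum.
have r_le : wt_le (wt r) omega2.
  rewrite omega2_wt; apply/(wt_leP C); split=> //=.
  by apply: leq_trans (valP r); rewrite ltnS.
rewrite mem_filter r_w r_le !andbT /wt_lt (inj_eq (wt_inj C)); congr (_ && _).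
exact/(wt_leP C)/andP.
Qed.

Lemma aboveP p s : s \in above p -> exists r, s = wt r.
Proof.
by rewrite mem_filter mem_undup => /andP[_ /mapP[r _ ->]]; exists r.
Qed.

Lemma chi_above_neq p s : s \in above p -> chl s != chl (wt p).
Proof.
move=> sp; have [r rs] := aboveP sp; move: sp; rewrite rs mem_above => /and3P[pr h1 h2].
rewrite !(chi_wt C LE); apply: (kappa_neq C LE) => //; rewrite -negb_and.
by apply: contra pr => /andP[/eqP e1 /eqP e2]; apply/eqP/pair5_eq.
Qed.

Lemma above_strictly_below p :
  strictly_below L (val p).1 (val p).2 [seq chl s | s <- above p].
Proof.
move=> x y xp yp ne xy; have [lt|gt|/val_inj xy'] := ltngtP x y; last by rewrite xy' eqxx in xy.
  pose r : pair5 := exist _ (x, y) lt; apply/mapP; exists (wt r); last by rewrite (chi_wt C LE).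
  rewrite mem_above /= xp yp /= andbT.
  by apply/negP => /eqP pr; move: ne; rewrite pr /= !eqxx.
pose r : pair5 := exist _ (y, x) gt; apply/mapP; exists (wt r).
  rewrite mem_above /= (ltnW (leq_trans gt xp)) (ltnW (leq_ltn_trans xp (valP p))) /= andbT.
  apply/negP => /eqP pr; have := leq_ltn_trans xp (valP p); rewrite pr /=.
  by rewrite ltnn.
by rewrite (chi_wt C LE) /kappa /=; ring.
Qed.

Lemma kappa_conj x y : (kappa C L x y)^* = kappa C L x y.
Proof.
rewrite /kappa /mu_of fmorph_div !(rmorphD, rmorphB, rmorphN, rmorph1, rmorph_nat) /=.
by rewrite !fmorph_div rmorph_nat !raddf_sum /=; under eq_bigr => i _ do rewrite rmorph_nat.
Qed.

Lemma ctilde_prod_eq p w c : raised a w -> has_weight a L (val p).1 (val p).2 w ->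
  c != 0 -> w p = c *: v ->
  exists2 d, d != 0 & ctilde_prod a lam (wt p) (pure p v) = d *: w.
Proof.
move=> rw ww c0 wp; have [dot dotP] := exists_form hV.
have v0 : v != 0 by exact/eqP/(irrep_neq0 hV).
have pp : (val p).1 != (val p).2 by rewrite -val_eqE /= neq_ltn (valP p).
rewrite ctilde_prodE; set xs := map _ _; set d := \prod_(s <- _) _.
have d0 : d != 0.
  rewrite /d prodf_seq_neq0; apply/allP => s sp /=.
  by rewrite invr_eq0 subr_eq0 eq_sym chi_above_neq.
set y := spec_prod a xs _.
have yr : raised a y.
  by rewrite /y pure_dvec; exact: (spec_prod_raised hV LE (@above_strictly_below p)).
have yw : has_weight a L (val p).1 (val p).2 y.
  by rewrite /y pure_dvec; exact: (spec_prod_weight hV LE).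
(* The pairing of [y] with [w] is 2 c^* (v, v) times differences between the eigenvalue of [w] and
   those at strictly larger weights. *)
have y0 : y != 0.
  have cw := raised_eigen hV LE pp rw ww.
  have := spec_prod_adj hV xs (pure p v) dotP cw; rewrite -/y => E.
  apply/eqP => y0; move/eqP: E; rewrite y0.
  have -> : dotW dot 0 w = 0.
    by rewrite /dotW big1 // => i _; rewrite big1 // => j _; rewrite ext0 (dot0l dotP).
  rewrite (dotW_pure dotP) wp (dotZr dotP) eq_sym !mulf_eq0 conjC_eq0 (negPf c0) pnatr_eq0 /=.
  have /negPf -> : dot v v != 0 by apply: contra_neq v0; exact: (dot_def dotP).
  rewrite orbF; apply/negP; rewrite big_map prodf_seq_neq0.
  apply/allP => s sp /=; rewrite kappa_conj -(chi_wt C LE) subr_eq0 eq_sym.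
  exact: chi_above_neq.
have [q yq yq0] := exists_leading y0; have [c' c'0 yc] := leading_hw hV yr yq0 yq.
have qp : q = p.
  have /orP[] := weight_leading hV LE pp yw yq (ex_intro _ c' yc).
    by move=> /andP[/eqP e1 /eqP e2]; exact: pair5_eq.
  move=> /andP[/eqP e1 /eqP e2]; have := valP q; rewrite /= e1 e2 => lt.
  by have := valP p; rewrite /= ltnNge ltnW.
exists (d * (c' / c)); first by rewrite !mulf_neq0 ?invr_eq0.
rewrite -scalerA; congr (_ *: _); apply/eqP; rewrite -subr_eq0; apply/eqP.
apply: (raised_weight0 hV LE pp).
- move=> i j ij; rewrite (glB glW) (glZ glW _ _ _ w) yr // rw //.
  by rewrite scaler0 subrr.
- by move=> i; rewrite (glB glW) (glZ glW _ _ _ w) yw ww; lincomb.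
by rewrite ext_val ffunBZ wp -qp yc scalerA divfK // subrr.
Qed.

End Product.

Section Induced.
Variables (U : algType C) (iota : E510 C -> U) (hU : is_enveloping iota).
Variables (M : lmodType C) (aM : U -> M -> M) (ten : U -> V -> M).
Hypothesis hM : is_induced iota a aM ten.

Lemma deg1Z c u : deg1 iota ten (c *: u) = c *: deg1 iota ten u.
Proof.
have [_ tR _] := ind_bal hM; rewrite /deg1 scaler_sumr; apply: eq_bigr => p _.
by rewrite ffunE; exact: (linearZ_LR (mkhom (tR _))).
Qed.

Lemma deg1_pure p z : deg1 iota ten (pure p z) = ten (iota (dd C p)) z.
Proof.
have [_ tR _] := ind_bal hM; rewrite /deg1 (bigD1 p) //= ffunE eqxx big1 ?addr0 // => q qp.
by rewrite ffunE (negPf qp); exact: (linear0 (mkhom (tR _))).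
Qed.

Lemma raised_simple u : (forall i : 'I_4, Dl e (lo i) (hi i) u = 0) -> raised a u.
Proof.
move=> H i j ij; have [n jE] : exists n, (j = i + n.+1 :> nat)%N.
  by exists (j - i).-1; rewrite prednK ?subn_gt0 // subnKC // ltnW.
elim: n j jE {ij} => [|n IH] j jE.
  have i4 : (i < 4)%N by rewrite -ltnS (leq_trans _ (ltn_ord j)) // jE addn1.
  have := H (Ordinal i4); have -> : lo (Ordinal i4) = i by exact: val_inj.
  have -> // : hi (Ordinal i4) = j by apply: val_inj; rewrite /= jE addn1.
have m4 : (i + n.+1 < 4)%N by rewrite -ltnS (leq_trans _ (ltn_ord j)) // jE !addnS.
have m5 := ltnW m4.
pose m : 'I_5 := lo (Ordinal m4).
have mj : Dl e m j u = 0.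
  by have := H (Ordinal m4); have -> : hi (Ordinal m4) = j by apply: val_inj; rewrite /= jE !addnS.
have := gl_comm glW i m m j u; rewrite mj IH // !(gl0 glW) subrr eqxx scale1r.
have -> : i == j = false by rewrite -val_eqE /= jE -[X in X == _]addn0 eqn_add2l.
by rewrite scale0r subr0.
Qed.

Lemma singular_deg1 u : singular (fun z => aM (iota z)) (deg1 iota ten u) <->
  [/\ u != 0, raised a u & D5 a u (o5 4) (o5 0) (o5 1) (o5 2) = 0].
Proof.
have [t1 d1] := ten1_deg1_inj hV hU hM; have [_ tR _] := ind_bal hM.
have d0 : deg1 iota ten 0 = 0 by rewrite -[0](scale0r 0) deg1Z scale0r.
have lh (i : 'I_4) : lo i != hi i by rewrite -val_eqE /= neq_ltn /bump /= add1n ltnSn.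
split=> [[u0 ur uD]|[u0 ur uD]]; split.
- by apply/eqP => uE; apply: u0; rewrite uE.
- apply: raised_simple => i; apply: d1; rewrite -(act_deg1 hU hM) -lE_xd //.
- by apply: t1; rewrite -(act_x5d45 hV hU hM).
- by move/d1/eqP; rewrite (negPf u0).
- by move=> i; rewrite lE_xd // (act_deg1 hU hM) ur // -?d0 //= /bump /= add1n.
by rewrite (act_x5d45 hV hU hM) uD; exact: (linear0 (mkhom (tR _))).
Qed.

End Induced.
End DegreeOne.

(** * Assembling the classification *)

Section Classification.
Variables (C : numClosedFieldType) (lam : 4.-tuple nat) (V : vectType C).
Variables (a : E510 C -> V -> V) (v : V).
Hypothesis hV : is_irrep lam a v.
Implicit Types (u w : {ffun pair5 -> V}) (i j k l x y : 'I_5) (p q r : pair5).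

Local Notation e := (eV a).
Local Notation glV := (eV_gl hV).
Local Notation glW := (Dl_gl glV).
Local Notation la i := (nth 0%N lam i).
Local Notation D0 u := (D5 a u (o5 4) (o5 0) (o5 1) (o5 2) = 0).

Lemma D5BZ u w (c : C) b x y z : D5 a (u - c *: w) b x y z = D5 a u b x y z - c *: D5 a w b x y z.
Proof.
by rewrite /D5 !extD !extN !extZ !(glB glV) !(glZ glV); lincomb.
Qed.

Lemma D5Z u (c : C) b x y z : D5 a (c *: u) b x y z = c *: D5 a u b x y z.
Proof. by rewrite /D5 !extZ !(glZ glV); lincomb. Qed.

Lemma sing12 : la 2 = 0%N -> la 3 = 0%N -> raised a (pure p12 v) /\ D0 (pure p12 v).
Proof.
have [L _ LE] := exists_hw C lam; have [L0 L1 L2 L3] := hw_steps LE => l2 l3; split.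
  move=> i j ij; rewrite pure_dvec (Dl_dvec hV) // (hw_raise (eV_hw hV LE)) // dvec0 addr0 /=.
  move: ij; elim/ord5_ind: i; elim/ord5_ind: j => //= _;
    by rewrite ?dvec_diag ?scale0r ?scale1r ?addr0 ?scaler0.
rewrite /D5 !ext_pure /= subrr !(subr0, scale0r, scale1r, add0r) !(gl0 glV) !add0r.
by rewrite (lower_eq0 hV LE) // /mu_of L2 L3 l2 l3 !addn0.
Qed.

Lemma exists_sing15 : la 1 = 0%N -> la 2 = 0%N -> (0 < la 3)%N ->
  exists w, [/\ raised a w, D0 w, exists2 c, c != 0 & w p15 = c *: v &
    exists2 d, d != 0 & ctilde_prod a lam (wt p15) (pure p15 v) = d *: w].
Proof.
have [L _ LE] := exists_hw C lam; have [L0 L1 L2 L3] := hw_steps LE => l1 l2 l3; exists (vec15 a v L).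
have m1 : mu_of C L (o5 1) = mu_of C L (o5 3) by rewrite /mu_of L1 L2 l1 l2 !addn0.
have m2 : mu_of C L (o5 2) = mu_of C L (o5 3) by rewrite /mu_of L2 l2 !addn0.
have c0 : mu_of C L (o5 4) - mu_of C L (o5 3) != 0.
  rewrite subr_eq0 /mu_of; apply/negP => /eqP/addIr/eqP; rewrite eqr_nat L3; lia.
have wr := vec15_raised hV LE m1 m2; have wl := vec15_lead hV LE.
split; [by []|exact: vec15_D5 hV L|by eexists; [exact: c0|exact: wl]|].
have ww : has_weight a L (val p15).1 (val p15).2 (vec15 a v L) := vec15_weight hV LE.
exact: (@ctilde_prod_eq _ _ _ _ _ hV _ LE p15 _ _ wr ww c0 wl).
Qed.

Lemma exists_sing45 : la 0 = 0%N -> la 1 = 0%N -> (0 < la 2)%N ->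
  exists w, [/\ raised a w, D0 w, exists2 c, c != 0 & w p45 = c *: v &
    exists2 d, d != 0 & ctilde_prod a lam (wt p45) (pure p45 v) = d *: w].
Proof.
have [L _ LE] := exists_hw C lam; have [L0 L1 L2 L3] := hw_steps LE => l0 l1 l2; exists (vec45 a v L).
have m0 : mu_of C L (o5 0) = mu_of C L (o5 2) by rewrite /mu_of L0 L1 l0 l1 !addn0.
have m1 : mu_of C L (o5 1) = mu_of C L (o5 2) by rewrite /mu_of L1 l1 !addn0.
set c := (mu_of C L (o5 3) - mu_of C L (o5 2) - 1) * (mu_of C L (o5 4) - mu_of C L (o5 2))
  - (mu_of C L (o5 3) - mu_of C L (o5 4)).
have c0 : c != 0.
  (* In this form the scalar is visibly nonzero exactly when the third entry of [lam] is
     positive. *)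
  have -> : c = (la 2 * (la 2 + la 3 + 1))%N%:R.
    by rewrite /c /mu_of L2 L3 natrM !natrD; ring.
  by rewrite pnatr_eq0 muln_eq0 negb_or -lt0n l2 addn1.
have wr := vec45_raised hV LE m0 m1; have wl := vec45_lead hV LE.
split; [by []|exact: vec45_D5 hV L|by eexists; [exact: c0|exact: wl]|].
have ww : has_weight a L (val p45).1 (val p45).2 (vec45 a v L) := vec45_weight hV LE.
exact: (@ctilde_prod_eq _ _ _ _ _ hV _ LE p45 _ _ wr ww c0 wl).
Qed.

(** A suitable multiple of [w] cancels the component of [u] at [p], and [H] leaves only 0 for the
    difference. *)
Lemma singular_unique p u w :
  (forall z, raised a z -> D0 z -> z != 0 -> z p != 0) ->
  raised a u -> D0 u -> raised a w -> D0 w ->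
  (exists c, u p = c *: v) -> (exists2 c, c != 0 & w p = c *: v) ->
  exists c, u = c *: w.
Proof.
move=> H ur uD wr wD [c uc] [d d0 wd]; exists (c / d); apply/eqP; rewrite -subr_eq0.
apply/negPn/negP => z0.
have zr : raised a (u - (c / d) *: w).
  by move=> i j ij; rewrite (glB glW) (glZ glW _ _ _ w) ur // wr // scaler0 subrr.
have zD : D0 (u - (c / d) *: w) by rewrite D5BZ uD wD scaler0 subrr.
have := H _ zr zD z0.
by rewrite ffunBZ uc wd scalerA divfK // subrr eqxx.
Qed.

Lemma singular_case15 u : la 1 = 0%N -> la 2 = 0%N -> (0 < la 3)%N ->
  u != 0 -> raised a u -> D0 u -> (exists c, u p15 = c *: v) ->
  exists2 c, c != 0 & u = c *: ctilde_prod a lam (wt p15) (pure p15 v).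
Proof.
move=> l1 l2 l3 u0 ur uD up; have [w [wr wD wp [d d0 ->]]] := exists_sing15 l1 l2 l3.
have [|c uc] := singular_unique _ ur uD wr wD up wp.
  move=> z zr zD z0; have [q [zq _ _]] := singular_leading hV zr zD z0.
  by case=> [[_ _ l3']|[<- _ _ _]|[_ _ _ l2']] //; [rewrite l3' in l3|rewrite l2 in l2'].
exists (c / d); last by rewrite scalerA divfK.
by rewrite mulf_neq0 ?invr_eq0 //; apply: contra_neq u0 => c0; rewrite uc c0 scale0r.
Qed.

Lemma singular_case45 u : la 0 = 0%N -> la 1 = 0%N -> (0 < la 2)%N ->
  u != 0 -> raised a u -> D0 u -> (exists c, u p45 = c *: v) ->
  exists2 c, c != 0 & u = c *: ctilde_prod a lam (wt p45) (pure p45 v).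
Proof.
move=> l0 l1 l2 u0 ur uD up; have [w [wr wD wp [d d0 ->]]] := exists_sing45 l0 l1 l2.
have [|c uc] := singular_unique _ ur uD wr wD up wp.
  move=> z zr zD z0; have [q [zq _ _]] := singular_leading hV zr zD z0.
  by case=> [[_ l2' _]|[_ _ l2' _]|[<- _ _ _]] //; rewrite l2' in l2.
exists (c / d); last by rewrite scalerA divfK.
by rewrite mulf_neq0 ?invr_eq0 //; apply: contra_neq u0 => c0; rewrite uc c0 scale0r.
Qed.

Lemma singularZ w (c : C) : c != 0 -> raised a w -> D0 w -> (exists p, w p != 0) ->
  [/\ c *: w != 0, raised a (c *: w) & D0 (c *: w)].
Proof.
move=> c0 wr wD [p wp]; split.
- rewrite scaler_eq0 (negPf c0) /=; apply: contra_neq wp => ->; exact: ffunE.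
- by move=> i j ij; rewrite (glZ glW _ _ _ w) wr // scaler0.
by rewrite D5Z wD scaler0.
Qed.

Lemma lam_nth : lam = [tuple la 0; la 1; la 2; la 3].
Proof. by apply/val_inj; case: lam => -[|x0 [|x1 [|x2 [|x3 [|]]]]]. Qed.

End Classification.

Theorem theorem5p3 (R : realType) (lam : 4.-tuple nat)
    (V : vectType R[i]) (a : E510 R[i] -> V -> V) (v : V)
    (hV : is_irrep lam a v)
    (U : algType R[i]) (iota : E510 R[i] -> U) (hU : is_enveloping iota)
    (M : lmodType R[i]) (aM : U -> M -> M) (ten : U -> V -> M)
    (hM : is_induced iota a aM ten) (xi : M) :
  ((exists u : {ffun pair5 -> V}, xi = deg1 iota ten u) /\
   singular (fun x => aM (iota x)) xi)
  <->
  exists2 c : R[i], c != 0 &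
    [\/ (exists m n : nat, lam = [tuple m; n; 0%N; 0%N]) /\
          xi = c *: ten (iota (dd R[i] p12)) v,
        (exists m n : nat, (1 <= n)%N /\ lam = [tuple m; 0%N; 0%N; n]) /\
          xi = c *: deg1 iota ten
                      (ctilde_prod a lam (wt p15) (pure p15 v))
      | (exists m n : nat, (1 <= m)%N /\ lam = [tuple 0%N; 0%N; m; n]) /\
          xi = c *: deg1 iota ten
                      (ctilde_prod a lam (wt p45) (pure p45 v))].
Proof.
have v0 : v != 0 by exact/eqP/(irrep_neq0 hV).
split=> [[[u ->]]|[c c0]].
  move=> /(singular_deg1 hV hU hM)[u0 ur uD].
  have [p [up0 up ul]] := singular_leading hV ur uD u0.
  case=> [[pE l2 l3]|[pE l1 l2 l3]|[pE l0 l1 l2]]; rewrite {}pE in up0 up ul.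
  - have [c uc] := up; exists c.
      by apply: contra_neq up0 => c0; rewrite uc c0 scale0r.
    constructor 1; split.
      by exists (nth 0%N lam 0), (nth 0%N lam 1); rewrite [LHS]lam_nth l2 l3.
    rewrite -(deg1_pure hM) -(deg1Z hM); congr deg1; apply/ffunP => q.
    rewrite !ffunE; case: eqP => [->//|/eqP q12]; rewrite scaler0; apply: ul.
    by elim/pair5_ind: q q12.
  - have [c c0 ->] := singular_case15 hV l1 l2 l3 u0 ur uD up; exists c => //.
    constructor 2; split; last exact: (deg1Z hM).
    by exists (nth 0%N lam 0), (nth 0%N lam 3); rewrite [LHS]lam_nth l1 l2.
  have [c c0 ->] := singular_case45 hV l0 l1 l2 u0 ur uD up; exists c => //.
  constructor 3; split; last exact: (deg1Z hM).
  by exists (nth 0%N lam 2), (nth 0%N lam 3); rewrite [LHS]lam_nth l0 l1.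
case=> [[[m [n lE]] ->]|[[m [n [n1 lE]]] ->]|[[m [n [m1 lE]]] ->]].
- rewrite -(deg1_pure hM) -(deg1Z hM); split; first by eexists.
  have [||wr wD] := sing12 hV; rewrite ?lE //.
  apply/(singular_deg1 hV hU hM)/(singularZ hV) => //.
  by exists p12; rewrite ?ffunE ?eqxx.
- rewrite -(deg1Z hM); split; first by eexists.
  have [|||w [wr wD [d d0 wp] [d' d'0 ->]]] := exists_sing15 hV; rewrite ?lE //.
  rewrite scalerA; apply/(singular_deg1 hV hU hM)/(singularZ hV) => //.
    by rewrite mulf_neq0.
  by exists p15; rewrite // wp scaler_eq0 negb_or d0.
rewrite -(deg1Z hM); split; first by eexists.
have [|||w [wr wD [d d0 wp] [d' d'0 ->]]] := exists_sing45 hV; rewrite ?lE //.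
rewrite scalerA; apply/(singular_deg1 hV hU hM)/(singularZ hV) => //.
  by rewrite mulf_neq0.
by exists p45; rewrite // wp scaler_eq0 negb_or d0.
Qed.
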